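(* Let $p>0$ and let $n$ be a positive integer. Consider the MEMS problem \[ \Delta u+\frac{\lambda}{(1-u)^p}=0 \quad (|x|<1,\ x\in\mathbb{R}^n),\qquad u=0 \ \text{ on } |x|=1, \] with $w$, $\lambda(t)$ and $u_t$ as in the context. Then: (i) If $t_n>0$ satisfies $\lambda'(t_n)=0$ (a singular solution), then $\lambda''(t_n)\ne 0$. (ii) When one follows the solution curve in the direction of increasing $u(0)$, i.e. increasing $t$, the Morse index of the solution increases by one at each turn. That is, at each $t_n$ with $\lambda'(t_n)=0$, the Morse index of $u_t$ for $t$ slightly larger than $t_n$ exceeds by one the Morse index of $u_t$ for $t$ slightly smaller than $t_n$.
   Context: Solutions satisfy $0<u<1$; they are radial and decreasing in $|x|$. Let $w(t)$ be the solution of \[ w''+\frac{n-1}{t}w'=\frac{1}{w^p},\qquad w(0)=1,\quad w'(0)=0, \] which is positive and increasing and defined for all $t>0$. The solution set is the curve $t\mapsto(\lambda(t),u_t)$, $t\in(0,\infty)$, where \[ \lambda(t)=\frac{t^2}{w(t)^{p+1}},\qquad u_t(x)=1-\frac{w(t|x|)}{w(t)}. \] In particular $u_t(0)=1-1/w(t)$ is increasing in $t$. A turn is a value of $t$ at which $\lambda'(t)$ changes sign. The Morse index of $u_t$ is the number of negative eigenvalues $\mu$ of \[ \Delta\omega+\lambda(t)\frac{p}{(1-u_t)^{p+1}}\omega+\mu\omega=0 \ \text{ in } |x|<1,\qquad \omega=0 \text{ on } |x|=1. \] *)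

(* Defs.v *)
From HB Require Import structures.
From mathcomp Require Import all_boot all_order all_algebra.
From mathcomp Require Import all_classical all_reals all_analysis.
Set Implicit Arguments. Unset Strict Implicit. Unset Printing Implicit Defensive.
Import Order.TTheory GRing.Theory Num.Theory.
Import numFieldNormedType.Exports.
Local Open Scope classical_set_scope.
Local Open Scope ring_scope.

Section MEMS.
Variable R : realType.

(* Euclidean norm on R^n (the library norm on matrices is the max norm). *)
Definition enorm (n : nat) (x : 'rV[R]_n) : R := Num.sqrt (\sum_(i < n) x 0 i ^+ 2).

Definition ebasis (n : nat) (i : 'I_n) : 'rV[R]_n := delta_mx 0 i.

Definition laplacian (n : nat) (f : 'rV[R]_n -> R) (x : 'rV[R]_n) : R :=
  \sum_(i < n) derive (fun y => derive f y (ebasis i)) x (ebasis i).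

Definition lam (p : R) (w : R -> R) (t : R) : R := t ^+ 2 / (w t) `^ (p + 1).

Definition u_sol (n : nat) (w : R -> R) (t : R) (x : 'rV[R]_n) : R :=
  1 - w (t * enorm x) / w t.

(* potential lambda(t) p / (1 - u_t)^(p+1) of the linearized operator *)
Definition potential (n : nat) (p : R) (w : R -> R) (t : R) (x : 'rV[R]_n) : R :=
  lam p w t * p / (1 - u_sol w t x) `^ (p + 1).

Definition dirichlet_eigenfunction (n : nat) (p : R) (w : R -> R) (t mu : R)
    (f : 'rV[R]_n -> R) : Prop :=
  {within [set x | enorm x <= 1], continuous f} /\
  (forall x, enorm x < 1 ->
     differentiable f x /\
     forall i, differentiable (fun y => derive f y (ebasis i)) x) /\
  (forall x, enorm x < 1 ->
     laplacian f x + potential p w t x * f x + mu * f x = 0) /\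
  (forall x, enorm x = 1 -> f x = 0).

Definition lin_indep_ball (n k : nat) (fs : 'I_k -> 'rV[R]_n -> R) : Prop :=
  forall c : 'I_k -> R,
    (forall x, enorm x < 1 -> \sum_(i < k) c i * fs i x = 0) ->
    forall i, c i = 0.

Definition neg_eigen_family (n : nat) (p : R) (w : R -> R) (t : R) (k : nat)
    (fs : 'I_k -> 'rV[R]_n -> R) : Prop :=
  (forall i, exists mu, mu < 0 /\ dirichlet_eigenfunction p w t mu (fs i)) /\
  lin_indep_ball fs.

(* Morse index of u_t equals k: number of negative eigenvalues counted with
   multiplicity = maximal number of linearly independent eigenfunctions with
   negative eigenvalues. *)
Definition morse_index_is (n : nat) (p : R) (w : R -> R) (t : R) (k : nat) : Prop :=
  (exists fs : 'I_k -> 'rV[R]_n -> R, neg_eigen_family p w t fs) /\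
  ~ (exists fs : 'I_k.+1 -> 'rV[R]_n -> R, neg_eigen_family p w t fs).

Definition is_w (n : nat) (p : R) (w : R -> R) : Prop :=
  w 0 = 1 /\
  (w x @[x --> (0:R)^'+] --> (1:R)) /\
  ((w h - w 0) / h @[h --> (0:R)^'+] --> (0:R)) /\
  (forall t, 0 < t -> 0 < w t) /\
  (forall t, 0 < t -> derivable w t 1 /\ derivable (derive1 w) t 1) /\
  (forall t, 0 < t ->
     derive1n 2 w t + (n%:R - 1) / t * derive1 w t = 1 / (w t) `^ p).

End MEMS.

(* Main.v *)
Require Import Defs.
From HB Require Import structures.
From mathcomp Require Import all_boot all_order all_algebra.
From mathcomp Require Import all_classical all_reals all_analysis.
From mathcomp Require Import ring lra.
Import Order.TTheory GRing.Theory Num.Theory.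
Import numFieldNormedType.Exports.
Local Open Scope classical_set_scope.
Local Open Scope ring_scope.

Set Implicit Arguments.
Unset Strict Implicit.

(* In the variable r = t |x| the radial linearized equation with eigenvalue
   t^2 nu becomes F'' + ((n-1)/r) F' + (p / w^(p+1) + nu) F = 0, which no longer
   depends on t; let Phi nu be its solution with F(0) = 1, F'(0) = 0.  By the
   scaling invariance of the equation for w, Phi 0 = w - ((p+1)/2) r w', and
   lambda' = 2 t w^(-p-2) Phi 0; so the singular solutions are the zeros of
   Phi 0, which are simple, whence (i).  An eigenfunction with negative
   eigenvalue is radial: its odd part under a reflection, divided by a
   perturbation of the derivative of u_t across the mirror, would violate the
   maximum principle on a half ball.  Hence it is a multiple of Phi nu (t |x|)
   with nu < 0 and Phi nu t = 0.  By Sturm's comparison theorem and the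
   continuity of Phi in nu, the number of such nu equals the number of zeros of
   Phi 0 in ]0, t[, and this number increases by one when t crosses a zero. *)

(** * Derivatives of real functions *)

(** An eigenfunction is known to be twice differentiable only inside the ball and continuous up to
    the sphere, and [is_w] describes [w] at the origin by one-sided limits. The argument is
    therefore pointwise: monotone auxiliary quantities, the maximum principle and sign changes take
    the place of integration by parts and of a variational description of the spectrum. The number
    of zeros of [Phi nu] in []0, t[] grows with [nu], is 0 for [nu <= - p], and can change only when
    a zero passes through [t], because zeros are simple. Hence the infimum of the [nu] with at least
    k + 1 zeros satisfies [Phi nu t = 0] with exactly k zeros before [t], which produces as many
    eigenvalues as needed. Conversely, two radial eigenfunctions with the same [nu] are
    proportional, so multiplicities are 1 and independent eigenfunctions have distinct parameters,
    each of which costs [Phi 0] a zero. In the symmetry step a derivative of [u_t] solves the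
    linearized equation with eigenvalue 0 and has one sign on a half ball, but it vanishes on the
    mirror; a quotient by it alone would not be controlled there. *)

Section Calculus.
Context {R : realType}.
Implicit Types (f g : R -> R) (x a b : R).

Lemma is_derive_cst1 (c : R) x : is_derive x 1 (fun _ : R => c) 0.
Proof. exact: is_derive_cst. Qed.

Lemma is_derive_id1 x : is_derive x 1 (fun y : R => y) 1.
Proof. exact: is_derive_id. Qed.

Lemma is_deriveD1 f g x df dg : is_derive x 1 f df -> is_derive x 1 g dg ->
  is_derive x 1 (fun y => f y + g y) (df + dg).
Proof. exact: is_deriveD. Qed.

Lemma is_deriveN1 f x df : is_derive x 1 f df ->
  is_derive x 1 (fun y => - f y) (- df).
Proof. exact: is_deriveN. Qed.

Lemma is_deriveM1 f g x df dg : is_derive x 1 f df -> is_derive x 1 g dg ->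
  is_derive x 1 (fun y => f y * g y) (df * g x + f x * dg).
Proof.
move=> Hf Hg; apply: (is_derive_eq (is_deriveM Hf Hg)).
by rewrite /GRing.scale /= addrC mulrC.
Qed.

Lemma is_deriveV1 f x df : f x != 0 -> is_derive x 1 f df ->
  is_derive x 1 (fun y => (f y)^-1) (- df / f x ^+ 2).
Proof.
move=> fx Hf; apply: (is_derive_eq (is_deriveV fx Hf)).
by rewrite /GRing.scale /= mulrC mulrN mulNr.
Qed.

Lemma is_deriveX1 f x df k : is_derive x 1 f df ->
  is_derive x 1 (fun y => f y ^+ k) (k%:R * f x ^+ k.-1 * df).
Proof. by move=> Hf; have := is_deriveX k Hf; rewrite exprfctE. Qed.

Lemma is_derive_comp1 f g x df dg : is_derive x 1 f df ->
  is_derive (f x) 1 g dg -> is_derive x 1 (fun y => g (f y)) (dg * df).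
Proof. by move=> Hf Hg; exact: is_derive1_comp. Qed.

Lemma is_derive_cont f x l : is_derive x 1 f l -> {for x, continuous f}.
Proof. by move=> H; apply/differentiable_continuous/derivable1_diffP; case: H. Qed.

Lemma is_derive_powR1 (s x : R) : 0 < x ->
  is_derive x 1 (fun y => y `^ s) (s * x `^ (s - 1)).
Proof.
move=> x0; have xi : x \in `]0, +oo[ by rewrite in_itv /= x0.
apply: DeriveDef; first exact: derivable_powR.
by rewrite -derive1E powR_derive1.
Qed.

Lemma is_derive_expRM (k : R) x :
  is_derive x 1 (fun y => expR (k * y)) (k * expR (k * x)).
Proof.
have d1 : is_derive x 1 (fun y => k * y) k.
  have := is_deriveM1 (is_derive_cst1 k x) (is_derive_id1 x).
  by rewrite mul0r add0r mulr1.
have := is_derive_comp1 d1 (is_derive_expR (k * x)).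
by rewrite mulrC.
Qed.

Lemma is_derive_near f g x l : (\near x, g x = f x) ->
  is_derive x 1 g l -> is_derive x 1 f l.
Proof. exact: near_eq_is_derive. Qed.

Lemma MVT1 {f} {df : R -> R} {a b} : a < b ->
  {within `[a, b], continuous f} ->
  (forall x, a < x < b -> is_derive x 1 f (df x)) ->
  exists2 c, a < c < b & f b - f a = df c * (b - a).
Proof.
move=> ab cf Hd; have Hd' x : x \in `]a, b[ -> is_derive x 1 f (df x).
  by rewrite in_itv /=; apply: Hd.
have [c + E] := MVT ab Hd' cf.
by rewrite in_itv; exists c.
Qed.

Lemma derive_nonneg_le f (df : R -> R) a b : a <= b ->
  {within `[a, b], continuous f} ->
  (forall x, a < x < b -> is_derive x 1 f (df x)) ->
  (forall x, a < x < b -> 0 <= df x) -> f a <= f b.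
Proof.
rewrite le_eqVlt => /orP[/eqP-> //|ab] cf Hd H0.
have [c ci E] := MVT1 ab cf Hd.
by rewrite -subr_ge0 E; apply: mulr_ge0; [exact: H0|rewrite subr_ge0 ltW].
Qed.

Lemma derive_pos_lt f (df : R -> R) a b : a < b ->
  {within `[a, b], continuous f} ->
  (forall x, a < x < b -> is_derive x 1 f (df x)) ->
  (forall x, a < x < b -> 0 < df x) -> f a < f b.
Proof.
move=> ab cf Hd H0.
have [c ci E] := MVT1 ab cf Hd.
by rewrite -subr_gt0 E; apply: mulr_gt0; [exact: H0|rewrite subr_gt0].
Qed.

Lemma within_cont f a b : (forall x, a <= x <= b -> {for x, continuous f}) ->
  {within `[a, b], continuous f}.
Proof.
move=> H; apply: continuous_in_subspaceT => x.
by rewrite inE /= in_itv /=; apply: H.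
Qed.

Lemma IVT1 f a b v : a <= b -> {within `[a, b], continuous f} ->
  f a <= v <= f b -> exists2 c, a <= c <= b & f c = v.
Proof.
move=> ab cf /andP[h1 h2]; have [|c] := @IVT R f a b v ab cf.
  by rewrite ge_min h1 le_max h2 orbT.
by rewrite in_itv; exists c.
Qed.

Lemma cont_ball f x : {for x, continuous f} -> forall e, 0 < e ->
  exists2 d, 0 < d & forall y, `|y - x| < d -> `|f y - f x| < e.
Proof.
move=> /cvgrPdist_lt H e e0; have := H e e0.
move/nbhs_ballP => [d /= d0 Hd]; exists d => // y yd.
by rewrite distrC; apply: Hd; rewrite /ball /= distrC.
Qed.

Lemma ball_cont f x : (forall e, 0 < e ->
  exists2 d, 0 < d & forall y, `|y - x| < d -> `|f y - f x| < e) ->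
  {for x, continuous f}.
Proof.
move=> H; apply/cvgrPdist_lt => e /H[d d0 Hd].
apply/nbhs_ballP; exists d => // y; rewrite /ball /= => yd.
by rewrite distrC Hd // distrC.
Qed.

End Calculus.

(** * Primitives *)

Section Antiderivative.
Context {R : realType}.
Implicit Types (f g h F : R -> R) (x y s : R).

(** Starting the integral at -1 rather than at 0 puts 0 inside the interval, so the primitive has a
    two-sided derivative there too; the half-line of interest is [0 <= x]. *)
Lemma antiderivative_gtN1 h : continuous h ->
  exists F, F 0 = 0 /\ forall x, -1 < x -> is_derive x 1 F (h x).
Proof.
move=> ch.
pose G x := (\int[lebesgue_measure]_(t in [set` `[(-1 : R), x]]) (h t))%R.
have HG x : -1 < x -> is_derive x 1 G (h x).
  move=> x1; have xu : x < x + 1 by rewrite ltrDl.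
  have hi : lebesgue_measure.-integrable `[-1, x + 1] (EFin \o h).
    apply: continuous_compact_integrable; first exact: segment_compact.
    exact: continuous_subspaceT.
  have [d1 d2] := continuous_FTC1_closed xu hi x1 (ch x).
  by apply: DeriveDef; [exact: d1|rewrite -derive1E; exact: d2].
exists (fun x => G x - G 0); split; first by rewrite subrr.
move=> x x1; have := is_deriveD1 (HG x x1) (is_derive_cst1 (- G 0) x).
by rewrite addr0.
Qed.

(** When the integrand vanishes on the negative side, the primitive can be cut to 0 there and is
    differentiable on the whole line; this spares the fixed-point equation any one-sided
    derivative. *)
Lemma antiderivative_vanishing h : continuous h -> (forall x, x <= 0 -> h x = 0) ->
  exists F, (forall x, x <= 0 -> F x = 0) /\ forall x, is_derive x 1 F (h x).
Proof.
move=> ch h0; have [F [F0 HF]] := antiderivative_gtN1 ch.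
have Fz x : -1 < x -> x <= 0 -> F x = 0.
  move=> x1; rewrite le_eqVlt => /orP[/eqP->//|x0].
  have cF : {within `[x, 0], continuous F}.
    apply: within_cont => y /andP[xy _]; apply: is_derive_cont; apply: HF.
    exact: lt_le_trans xy.
  have Hd y : x < y < 0 -> is_derive y 1 F (h y).
    by move=> /andP[xy _]; apply: HF; exact: lt_trans xy.
  have [c /andP[_ c0]] := MVT1 x0 cF Hd.
  by rewrite h0 ?ltW // mul0r F0 sub0r => /eqP; rewrite oppr_eq0 => /eqP.
exists (fun x => if x <= 0 then 0 else F x); split; first by move=> x ->.
move=> x; have [x1|x1] := ltP (-1) x.
  apply: (is_derive_near _ (HF x x1)); near=> y.
  case: ifPn => // y0; apply: Fz => //; near: y; exact: lt_nbhsr.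
rewrite h0; last by apply: le_trans x1 _; rewrite lerN10.
apply: (is_derive_near _ (is_derive_cst1 0 x)); near=> y.
rewrite ifT //; apply/ltW; near: y; apply: lt_nbhsl.
by apply: le_lt_trans x1 _; rewrite ltrN10.
Unshelve. all: by end_near. Qed.

(** A total function of [h], so that it can be iterated; the zero function is a default for
    discontinuous [h]. *)
Definition prim h : R -> R :=
  if pselect (continuous h) is left ch
  then sval (cid (antiderivative_gtN1 ch)) else 0.

Lemma prim0 h : continuous h -> prim h 0 = 0.
Proof. by rewrite /prim; case: pselect => // ch _; case: cid => F []. Qed.

Lemma is_derive_prim h x : continuous h -> -1 < x -> is_derive x 1 (prim h) (h x).
Proof.
rewrite /prim; case: pselect => // ch _; case: cid => F [_ HF] /=; exact: HF.
Qed.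

Lemma prim_cont h x : continuous h -> -1 < x -> {for x, continuous (prim h)}.
Proof. by move=> ch x1; apply: is_derive_cont; exact: is_derive_prim. Qed.

Lemma ltN1_ge0 (x : R) : 0 <= x -> -1 < x.
Proof. by move=> x0; apply: lt_le_trans x0; rewrite ltrN10. Qed.

Lemma prim_within h s : continuous h -> {within `[0, s], continuous (prim h)}.
Proof.
move=> ch; apply: within_cont => x /andP[x0 _].
by apply: prim_cont => //; exact: ltN1_ge0.
Qed.

(** Integral estimates take this form: [H + prim h] and [H - prim h] are both nondecreasing. *)
Lemma prim_bound h H (H' : R -> R) s : continuous h -> 0 <= s ->
  {within `[0, s], continuous H} ->
  (forall x, 0 < x < s -> is_derive x 1 H (H' x)) ->
  (forall x, 0 < x < s -> `|h x| <= H' x) -> `|prim h s| <= H s - H 0.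
Proof.
move=> ch s0 cH dH hH; rewrite ler_norml; apply/andP; split.
  have : H 0 + prim h 0 <= H s + prim h s.
    apply: (@derive_nonneg_le _ (fun x => H x + prim h x) (fun x => H' x + h x)) => //.
    - by move=> x; apply: continuousD; [exact: cH|exact: prim_within].
    - move=> x /andP[x0 xs]; apply: is_deriveD1; first by apply: dH; rewrite x0.
      by apply: is_derive_prim => //; apply: ltN1_ge0; exact: ltW.
    - by move=> x /hH; rewrite ler_norml => /andP[]; lra.
  by rewrite prim0 //; lra.
have : H 0 - prim h 0 <= H s - prim h s.
  apply: (@derive_nonneg_le _ (fun x => H x - prim h x) (fun x => H' x - h x)) => //.
  - by move=> x; apply: continuousB; [exact: cH|exact: prim_within].
  - move=> x /andP[x0 xs]; apply: is_deriveD1; first by apply: dH; rewrite x0.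
    by apply: is_deriveN1; apply: is_derive_prim => //; apply: ltN1_ge0; exact: ltW.
  - by move=> x /hH; rewrite ler_norml => /andP[]; lra.
by rewrite prim0 //; lra.
Qed.

Lemma primB f g s : continuous f -> continuous g -> 0 <= s ->
  prim (fun x => f x - g x) s = prim f s - prim g s.
Proof.
move=> cf cg s0.
have cfg : continuous (fun x => f x - g x).
  by move=> x; apply: continuousB; [exact: cf|exact: cg].
move: s0; rewrite le_eqVlt => /orP[/eqP<-|s0]; first by rewrite !prim0 // subr0.
pose D x := prim (fun x => f x - g x) x - (prim f x - prim g x).
have cD : {within `[0, s], continuous D}.
  move=> x; apply: continuousB; first exact: prim_within.
  by apply: continuousB; exact: prim_within.
have dD x : 0 < x < s -> is_derive x 1 D ((f x - g x) - (f x - g x)).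
  move=> /andP[/ltW/ltN1_ge0 x0 _].
  apply: is_deriveD1; first exact: is_derive_prim.
  apply: is_deriveN1; apply: is_deriveD1; first exact: is_derive_prim.
  by apply: is_deriveN1; exact: is_derive_prim.
have [c _] := MVT1 s0 cD dD; rewrite subrr mul0r /D !prim0 // !subr0.
by move/eqP; rewrite subr_eq0 => /eqP.
Qed.

(** Completeness with a rate. The intervals of radius [2 * c / 2 ^+ k] around [u k] are nested, and
    the supremum of their left ends lies in all of them. *)
Lemma geometric_limit (u : nat -> R) c : 0 <= c ->
  (forall k, `|u k.+1 - u k| <= c / 2 ^+ k) ->
  exists L, forall k, `|L - u k| <= 2 * c / 2 ^+ k.
Proof.
move=> c0 Hu.
pose e k := 2 * c / 2 ^+ k : R.
have e0 k : 0 <= e k by rewrite /e divr_ge0 ?mulr_ge0 // exprn_ge0.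
have eS k : e k = e k.+1 + c / 2 ^+ k.
  by rewrite /e exprS; field; rewrite expf_neq0.
have lo k : u k - e k <= u k.+1 - e k.+1.
  by move: (Hu k) (eS k); rewrite ler_norml => /andP[]; lra.
have up k : u k.+1 + e k.+1 <= u k + e k.
  by move: (Hu k) (eS k); rewrite ler_norml => /andP[]; lra.
have lom i k : u i - e i <= u (i + k)%N - e (i + k)%N.
  elim: k => [|k IH]; first by rewrite addn0.
  by rewrite addnS; apply: le_trans IH (lo _).
have upm i k : u (i + k)%N + e (i + k)%N <= u i + e i.
  elim: k => [|k IH]; first by rewrite addn0.
  by rewrite addnS; apply: le_trans (up _) IH.
have lu i j : u i - e i <= u j + e j.
  have := lom i j; have := upm j i; rewrite (addnC j i).
  have := e0 (i + j)%N; lra.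
pose A := [set u i - e i | i in [set: nat]].
have sA : has_sup A.
  split; first by exists (u 0%N - e 0%N); exists 0%N.
  by exists (u 0%N + e 0%N) => _ [i _ <-]; exact: lu.
exists (sup A) => k; rewrite ler_norml; apply/andP; split.
  have : u k - e k <= sup A by apply: sup_upper_bound => //; exists k.
  by rewrite /e; lra.
have : sup A <= u k + e k by apply: sup_le_ub => [|_ [i _ <-]]; [case: sA|exact: lu].
by rewrite /e; lra.
Qed.

Lemma geometric_le0 (x c : R) : (forall k, x <= c / 2 ^+ k) -> x <= 0.
Proof.
move=> H; rewrite leNgt; apply/negP => x0.
have [k] : exists k : nat, c / x < k%:R.
  exists (Num.bound `|c / x|); apply: le_lt_trans (ler_norm _) _.
  by apply: archi_boundP; exact: normr_ge0.
rewrite ltr_pdivrMr // => h; have := H k.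
rewrite ler_pdivlMr ?exprn_gt0 // => h2.
have : k%:R <= 2 ^+ k :> R by rewrite -natrX ler_nat ltnW // ltn_expl.
rewrite -(ler_pM2r x0); lra.
Qed.

End Antiderivative.

(** * Regular solutions of the radial equation *)

Section Picard.
Context {R : realType}.
Variables (N : nat) (a : R -> R) (M k : R).
Hypotheses (ca : continuous a) (aM : forall x, `|a x| <= M) (M0 : 0 <= M)
  (k0 : 0 < k) (kM : 2 * M <= k ^+ 2).
Implicit Types (f g : R -> R) (x s C : R).

Let wt g x := x ^+ N * a x * g x.

Lemma weight_cont g : continuous g -> continuous (wt g).
Proof.
move=> cg x; apply: cvgM; last exact: cg.
by apply: cvgM; [exact: exprn_continuous|exact: ca].
Qed.

(* [F = 1 - itg F] is the integral form of [F'' + (N / s) F' + a F = 0], [F 0 = 1],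
   where [itg g] is the primitive of [flux g]; measured against the weight
   [expR (k * s)], [itg] contracts by the factor 1/2. *)
Definition flux g s : R := if s <= 0 then 0 else prim (wt g) s / s ^+ N.

(** The weight [x ^+ N] under the integral compensates the division by [s ^+ N] and leaves a factor
    [s]: this is what makes [flux g] continuous at 0. *)
Lemma flux_near0 g C s : continuous g -> 0 <= s ->
  (forall x, 0 < x < s -> `|g x| <= C) -> `|flux g s| <= M * C * s.
Proof.
move=> cg s0 gC; rewrite /flux; case: ifPn => [h|].
  have -> : s = 0 by apply/eqP; rewrite eq_le h.
  by rewrite normr0 mulr0.
rewrite -ltNge => sp.
have sN : 0 < s ^+ N by exact: exprn_gt0.
rewrite normrM normfV (gtr0_norm sN) ler_pdivrMr //.
have C0 : 0 <= C.
  by apply: le_trans (gC (s / 2) _); [exact: normr_ge0|lra].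
have dH x : 0 < x < s -> is_derive x 1 (fun y => M * C * y ^+ N.+1)
    (M * C * (N.+1%:R * x ^+ N)).
  move=> _; have := is_deriveM1 (is_derive_cst1 (M * C) x)
    (is_deriveX1 N.+1 (is_derive_id1 x)).
  by rewrite mul0r add0r mulr1.
have cH : {within `[0, s], continuous (fun y => M * C * y ^+ N.+1)}.
  apply: within_cont => x _; apply: is_derive_cont.
  have := is_deriveM1 (is_derive_cst1 (M * C) x)
    (is_deriveX1 N.+1 (is_derive_id1 x)); exact.
have := prim_bound (weight_cont cg) s0 cH dH _.
rewrite expr0n /= mulr0 subr0 exprS => H.
apply: le_trans (H _) _; last by rewrite !mulrA.
move=> x xs; rewrite /wt !normrM.
have xp : 0 < x by case/andP: xs.
rewrite [`|x ^+ N|]gtr0_norm ?exprn_gt0 //.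
rewrite -natr1.
have xN : 0 <= x ^+ N by rewrite exprn_ge0 // ltW.
have h1 : `|a x| * `|g x| <= M * C by apply: ler_pM => //; exact: gC.
have h2 := mulr_ge0 (ler0n R N) (mulr_ge0 xN (mulr_ge0 M0 C0)).
have h3 := ler_wpM2l xN h1; lra.
Qed.

Lemma flux_cont g : continuous g -> continuous (flux g).
Proof.
move=> cg x; have [x0|x0|->] := ltgtP x 0.
- apply: (@is_derive_cont _ _ _ 0); apply: (is_derive_near _ (is_derive_cst1 0 x)).
  near=> y; rewrite /flux ifT //; apply/ltW; near: y; exact: lt_nbhsl.
- apply: (@is_derive_cont _ _ _ _).
  have h1 := is_derive_prim (weight_cont cg) (ltN1_ge0 (ltW x0)).
  have h2 : x ^+ N != 0 by rewrite expf_neq0 // gt_eqF.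
  have h3 := is_deriveV1 (f := fun y => y ^+ N) h2 (is_deriveX1 N (is_derive_id1 x)).
  apply: (is_derive_near _ (is_deriveM1 h1 h3)).
  near=> y; rewrite /flux ifF //; apply/negbTE; rewrite -ltNge.
  near: y; exact: lt_nbhsr.
- apply: ball_cont => e e0.
  have [d d0 Hd] := cont_ball (cg 0) ltr01.
  pose C := `|g 0| + 1.
  have C0 : 0 < C by rewrite /C; have := normr_ge0 (g 0); lra.
  have MC : 0 < M * C + 1 by have := mulr_ge0 M0 (ltW C0); lra.
  exists (Num.min d (e / (M * C + 1))); first by rewrite lt_min d0 divr_gt0.
  move=> y; rewrite subr0 lt_min => /andP[yd ye].
  rewrite [X in `|_ - X|]/flux lexx subr0.
  have [y0|y0] := leP y 0; first by rewrite /flux y0 normr0.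
  move: yd ye; rewrite gtr0_norm // => yd; rewrite ltr_pdivlMr // => ye.
  apply: le_lt_trans (flux_near0 cg (ltW y0) (C := C) _) _; last by lra.
  move=> z /andP[z0 zy]; have /Hd : `|z - 0| < d by rewrite subr0 gtr0_norm //; lra.
  have := ler_normD (g z - g 0) (g 0); rewrite subrK /C; lra.
Unshelve. all: by end_near. Qed.

Lemma flux_le0 g x : x <= 0 -> flux g x = 0.
Proof. by rewrite /flux => ->. Qed.

(** The derivative of [s ^+ N * expR (k * s)] contains [k * s ^+ N * expR (k * s)], and its other
    term is nonnegative; so this integration gains a factor 1/k. The next one, in [itg], gains
    another, and [2 * M <= k ^+ 2] bounds the product by 1/2. *)
Lemma flux_bound g C s : continuous g -> 0 <= s ->
  (forall x, 0 <= x -> `|g x| <= C * expR (k * x)) ->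
  `|flux g s| <= M * C / k * expR (k * s).
Proof.
move=> cg s0 gC.
have C0 : 0 <= C.
  by have := gC 0 (lexx _); rewrite mulr0 expR0 mulr1; apply: le_trans.
have MC : 0 <= M * C / k by rewrite divr_ge0 ?mulr_ge0 // ltW.
rewrite /flux; case: ifPn => [h|].
  by rewrite normr0 mulr_ge0 // expR_ge0.
rewrite -ltNge => sp.
have sN : 0 < s ^+ N by exact: exprn_gt0.
rewrite normrM normfV (gtr0_norm sN) ler_pdivrMr //.
pose H y := M * C / k * (y ^+ N * expR (k * y)).
pose H' x := M * C / k * (N%:R * x ^+ N.-1 * expR (k * x) + x ^+ N * (k * expR (k * x))).
have dH x : is_derive x 1 H (H' x).
  have := is_deriveM1 (is_derive_cst1 (M * C / k) x)
    (is_deriveM1 (is_deriveX1 N (is_derive_id1 x)) (is_derive_expRM k x)).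
  by rewrite mul0r add0r mulr1.
have cH : {within `[0, s], continuous H}.
  apply: within_cont => x _; exact: is_derive_cont (dH x).
have := prim_bound (weight_cont cg) s0 cH (fun x _ => dH x) _.
have H0 : 0 <= H 0.
  exact: (mulr_ge0 MC (mulr_ge0 (exprn_ge0 N (lexx 0)) (expR_ge0 _))).
move=> Hb; apply: le_trans (Hb _) _; last by move: H0; rewrite /H; lra.
move=> x /andP[xp _]; rewrite /wt !normrM.
rewrite [`|x ^+ N|]gtr0_norm ?exprn_gt0 //.
have xN : 0 <= x ^+ N by rewrite exprn_ge0 // ltW.
have h1 : `|a x| * `|g x| <= M * (C * expR (k * x)).
  by apply: ler_pM => //; apply: gC; exact: ltW.
rewrite /H' mulrDr -[X in X <= _]add0r; apply: lerD.
  apply: mulr_ge0 => //; apply: mulr_ge0; last exact: expR_ge0.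
  by apply: mulr_ge0 => //; apply: exprn_ge0; exact: ltW.
have -> : M * C / k * (x ^+ N * (k * expR (k * x))) =
  x ^+ N * (M * (C * expR (k * x))) by field; rewrite gt_eqF.
by rewrite -mulrA; exact: ler_wpM2l.
Qed.

Lemma fluxB f g s : continuous f -> continuous g ->
  flux (fun x => f x - g x) s = flux f s - flux g s.
Proof.
move=> cf cg; rewrite /flux; case: ifPn; first by rewrite subrr.
rewrite -ltNge => s0; rewrite -mulrBl; congr (_ / _).
rewrite -(primB (weight_cont cf) (weight_cont cg) (ltW s0)).
by congr (prim _ s); apply/funext => x; rewrite /wt mulrBr.
Qed.

(** Continuity of [g] is assumed inside the existential, so that [itg] is defined on every function
    and the Picard iteration carries no proofs. *)
Lemma itg_ex g : exists F, continuous g ->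
  (forall x, x <= 0 -> F x = 0) /\ forall x, is_derive x 1 F (flux g x).
Proof.
have [cg|ncg] := pselect (continuous g); last by exists 0 => /ncg.
have [F HF] := antiderivative_vanishing (flux_cont cg) (@flux_le0 g).
by exists F.
Qed.

Definition itg g : R -> R := sval (cid (itg_ex g)).

Lemma itg_le0 g x : continuous g -> x <= 0 -> itg g x = 0.
Proof. by rewrite /itg => cg; case: cid => F /= /(_ cg) [h _]; exact: h. Qed.

Lemma is_derive_itg g x : continuous g -> is_derive x 1 (itg g) (flux g x).
Proof. by rewrite /itg => cg; case: cid => F /= /(_ cg) [_ h]; exact: h. Qed.

Lemma itg_cont g : continuous g -> continuous (itg g).
Proof. by move=> cg x; apply: is_derive_cont; exact: is_derive_itg. Qed.

Lemma itgB_bound f g C s : continuous f -> continuous g -> 0 <= s ->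
  (forall x, 0 <= x -> `|f x - g x| <= C * expR (k * x)) ->
  `|itg f s - itg g s| <= C / 2 * expR (k * s).
Proof.
move=> cf cg s0 fgC.
have C0 : 0 <= C.
  by have := fgC 0 (lexx _); rewrite mulr0 expR0 mulr1; apply: le_trans.
have cfg : continuous (fun x => f x - g x).
  by move=> x; apply: continuousB; [exact: cf|exact: cg].
pose D x := itg f x - itg g x.
have dD x : is_derive x 1 D (flux f x - flux g x).
  by apply: is_deriveD1; [|apply: is_deriveN1]; exact: is_derive_itg.
pose H x := C / 2 * expR (k * x).
have dH x : is_derive x 1 H (C / 2 * (k * expR (k * x))).
  have := is_deriveM1 (is_derive_cst1 (C / 2) x) (is_derive_expRM k x).
  by rewrite mul0r add0r.
have Hb x : 0 < x < s -> `|flux f x - flux g x| <= C / 2 * (k * expR (k * x)).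
  move=> /andP[/ltW x0 _]; rewrite -fluxB //.
  apply: le_trans (flux_bound cfg x0 fgC) _.
  rewrite !mulrA ler_wpM2r ?expR_ge0 // ler_pdivrMr //.
  by have := ler_wpM2l C0 kM; rewrite expr2; lra.
have D0 : D 0 = 0 by rewrite /D !itg_le0 // subrr.
have H0 : 0 <= H 0 by apply: mulr_ge0; [rewrite divr_ge0|exact: expR_ge0].
rewrite -/(D s) -/(H s) ler_norml; apply/andP; split.
  have : H 0 + D 0 <= H s + D s.
    apply: (@derive_nonneg_le _ (fun x => H x + D x)
      (fun x => C / 2 * (k * expR (k * x)) + (flux f x - flux g x))) => //.
    - by apply: within_cont => x _; exact: is_derive_cont (is_deriveD1 (dH x) (dD x)).
    - by move=> x /Hb; rewrite ler_norml => /andP[]; lra.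
  lra.
have : H 0 - D 0 <= H s - D s.
  apply: (@derive_nonneg_le _ (fun x => H x - D x)
    (fun x => C / 2 * (k * expR (k * x)) - (flux f x - flux g x))) => //.
  - apply: within_cont => x _.
    exact: is_derive_cont (is_deriveD1 (dH x) (is_deriveN1 (dD x))).
  - by move=> x /Hb; rewrite ler_norml => /andP[]; lra.
lra.
Qed.

Fixpoint picard (i : nat) : R -> R :=
  if i is j.+1 then fun x => 1 - itg (picard j) x else fun _ => 1.

Lemma picard_cont i : continuous (picard i).
Proof.
elim: i => [|i IH] /=; first by move=> x; exact: cst_continuous.
by move=> x; apply: continuousB; [exact: cst_continuous|exact: itg_cont].
Qed.

Lemma zero_itg s : 0 <= s -> itg (fun _ => 0) s = 0.
Proof.
move=> s0; have c0 : continuous (fun _ : R => 0 : R).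
  by move=> x; exact: cst_continuous.
have f0 x : flux (fun _ => 0) x = 0.
  transitivity (flux (fun _ => 0 - 0) x).
    by congr (flux _ x); apply/funext => y; rewrite subr0.
  exact: (etrans (fluxB x c0 c0) (subrr _)).
have d0 x : is_derive x 1 (itg (fun _ => 0)) 0.
  by have := is_derive_itg x c0; rewrite f0.
by rewrite (is_derive_0_is_cst s 0 d0) itg_le0.
Qed.

(** For [x <= 0] all iterates equal 1. For [x >= 0] the base case compares the constants 1 and 0,
    and each further step halves the bound. *)
Lemma picard_step i x : `|picard i.+1 x - picard i x| <= expR (k * x) / 2 ^+ i.
Proof.
elim: i x => [|i IH] x.
  rewrite /= addrAC subrr sub0r normrN expr0 divr1.
  have [x0|/ltW x0] := leP x 0.
    by rewrite itg_le0 ?normr0 ?expR_ge0 //; exact: cst_continuous.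
  have c1 : continuous (fun _ : R => 1 : R) by move=> y; exact: cst_continuous.
  have c0 : continuous (fun _ : R => 0 : R) by move=> y; exact: cst_continuous.
  have h y : 0 <= y -> `|(1 : R) - 0| <= 1 * expR (k * y).
    move=> y0; rewrite subr0 normr1 mul1r -expR0 ler_expR mulr_ge0 //; exact: ltW.
  have := itgB_bound c1 c0 x0 h; rewrite zero_itg // subr0.
  have := expR_ge0 (k * x); lra.
have [x0|/ltW x0] := leP x 0.
  have E j : picard j x = 1.
    by case: j => //= j; rewrite (itg_le0 (@picard_cont j) x0) subr0.
  by rewrite !E subrr normr0 divr_ge0 ?expR_ge0 ?exprn_ge0.
have h y : 0 <= y -> `|picard i.+1 y - picard i y| <= (2 ^+ i)^-1 * expR (k * y).
  by move=> _; rewrite mulrC.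
have := itgB_bound (@picard_cont i.+1) (@picard_cont i) x0 h.
rewrite [in X in _ -> X]/= opprD opprK addrACA subrr add0r addrC distrC.
by rewrite exprS invfM; lra.
Qed.

Lemma picard_limit : exists F G : R -> R,
  [/\ forall x, x <= 0 -> F x = 1 /\ G x = 0,
      forall x, is_derive x 1 F (G x), continuous G
    & forall x, 0 < x -> is_derive x 1 G (- (N%:R / x) * G x - a x * F x)].
Proof.
have [F HF] : exists F : R -> R, forall x i,
    `|F x - picard i x| <= 2 * expR (k * x) / 2 ^+ i.
  have H x := geometric_limit (expR_ge0 (k * x)) (fun i => picard_step i x).
  by have [F HF] := choice H; exists F.
have cF : continuous F.
  move=> x; apply: ball_cont => e e0.
  (* The rate depends on the point only through [expR (k * x)], so one index [i] serves a whole
     neighbourhood of [x], and continuity follows by a three-term estimate. *)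
  have [i Hi] : exists i, 2 * expR (k * (x + 1)) / 2 ^+ i < e / 4.
    apply/not_existsP => Hn; have : e / 4 <= 0.
      by apply: (@geometric_le0 _ _ (2 * expR (k * (x + 1)))) => i; rewrite leNgt; apply/negP/Hn.
    by rewrite leNgt => /negP; apply; lra.
  have e4 : 0 < e / 4 by lra.
  have [d d0 Hd] := cont_ball (@picard_cont i x) e4.
  exists (Num.min d 1); first by rewrite lt_min d0 ltr01.
  move=> y; rewrite lt_min => /andP[/Hd h1 y1].
  have E z : z <= x + 1 -> `|F z - picard i z| < e / 4.
    move=> zx; apply: le_lt_trans (HF z i) _; apply: le_lt_trans Hi.
    rewrite ler_wpM2r ?invr_ge0 ?exprn_ge0 // ler_wpM2l // ler_expR.
    by rewrite ler_wpM2l // ltW.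
  have h2 : `|F y - picard i y| < e / 4.
    by apply: E; move: y1; rewrite ltr_norml => /andP[]; lra.
  have h3 : `|F x - picard i x| < e / 4 by apply: E; lra.
  move: h1 h2 h3; rewrite !ltr_norml => /andP[??] /andP[??] /andP[??].
  by apply/andP; split; lra.
have Fle x : x <= 0 -> F x = 1.
  move=> x0; have P1 i : picard i x = 1.
    by case: i => //= i; rewrite itg_le0 ?subr0 //; exact: picard_cont.
  have : `|F x - 1| <= 0.
    by apply: (@geometric_le0 _ _ (2 * expR (k * x))) => i; rewrite -{1}(P1 i).
  by rewrite normr_le0 subr_eq0 => /eqP.
have FE x : F x = 1 - itg F x.
  have [x0|/ltW x0] := leP x 0; first by rewrite Fle // itg_le0 // subr0.
  have : `|F x - (1 - itg F x)| <= 0.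
    apply: (@geometric_le0 _ _ (2 * expR (k * x))) => i.
    have h1 := HF x i.+1.
    have h y : 0 <= y -> `|F y - picard i y| <= (2 / 2 ^+ i) * expR (k * y).
      by move=> _; apply: le_trans (HF y i) _; rewrite -!mulrA [expR _ * _]mulrC.
    have := itgB_bound cF (@picard_cont i) x0 h.
    move: h1; rewrite /= exprS => h1 h2.
    have -> : F x - (1 - itg F x) =
      (F x - (1 - itg (picard i) x)) + (itg F x - itg (picard i) x) by ring.
    apply: le_trans (ler_normD _ _) _; apply: le_trans (lerD h1 h2) _.
    by rewrite le_eqVlt; apply/orP; left; apply/eqP; field; rewrite expf_neq0.
  by rewrite normr_le0 subr_eq0 => /eqP.
exists F, (fun x => - flux F x); split.
- by move=> x x0; rewrite Fle // flux_le0 // oppr0.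
- move=> x; have -> : F = fun x => 1 - itg F x by apply/funext.
  have := is_deriveD1 (is_derive_cst1 1 x) (is_deriveN1 (is_derive_itg x cF)).
  by rewrite add0r -(_ : F = fun x => 1 - itg F x) //; apply/funext.
- by move=> x; apply: continuousN; exact: flux_cont.
move=> x x0.
have h1 := is_derive_prim (weight_cont cF) (ltN1_ge0 (ltW x0)).
have xn0 : x != 0 by rewrite gt_eqF.
have h2 : x ^+ N != 0 by rewrite expf_neq0.
have h3 := is_deriveV1 (f := fun y => y ^+ N) h2 (is_deriveX1 N (is_derive_id1 x)).
have -> : - (N%:R / x) * - flux F x - a x * F x =
  - (wt F x * (x ^+ N)^-1 + prim (wt F) x * (- (N%:R * x ^+ N.-1 * 1) / (x ^+ N) ^+ 2)).
  rewrite /flux ifF; last by apply/negbTE; rewrite -ltNge.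
  rewrite /wt; case: (N) h2 => [|N1] /= h2; first by rewrite expr0; field.
  by rewrite exprS; field; rewrite expf_neq0 // xn0.
apply: (is_derive_near _ (is_deriveN1 (is_deriveM1 h1 h3))).
near=> y; rewrite /flux ifF //; apply/negbTE; rewrite -ltNge.
near: y; exact: lt_nbhsr.
Unshelve. all: by end_near. Qed.

End Picard.

(** Every bound [M] is admissible, because [k = M + 1] satisfies [2 * M <= k ^+ 2]. *)
Lemma regular_solution_exists {R : realType} (N : nat) (a : R -> R) (M : R) :
  continuous a -> (forall x, `|a x| <= M) ->
  exists F G : R -> R,
  [/\ forall x : R, x <= 0 -> F x = 1 /\ G x = 0,
      forall x : R, is_derive x 1 F (G x), continuous G
    & forall x : R, 0 < x -> is_derive x 1 G (- (N%:R / x) * G x - a x * F x)].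
Proof.
move=> ca aM; have M0 : 0 <= M by apply: le_trans (aM 0).
apply: (picard_limit (k := M + 1) N ca aM) => //; first by lra.
by rewrite expr2; nra.
Qed.

(** * Energy estimates *)

Section Energy.
Context {R : realType}.
Implicit Types (F G a h : R -> R) (x y r S : R).

Lemma expRM_within (k : R) x y : {within `[x, y], continuous (fun y => expR (k * y))}.
Proof.
by apply: within_cont => z _; exact: is_derive_cont (is_derive_expRM k z).
Qed.

(* The damping term [- (N / r) * G] has the good sign in the energy
   [F ^+ 2 + G ^+ 2], so the singularity at [0] does no harm. *)
Lemma energy_bound (N : nat) a h F G S M d : 0 <= S -> 0 <= M ->
  {within `[0, S], continuous F} -> {within `[0, S], continuous G} ->
  F 0 = 0 -> G 0 = 0 ->
  (forall r, 0 < r < S -> is_derive r 1 F (G r)) ->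
  (forall r, 0 < r < S ->
     is_derive r 1 G (- (N%:R / r) * G r - a r * F r - h r)) ->
  (forall r, 0 < r < S -> `|a r| <= M) ->
  (forall r, 0 < r < S -> `|h r| <= d) ->
  F S ^+ 2 + G S ^+ 2 <= expR ((2 + M) * S) * d ^+ 2.
Proof.
move=> S0 M0 cF cG F0 G0 dF dG aM hd.
pose K := 2 + M.
(* The constant [d ^+ 2] absorbs the cross term of [G] with the forcing [h], so that one exponential
   controls the inhomogeneous equation. *)
pose E x := F x ^+ 2 + G x ^+ 2 + d ^+ 2.
pose V x := - (expR (- K * x) * E x).
have : V 0 <= V S.
  pose dV x := - (- K * expR (- K * x) * E x + expR (- K * x) *
    (2%:R * F x ^+ 1 * G x +
     2%:R * G x ^+ 1 * (- (N%:R / x) * G x - a x * F x - h x) + 0)).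
  apply: (@derive_nonneg_le _ V dV); first exact: S0.
  - move=> x; apply: cvgN; apply: cvgM; first exact: expRM_within.
    apply: cvgD; last exact: cvg_cst.
    by apply: cvgD; [apply: (cvg_comp _ (fun y => y ^+ 2) (cF x))
      |apply: (cvg_comp _ (fun y => y ^+ 2) (cG x))]; exact: exprn_continuous.
  - move=> x xS; exact: (is_deriveN1 (is_deriveM1 (is_derive_expRM (- K) x)
      (is_deriveD1 (is_deriveD1 (is_deriveX1 2 (dF x xS)) (is_deriveX1 2 (dG x xS)))
      (is_derive_cst1 (d ^+ 2) x)))).
  move=> x xS; rewrite /dV /E !expr1.
  have x0 : 0 < x by case/andP: xS.
  have e0 := expR_gt0 (- K * x).
  have Nx : 0 <= N%:R / x by rewrite divr_ge0 // ltW.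
  have h1 : h x ^+ 2 <= d ^+ 2.
    rewrite -(real_normK (num_real (h x))) lerXn2r ?nnegrE ?hd //.
    exact: le_trans (hd _ xS).
  have := aM _ xS; rewrite ler_norml => /andP[a1 a2].
  move: e0 Nx h1 a1 a2; move: (F x) (G x) (h x) (a x) (N%:R / x) => f g hx ax b.
  move=> e0 b0 h1 a1 a2.
  have -> : - (- K * expR (- K * x) * (f ^+ 2 + g ^+ 2 + d ^+ 2) +
    expR (- K * x) * (2 * f * g + 2 * g * (- b * g - ax * f - hx) + 0)) =
    expR (- K * x) * ((f - g) ^+ 2 + (g + hx) ^+ 2 + 2 * b * g ^+ 2
      + (1 + M) * d ^+ 2 + (d ^+ 2 - hx ^+ 2) + f ^+ 2
      + ((M + ax) * (f + g) ^+ 2 + (M - ax) * (f - g) ^+ 2) / 2).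
    by rewrite /K; field.
  apply: mulr_ge0; first exact: ltW.
  have p1 : 0 <= b * g ^+ 2 by rewrite mulr_ge0 // sqr_ge0.
  have p2 : 0 <= (1 + M) * d ^+ 2 by rewrite mulr_ge0 ?sqr_ge0 // addr_ge0.
  have p3 : 0 <= (M + ax) * (f + g) ^+ 2 by rewrite mulr_ge0 ?sqr_ge0 //; lra.
  have p4 : 0 <= (M - ax) * (f - g) ^+ 2 by rewrite mulr_ge0 ?sqr_ge0 //; lra.
  have := sqr_ge0 (f - g); have := sqr_ge0 (g + hx); have := sqr_ge0 f; lra.
rewrite /V /E F0 G0 mulr0 expR0 !expr0n /= !add0r mul1r lerN2 mulNr expRN.
rewrite mulrC ler_pdivrMr ?expR_gt0 // => H.
have := sqr_ge0 d; lra.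
Qed.

(** Read backward, the damping feeds the energy, so its rate enters the exponent as
    [2 * (N%:R / x)]; this is why the interval stays away from 0. *)
Lemma energy_backward (N : nat) a F G x z M : 0 < x -> x < z -> 0 <= M ->
  (forall r, x <= r <= z -> is_derive r 1 F (G r)) ->
  (forall r, x <= r <= z -> is_derive r 1 G (- (N%:R / r) * G r - a r * F r)) ->
  (forall r, x <= r <= z -> `|a r| <= M) ->
  F z = 0 -> G z = 0 -> F x = 0.
Proof.
move=> x0 xz M0 dF dG aM Fz Gz.
pose K := 2 * (N%:R / x) + 1 + M.
pose E r := F r ^+ 2 + G r ^+ 2.
pose V r := expR (K * r) * E r.
have : V x <= V z.
  pose dV r := K * expR (K * r) * E r + expR (K * r) *
    (2%:R * F r ^+ 1 * G r +
     2%:R * G r ^+ 1 * (- (N%:R / r) * G r - a r * F r)).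
  have dV' r : x <= r <= z -> is_derive r 1 V (dV r).
    move=> rS; exact: (is_deriveM1 (is_derive_expRM K r)
      (is_deriveD1 (is_deriveX1 2 (dF r rS)) (is_deriveX1 2 (dG r rS)))).
  have W r : x < r < z -> x <= r <= z by move=> /andP[/ltW-> /ltW->].
  apply: (@derive_nonneg_le _ V dV).
  - exact: ltW.
  - by apply: within_cont => r /dV'/is_derive_cont.
  - by move=> r /W/dV'.
  move=> r /W rS; rewrite /dV /E !expr1.
  have [xr rz] := andP rS.
  have := aM _ rS; rewrite ler_norml => /andP[a1 a2].
  have Nr : N%:R / r <= N%:R / x.
    by rewrite ler_wpM2l // lef_pV2 // posrE //; exact: lt_le_trans xr.
  have Nx : 0 <= N%:R / x by rewrite divr_ge0 // ltW.
  rewrite /K; move: Nx Nr a1 a2.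
  move: (F r) (G r) (a r) (N%:R / r) (N%:R / x) => f g ar b c c0 bc a1 a2.
  set L := 2 * c + 1 + M.
  have -> : L * expR (L * r) * (f ^+ 2 + g ^+ 2) +
    expR (L * r) * (2 * f * g + 2 * g * (- b * g - ar * f)) =
    expR (L * r) * ((f + g) ^+ 2 + 2 * (c - b) * g ^+ 2 + 2 * c * f ^+ 2
      + ((M + ar) * (f - g) ^+ 2 + (M - ar) * (f + g) ^+ 2) / 2).
    by rewrite /L; field.
  apply: mulr_ge0; first exact: expR_ge0.
  have p1 : 0 <= (c - b) * g ^+ 2 by rewrite mulr_ge0 ?sqr_ge0 // subr_ge0.
  have p2 : 0 <= c * f ^+ 2 by rewrite mulr_ge0 ?sqr_ge0.
  have p3 : 0 <= (M + ar) * (f - g) ^+ 2 by rewrite mulr_ge0 ?sqr_ge0 //; lra.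
  have p4 : 0 <= (M - ar) * (f + g) ^+ 2 by rewrite mulr_ge0 ?sqr_ge0 //; lra.
  have := sqr_ge0 (f + g); lra.
rewrite /V /E Fz Gz expr0n /= addr0 mulr0 pmulr_rle0 ?expR_gt0 // => H.
have f0 : F x ^+ 2 = 0.
  apply/eqP; rewrite eq_le sqr_ge0 andbT.
  by have := sqr_ge0 (G x); move: H; lra.
by apply/eqP; rewrite -sqrf_eq0 f0.
Qed.

End Energy.

(** * Sturm comparison and zero counting *)

Section Continuity.
Context {R : realType}.
Implicit Types (f F G : R -> R) (x y z r : R).

Lemma cont_ge0 f y : {for y, continuous f} ->
  (forall e, 0 < e -> exists2 x, `|x - y| < e & 0 <= f x) -> 0 <= f y.
Proof.
move=> cf H; rewrite leNgt; apply/negP => fy.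
have fy' : 0 < - f y by lra.
have [d d0 Hd] := cont_ball cf fy'.
have [x /Hd] := H d d0; rewrite ltr_norml => /andP[_]; lra.
Qed.

Lemma cont_ge0_right f y z : y < z -> {for y, continuous f} ->
  (forall x, y < x < z -> 0 <= f x) -> 0 <= f y.
Proof.
move=> yz cf H; apply: (cont_ge0 cf) => e e0.
pose d := Num.min (e / 2) ((z - y) / 2).
have d0 : 0 < d by rewrite lt_min; apply/andP; split; lra.
have d1 : d <= e / 2 by rewrite ge_min lexx.
have d2 : d <= (z - y) / 2 by rewrite ge_min lexx orbT.
exists (y + d); first by rewrite addrAC subrr add0r gtr0_norm //; lra.
by apply: H; apply/andP; split; lra.
Qed.

Lemma cont_ge0_left f y z : y < z -> {for z, continuous f} ->
  (forall x, y < x < z -> 0 <= f x) -> 0 <= f z.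
Proof.
move=> yz cf H; apply: (cont_ge0 cf) => e e0.
pose d := Num.min (e / 2) ((z - y) / 2).
have d0 : 0 < d by rewrite lt_min; apply/andP; split; lra.
have d1 : d <= e / 2 by rewrite ge_min lexx.
have d2 : d <= (z - y) / 2 by rewrite ge_min lexx orbT.
exists (z - d); first by rewrite addrAC subrr add0r normrN gtr0_norm //; lra.
by apply: H; apply/andP; split; lra.
Qed.

(** The mean value theorem provides points arbitrarily close to [y] where [G] is positive, and [G]
    is continuous. *)
Lemma derive_ge0_right F G y z : y < z -> {for y, continuous G} ->
  (forall r, is_derive r 1 F (G r)) -> F y = 0 ->
  (forall r, y < r < z -> 0 < F r) -> 0 <= G y.
Proof.
move=> yz cG dF Fy Fp; apply: (cont_ge0 cG) => e e0.
pose d := Num.min (e / 2) ((z - y) / 2).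
have d0 : 0 < d by rewrite lt_min; apply/andP; split; lra.
have d1 : d <= e / 2 by rewrite ge_min lexx.
have d2 : d <= (z - y) / 2 by rewrite ge_min lexx orbT.
have yd : y < y + d by lra.
have [c /andP[c1 c2] E] := MVT1 yd (within_cont (fun x _ => is_derive_cont (dF x)))
  (fun x _ => dF x).
exists c; first by rewrite gtr0_norm; lra.
have Fd : 0 < F (y + d) by apply: Fp; apply/andP; split; lra.
move: E Fd; rewrite Fy subr0 (_ : y + d - y = d); last by ring.
by move=> ->; rewrite pmulr_lgt0 // => /ltW.
Qed.

Lemma derive_le0_left F G y z : y < z -> {for z, continuous G} ->
  (forall r, is_derive r 1 F (G r)) -> F z = 0 ->
  (forall r, y < r < z -> 0 < F r) -> G z <= 0.
Proof.
move=> yz cG dF Fz Fp; rewrite -oppr_ge0; apply: (@cont_ge0 (fun x => - G x)).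
  by apply: cvgN; exact: cG.
move=> e e0.
pose d := Num.min (e / 2) ((z - y) / 2).
have d0 : 0 < d by rewrite lt_min; apply/andP; split; lra.
have d1 : d <= e / 2 by rewrite ge_min lexx.
have d2 : d <= (z - y) / 2 by rewrite ge_min lexx orbT.
have yd : z - d < z by lra.
have [c /andP[c1 c2] E] := MVT1 yd (within_cont (fun x _ => is_derive_cont (dF x)))
  (fun x _ => dF x).
exists c; first by rewrite ler0_norm; lra.
have Fd : 0 < F (z - d) by apply: Fp; apply/andP; split; lra.
move: E Fd; rewrite Fz (_ : z - (z - d) = d); last by ring.
move=> E Fd; have : 0 < - G c * d by rewrite mulNr -E; lra.
by rewrite pmulr_lgt0 // => /ltW.
Qed.

Lemma IVT_zero f x y : x <= y -> continuous f -> f x * f y < 0 ->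
  exists2 c, x < c < y & f c = 0.
Proof.
move=> xy cf fxy.
have [c /andP[c1 c2] fc] : exists2 c, x <= c <= y & f c = 0.
  have [fx0|fx0] := ltP (f x) 0.
    have fy0 : 0 < f y by move: fxy; rewrite nmulr_rlt0.
    apply: IVT1 => //; first exact: continuous_subspaceT.
    by rewrite !ltW.
  have fx1 : 0 < f x.
    by rewrite lt_neqAle fx0 andbT; apply: contraTneq fxy => <-; rewrite mul0r ltxx.
  have fy0 : f y < 0 by move: fxy; rewrite pmulr_rlt0.
  have [||c ci] := @IVT1 _ (fun z => - f z) x y 0 xy.
  - by apply: continuous_subspaceT => z; apply: cvgN; exact: cf.
  - by rewrite oppr_le0 oppr_ge0 !ltW.
  by move/eqP; rewrite oppr_eq0 => /eqP; exists c.
exists c => //; apply/andP; split; rewrite lt_neqAle ?c1 ?c2 andbT.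
  by apply: contraTneq fxy => ->; rewrite fc mul0r ltxx.
by apply: contraTneq fxy => <-; rewrite fc mulr0 ltxx.
Qed.

(** The factor is the value at the midpoint: scaling by it makes the function positive and keeps a
    linear equation intact. *)
Lemma nonzero_sign f y z : y < z -> continuous f ->
  (forall r, y < r < z -> f r != 0) ->
  exists2 s : R, s != 0 & forall r, y < r < z -> 0 < s * f r.
Proof.
move=> yz cf f0; pose m := (y + z) / 2.
have mi : y < m < z by rewrite /m; apply/andP; split; lra.
exists (f m); first exact: f0.
move=> r ri; rewrite ltNge; apply/negP; rewrite le_eqVlt mulf_eq0.
rewrite (negbTE (f0 _ mi)) (negbTE (f0 _ ri)) /= => fmr.
move: ri mi => /andP[r1 r2] /andP[m1 m2].
have [mr|rm] := leP m r.
  have [c /andP[c1 c2] fc] := IVT_zero mr cf fmr.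
  have ci : y < c < z by apply/andP; split; lra.
by move: (f0 _ ci); rewrite fc eqxx.
have frm : f r * f m < 0 by rewrite mulrC.
have [c /andP[c1 c2] fc] := IVT_zero (ltW rm) cf frm.
have ci : y < c < z by apply/andP; split; lra.
by move: (f0 _ ci); rewrite fc eqxx.
Qed.

Lemma cont_neq0_near f y : {for y, continuous f} -> f y != 0 ->
  exists2 d, 0 < d & forall r, `|r - y| < d -> f r != 0.
Proof.
move=> cf fy; have [|d d0 Hd] := cont_ball cf (e := `|f y|); first by rewrite normr_gt0.
exists d => // r /Hd h; apply: contraTneq h => ->.
by rewrite sub0r normrN ltxx.
Qed.

Lemma Rolle_zero F G x y : x < y -> (forall r, is_derive r 1 F (G r)) ->
  F x = F y -> exists2 c, x < c < y & G c = 0.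
Proof.
move=> xy dF E.
have [c ci] := MVT1 xy (within_cont (fun x _ => is_derive_cont (dF x)))
  (fun x _ => dF x).
rewrite E subrr => /esym/eqP; rewrite mulf_eq0 subr_eq0 (gt_eqF xy) orbF => /eqP.
by exists c.
Qed.

Lemma abs_bounded f S : 0 <= S -> continuous f ->
  exists2 B, 0 <= B & forall r, 0 <= r <= S -> `|f r| <= B.
Proof.
move=> S0 cf; have cn : {within `[0, S], continuous (fun r => `|f r|)}.
  by apply: within_cont => x _; apply: cvg_norm; exact: cf.
have [c _ Hc] := EVT_max S0 cn.
exists `|f c| => // r rS; by apply: Hc; rewrite in_itv.
Qed.

Lemma abs_bounded_below f x y : x <= y -> continuous f ->
  (forall r, x <= r <= y -> f r != 0) ->
  exists2 m, 0 < m & forall r, x <= r <= y -> m <= `|f r|.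
Proof.
move=> xy cf f0; have cn : {within `[x, y], continuous (fun r => `|f r|)}.
  by apply: within_cont => z _; apply: cvg_norm; exact: cf.
have [c + Hc] := EVT_min xy cn; rewrite in_itv /= => ci.
exists `|f c|; first by rewrite normr_gt0; exact: f0.
by move=> r rS; apply: Hc; rewrite in_itv.
Qed.

End Continuity.

(** * Comparison of two solutions through their weighted Wronskian *)

Section Wronskian.
Context {R : realType}.
Variables (N : nat) (a1 a2 : R -> R) (F1 G1 F2 G2 : R -> R) (y z : R).
Implicit Types r : R.
Hypotheses (y0 : 0 <= y) (yz : y < z).
Hypotheses (dF1 : forall r, is_derive r 1 F1 (G1 r)) (cG1 : continuous G1)
  (dF2 : forall r, is_derive r 1 F2 (G2 r)) (cG2 : continuous G2).
Hypotheses
  (dG1 : forall r, 0 < r -> is_derive r 1 G1 (- (N%:R / r) * G1 r - a1 r * F1 r))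
  (dG2 : forall r, 0 < r -> is_derive r 1 G2 (- (N%:R / r) * G2 r - a2 r * F2 r)).

(** [W] has the derivative [r ^+ N * ((a2 r - a1 r) * (F1 r * F2 r))], positive inside, whereas the
    end conditions give [0 <= W y] and [W z <= 0]. At the origin both derivatives must vanish, since
    for [N = 0] the weight does not. *)
Lemma sturm_comparison_pos : (forall r, a1 r < a2 r) ->
  (y = 0 /\ G1 0 = 0 /\ G2 0 = 0 \/ F1 y = 0) -> F1 z = 0 ->
  (forall r, y < r < z -> 0 < F1 r) -> (forall r, y < r < z -> 0 < F2 r) -> False.
Proof.
move=> a12 Hy F1z p1 p2.
have cF1 : continuous F1 by move=> r; exact: is_derive_cont (dF1 r).
have cF2 : continuous F2 by move=> r; exact: is_derive_cont (dF2 r).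
pose W r := r ^+ N * (G1 r * F2 r - F1 r * G2 r).
have : W y < W z.
  apply: (@derive_pos_lt _ W (fun r => r ^+ N * ((a2 r - a1 r) * (F1 r * F2 r)))) => //.
  - apply: within_cont => r _; apply: cvgM; first exact: exprn_continuous.
    by apply: cvgB; apply: cvgM; [exact: cG1|exact: cF2|exact: cF1|exact: cG2].
  - move=> r /andP[yr _]; have r0 : 0 < r by exact: le_lt_trans yr.
    have := is_deriveM1 (is_deriveX1 N (is_derive_id1 r)) (is_deriveD1
      (is_deriveM1 (dG1 r0) (dF2 r)) (is_deriveN1 (is_deriveM1 (dF1 r) (dG2 r0)))).
    move/is_derive_eq; apply.
    have r1 : r != 0 by rewrite gt_eqF.
    by case: (N) => [|N1] /=; [rewrite expr0; field|rewrite exprS; field].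
  - move=> r ri; have r0 : 0 < r by case/andP: ri => yr _; exact: le_lt_trans yr.
    by apply: mulr_gt0; [exact: exprn_gt0|apply: mulr_gt0; [rewrite subr_gt0|apply: mulr_gt0; [exact: p1|exact: p2]]].
have z0 : 0 < z by exact: le_lt_trans yz.
have Wz : W z <= 0.
  rewrite /W F1z mul0r subr0 pmulr_rle0; last exact: exprn_gt0.
  apply: mulr_le0_ge0; first exact: (derive_le0_left yz (@cG1 z) dF1 F1z p1).
  by apply: (cont_ge0_left yz (cF2 z)) => x /p2/ltW.
have Wy : 0 <= W y.
  rewrite /W; case: Hy => [[-> [-> ->]]|F1y].
    by rewrite mul0r mulr0 subrr mulr0.
  rewrite F1y mul0r subr0; apply: mulr_ge0; first exact: exprn_ge0.
  apply: mulr_ge0; first exact: (derive_ge0_right yz (@cG1 y) dF1 F1y p1).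
  by apply: (cont_ge0_right yz (cF2 y)) => x /p2/ltW.
by move/(le_lt_trans Wy)/lt_le_trans/(_ Wz); rewrite ltxx.
Qed.

End Wronskian.

(** * The regular solutions [Phi nu] and the number of their zeros *)

Section Sturm.
Context {R : realType}.
Variables (N : nat) (q : R -> R) (Q : R).
Hypotheses (cq : continuous q) (qQ : forall x, 0 <= q x <= Q).
Implicit Types (nu t x y z r S : R).

Lemma shift_cont nu : continuous (fun r => q r + nu).
Proof. by move=> r; apply: cvgD; [exact: cq|exact: cvg_cst]. Qed.

Lemma shift_bound nu r : `|q r + nu| <= Q + `|nu|.
Proof.
apply: le_trans (ler_normD _ _) _; rewrite lerD2r.
by have /andP[q0 q1] := qQ r; rewrite ger0_norm.
Qed.

Lemma Q_ge0 : 0 <= Q.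
Proof. by have /andP[q0 q1] := qQ 0; exact: le_trans q1. Qed.

(** Function and derivative are chosen together, so that [Phi] and [dPhi] come from the same
    witness. *)
Lemma regular_pair nu : exists FG : (R -> R) * (R -> R),
  [/\ forall x, x <= 0 -> FG.1 x = 1 /\ FG.2 x = 0,
      forall x, is_derive x 1 FG.1 (FG.2 x), continuous FG.2
    & forall x, 0 < x ->
        is_derive x 1 FG.2 (- (N%:R / x) * FG.2 x - (q x + nu) * FG.1 x)].
Proof.
have [F [G [h1 h2 h3 h4]]] :=
  regular_solution_exists N (@shift_cont nu) (@shift_bound nu).
by exists (F, G).
Qed.

Definition Phi nu : R -> R := (sval (cid (regular_pair nu))).1.
Definition dPhi nu : R -> R := (sval (cid (regular_pair nu))).2.

Lemma Phi_le0 nu x : x <= 0 -> Phi nu x = 1.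
Proof. by rewrite /Phi; case: cid => FG /= [h _ _ _] /h []. Qed.

Lemma dPhi_le0 nu x : x <= 0 -> dPhi nu x = 0.
Proof. by rewrite /dPhi; case: cid => FG /= [h _ _ _] /h []. Qed.

Lemma Phi0 nu : Phi nu 0 = 1. Proof. exact: Phi_le0. Qed.

Lemma dPhi0 nu : dPhi nu 0 = 0. Proof. exact: dPhi_le0. Qed.

Lemma is_derive_Phi nu r : is_derive r 1 (Phi nu) (dPhi nu r).
Proof. by rewrite /Phi /dPhi; case: cid => FG /= []. Qed.

Lemma dPhi_cont nu : continuous (dPhi nu).
Proof. by rewrite /dPhi; case: cid => FG /= []. Qed.

Lemma Phi_cont nu : continuous (Phi nu).
Proof. by move=> r; exact: is_derive_cont (is_derive_Phi nu r). Qed.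

Lemma is_derive_dPhi nu r : 0 < r ->
  is_derive r 1 (dPhi nu) (- (N%:R / r) * dPhi nu r - (q r + nu) * Phi nu r).
Proof. by rewrite /Phi /dPhi; case: cid => FG /= [_ _ _]; exact. Qed.

(** [F - F 0 * Phi nu] solves the homogeneous equation with zero data, so [energy_bound] with
    [d = 0] annihilates it. Derivatives are asked for only inside the interval, because [phi] is
    known at 0 only through one-sided limits. *)
Lemma regular_unique nu (F G : R -> R) S : 0 <= S ->
  {within `[0, S], continuous F} -> {within `[0, S], continuous G} -> G 0 = 0 ->
  (forall r, 0 < r < S -> is_derive r 1 F (G r)) ->
  (forall r, 0 < r < S ->
     is_derive r 1 G (- (N%:R / r) * G r - (q r + nu) * F r)) ->
  F S = F 0 * Phi nu S.
Proof.
move=> S0 cF cG G0 dF dG.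
pose D r := F r - F 0 * Phi nu r; pose D1 r := G r - F 0 * dPhi nu r.
have cD : {within `[0, S], continuous D}.
  move=> x; apply: cvgB; first exact: cF.
  by apply: cvgM; [exact: cvg_cst|apply: continuous_subspaceT; exact: Phi_cont].
have cD1 : {within `[0, S], continuous D1}.
  move=> x; apply: cvgB; first exact: cG.
  by apply: cvgM; [exact: cvg_cst|apply: continuous_subspaceT; exact: dPhi_cont].
have D0 : D 0 = 0 by rewrite /D Phi0 mulr1 subrr.
have D10 : D1 0 = 0 by rewrite /D1 dPhi0 mulr0 subr0.
have dD r : 0 < r < S -> is_derive r 1 D (D1 r).
  move=> rS; have := is_deriveD1 (dF r rS) (is_deriveN1
    (is_deriveM1 (is_derive_cst1 (F 0) r) (is_derive_Phi nu r))).
  by rewrite mul0r add0r.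
have dD1 r : 0 < r < S ->
    is_derive r 1 D1 (- (N%:R / r) * D1 r - (q r + nu) * D r - 0).
  move=> rS; have r0 : 0 < r by case/andP: rS.
  have := is_deriveD1 (dG r rS) (is_deriveN1
    (is_deriveM1 (is_derive_cst1 (F 0) r) (is_derive_dPhi nu r0))).
  by move/is_derive_eq; apply; rewrite /D /D1; ring.
have := @energy_bound _ N (fun r => q r + nu) (fun _ => 0) D D1 S (Q + `|nu|) 0 S0
  (addr_ge0 Q_ge0 (normr_ge0 nu)) cD cD1 D0 D10 dD dD1 (fun r _ => shift_bound nu r).
rewrite expr0n /= mulr0 => H.
have {}H : D S ^+ 2 + D1 S ^+ 2 <= 0 by apply: H => r _; rewrite normr0.
have DS : D S ^+ 2 = 0.
  by apply/eqP; rewrite eq_le sqr_ge0 andbT; have := sqr_ge0 (D1 S); lra.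
by apply/eqP; rewrite -subr_eq0 -sqrf_eq0 -/(D S) DS.
Qed.

(** The difference of the two solutions solves the equation for [nu'] with forcing
    [(nu' - nu) * Phi nu]; the energy bound makes it small together with its derivative. *)
Lemma Phi_near nu S e : 0 <= S -> 0 < e -> exists2 d, 0 < d &
  forall nu', `|nu' - nu| < d -> forall r, 0 <= r <= S ->
    `|Phi nu' r - Phi nu r| < e /\ `|dPhi nu' r - dPhi nu r| < e.
Proof.
move=> S0 e0; have [B B0 HB] := abs_bounded S0 (@Phi_cont nu).
pose M := Q + `|nu| + 1.
have M0 : 0 <= M by rewrite /M; have := Q_ge0; have := normr_ge0 nu; lra.
pose C := expR ((2 + M) * S).
have C1 : 1 <= C by rewrite -[X in X <= _]expR0 ler_expR mulr_ge0 // addr_ge0.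
have CB : 0 < C * B + 1 by have := mulr_ge0 (le_trans ler01 C1) B0; lra.
exists (Num.min 1 (e / (C * B + 1))); first by rewrite lt_min ltr01 divr_gt0.
move=> nu'; rewrite lt_min ltr_pdivlMr // => /andP[n1 n2] r /andP[r0 rS].
set m := `|nu' - nu| in n1 n2.
have m0 : 0 <= m by exact: normr_ge0.
pose D x := Phi nu' x - Phi nu x; pose D1 x := dPhi nu' x - dPhi nu x.
have cD : {within `[0, r], continuous D}.
  by apply: continuous_subspaceT => x; apply: cvgB; exact: Phi_cont.
have cD1 : {within `[0, r], continuous D1}.
  by apply: continuous_subspaceT => x; apply: cvgB; exact: dPhi_cont.
have D0 : D 0 = 0 by rewrite /D !Phi0 subrr.
have D10 : D1 0 = 0 by rewrite /D1 !dPhi0 subrr.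
have dD x : 0 < x < r -> is_derive x 1 D (D1 x).
  by move=> _; exact: is_deriveD1 (is_derive_Phi nu' x) (is_deriveN1 (is_derive_Phi nu x)).
have dD1 x : 0 < x < r -> is_derive x 1 D1
    (- (N%:R / x) * D1 x - (q x + nu') * D x - (nu' - nu) * Phi nu x).
  move=> /andP[x0 _].
  have := is_deriveD1 (is_derive_dPhi nu' x0) (is_deriveN1 (is_derive_dPhi nu x0)).
  by move/is_derive_eq; apply; rewrite /D /D1; ring.
have aM x : 0 < x < r -> `|q x + nu'| <= M.
  move=> _; apply: le_trans (shift_bound nu' x) _.
  have := ler_normD (nu' - nu) nu; rewrite subrK -/m /M; lra.
have hd x : 0 < x < r -> `|(nu' - nu) * Phi nu x| <= m * B.
  move=> /andP[x0 xr]; rewrite normrM ler_wpM2l // HB //.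
  by rewrite ltW //= (le_trans (ltW xr)).
have := energy_bound r0 M0 cD cD1 D0 D10 dD dD1 aM hd.
have mB : 0 <= m * B by exact: mulr_ge0.
have Cr : expR ((2 + M) * r) <= C.
  by rewrite ler_expR ler_wpM2l //; lra.
have CmB : C * (m * B) < e.
  by apply: le_lt_trans n2; rewrite mulrDr mulr1 mulrCA; lra.
(* As [1 <= C], the exponential is at most [C ^+ 2], which turns the bound into a square. *)
have C2 : expR ((2 + M) * r) * (m * B) ^+ 2 <= (C * (m * B)) ^+ 2.
  rewrite [X in _ <= X]exprMn; apply: ler_wpM2r; first exact: sqr_ge0.
  by apply: le_trans Cr _; rewrite expr2 ler_peMl //; lra.
have E2 : (C * (m * B)) ^+ 2 < e ^+ 2.
  by rewrite ltr_pXn2r // nnegrE ?(ltW e0) // mulr_ge0 //; lra.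
move=> H; have s1 := sqr_ge0 (D r); have s2 := sqr_ge0 (D1 r).
have abs_lt x : x ^+ 2 < e ^+ 2 -> `|x| < e.
  move=> h; rewrite -(ltr_pXn2r (n := 2)) ?nnegrE //; last exact: ltW.
  by rewrite real_normK ?num_real.
by split; apply: abs_lt; rewrite -?/(D r) -?/(D1 r); lra.
Qed.

(** A double zero would propagate backward to all of []0, z[] and contradict [Phi nu 0 = 1]. *)
Lemma Phi_simple nu z : 0 < z -> Phi nu z = 0 -> dPhi nu z != 0.
Proof.
move=> z0 Pz; apply/eqP => dz.
have H x : 0 < x -> x < z -> Phi nu x = 0.
  move=> x0 xz.
  apply: (energy_backward (N := N) x0 xz (addr_ge0 Q_ge0 (normr_ge0 nu))
    (fun r _ => is_derive_Phi nu r) _ (fun r _ => shift_bound nu r) Pz dz).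
  by move=> r /andP[xr _]; apply: is_derive_dPhi; exact: lt_le_trans xr.
have [d d0 Hd] := cont_ball (@Phi_cont nu 0) ltr01.
pose x := Num.min (d / 2) (z / 2).
have x0 : 0 < x by rewrite lt_min; apply/andP; split; lra.
have x1 : x <= d / 2 by rewrite ge_min lexx.
have x2 : x <= z / 2 by rewrite ge_min lexx orbT.
have := Hd x; rewrite subr0 gtr0_norm // Phi0 H //; last by lra.
rewrite sub0r normrN normr1 ltxx => h; suff : false by [].
by apply: h; lra.
Qed.

(** Near a zero the derivative does not vanish, so Rolle's theorem excludes a second zero. *)
Lemma Phi_isolated nu y : 0 <= y ->
  exists2 d, 0 < d & forall r, 0 < `|r - y| < d -> Phi nu r != 0.
Proof.
move=> y0; have [Py|Py] := eqVneq (Phi nu y) 0; last first.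
  have [d d0 Hd] := cont_neq0_near (@Phi_cont nu y) Py.
  by exists d => // r /andP[_ /Hd].
have yp : 0 < y.
  rewrite lt_neqAle y0 andbT; apply/eqP => E; move: Py.
  by rewrite -E Phi0 => /eqP; rewrite oner_eq0.
have [d d0 Hd] := cont_neq0_near (@dPhi_cont nu y) (Phi_simple yp Py).
exists d => // r /andP[ry rd]; apply/eqP => Pr.
have [E|ne] := eqVneq r y; first by rewrite E subrr normr0 ltxx in ry.
have [lt|lt|//] := ltgtP r y; last by move=> E; rewrite E eqxx in ne.
  have [c /andP[c1 c2] /eqP] := Rolle_zero lt (is_derive_Phi nu) (etrans Pr (esym Py)).
  by apply/negP; apply: Hd; move: rd; rewrite !ltr0_norm; lra.
have [c /andP[c1 c2] /eqP] := Rolle_zero lt (is_derive_Phi nu) (etrans Py (esym Pr)).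
by apply/negP; apply: Hd; move: rd; rewrite !gtr0_norm; lra.
Qed.

(** The infimum of the zeros in []y, z']] exceeds [y] because zeros are isolated. *)
Lemma Phi_next_zero nu y z' : 0 <= y -> y < z' -> Phi nu z' = 0 ->
  exists z, [/\ y < z <= z', Phi nu z = 0 & forall r, y < r < z -> Phi nu r != 0].
Proof.
move=> y0 yz Pz; have [d d0 Hd] := Phi_isolated nu y0.
pose A := [set r | y < r <= z' /\ Phi nu r = 0].
have Az : A z' by rewrite /A /= yz lexx.
have lbA : lbound A (y + d).
  move=> r [/andP[yr _] Pr]; rewrite leNgt; apply/negP => rd.
  by move: (Hd r); rewrite gtr0_norm ?Pr ?eqxx; [move=> H; suff : false by []; apply: H; lra|lra].
have iA : has_inf A by split; [exists z'|exists (y + d)].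
have zd : y + d <= inf A by apply: lb_le_inf => //; exists z'.
have zz : inf A <= z' by apply: ge_inf => //; exists (y + d).
exists (inf A); split.
- by rewrite zz andbT; lra.
- apply/eqP; rewrite -[_ == _]negbK; apply/negP => P0.
  have [e e0 He] := cont_neq0_near (@Phi_cont nu (inf A)) P0.
  have [r Ar rl] := inf_adherent e0 iA.
  have rI : inf A <= r by apply: ge_inf => //; exists (y + d).
  by move: (He r); case: Ar => _ ->; rewrite eqxx ger0_norm; [move=> H; suff : false by []; apply: H; lra|lra].
- move=> r /andP[yr rA]; apply/eqP => Pr.
  have : inf A <= r.
    by apply: ge_inf; [exists (y + d)|split => //; rewrite yr /=; lra].
  by rewrite leNgt rA.
Qed.

(** The origin may serve as left end although [Phi] does not vanish there: both solutions have slope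
    0 at it, which is the other end condition of [sturm_comparison_pos]. *)
Lemma Phi_sturm nu nu' y z' : nu < nu' -> 0 <= y -> y < z' ->
  y = 0 \/ Phi nu y = 0 -> Phi nu z' = 0 -> exists2 x, y < x < z' & Phi nu' x = 0.
Proof.
move=> nn y0 yz0 Hy Pz0.
have [z [/andP[yz zz] Pz Pn]] := Phi_next_zero y0 yz0 Pz0.
apply: contrapT => Hn.
have Pn' r : y < r < z -> Phi nu' r != 0.
  move=> /andP[r1 r2]; apply/eqP => Pr; apply: Hn; exists r => //.
  by rewrite r1 (lt_le_trans r2).
have [s s0 Hs] := nonzero_sign yz (@Phi_cont nu) Pn.
have [s' s0' Hs'] := nonzero_sign yz (@Phi_cont nu') Pn'.
have dF c mu r : is_derive r 1 (fun r => c * Phi mu r) (c * dPhi mu r).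
  by have := is_deriveM1 (is_derive_cst1 c r) (is_derive_Phi mu r); rewrite mul0r add0r.
have cG c mu : continuous (fun r => c * dPhi mu r).
  by move=> r; apply: cvgM; [exact: cvg_cst|exact: dPhi_cont].
have dG c mu r : 0 < r -> is_derive r 1 (fun r => c * dPhi mu r)
    (- (N%:R / r) * (c * dPhi mu r) - (q r + mu) * (c * Phi mu r)).
  move=> r0; have := is_deriveM1 (is_derive_cst1 c r) (is_derive_dPhi mu r0).
  by move/is_derive_eq; apply; ring.
apply: (sturm_comparison_pos (a1 := fun r => q r + nu) (a2 := fun r => q r + nu')
  y0 yz (dF s nu) (cG s nu) (dF s' nu') (cG s' nu') (dG s nu) (dG s' nu')).
- by move=> r; rewrite ltrD2l.
- by case: Hy => [->|->]; [left; rewrite !dPhi0 !mulr0|right; rewrite mulr0].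
- by rewrite Pz mulr0.
- exact: Hs.
- exact: Hs'.
Qed.

(* [Phi nu] has at least [k] zeros in the open interval ]0, t[. *)
Fixpoint zeros_ge nu (k : nat) t : Prop :=
  if k is j.+1 then exists z, [/\ 0 < z < t, Phi nu z = 0 & zeros_ge nu j z]
  else True.

Lemma zeros_ge_mono nu k t t' : t <= t' -> zeros_ge nu k t -> zeros_ge nu k t'.
Proof.
case: k => //= k tt [z [/andP[z0 zt] Pz Hz]]; exists z; split => //.
by rewrite z0 (lt_le_trans zt).
Qed.

Lemma zeros_ge_pred nu k t : zeros_ge nu k.+1 t -> zeros_ge nu k t.
Proof. by move=> [z [/andP[_ /ltW zt] _]]; exact: zeros_ge_mono. Qed.

Lemma zeros_ge_leq nu j k t : (j <= k)%N -> zeros_ge nu k t -> zeros_ge nu j t.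
Proof.
move=> /subnK <-; elim: (k - j)%N => [//|i IH]; rewrite addSn => H.
exact: IH (zeros_ge_pred H).
Qed.

Lemma zeros_ge_left nu k z : 0 < z -> zeros_ge nu k z ->
  exists2 s, 0 < s < z & zeros_ge nu k s.
Proof.
move=> z0; case: k => [_|k [y [/andP[y0 yz] Py Hy]]].
  by exists (z / 2) => //; apply/andP; split; lra.
exists ((y + z) / 2); first by apply/andP; split; lra.
by exists y; split => //; apply/andP; split; lra.
Qed.

(** The origin, the [k] zeros and [z] bound [k + 1] consecutive intervals, each of which contains a
    zero of [Phi nu']. *)
Lemma zeros_ge_sturm nu nu' k z : nu < nu' -> 0 < z -> Phi nu z = 0 ->
  zeros_ge nu k z -> zeros_ge nu' k.+1 z.
Proof.
move=> nn; elim: k z => [|k IH] z z0 Pz Hz.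
  have [|x xi Px] := Phi_sturm nn (lexx 0) z0 _ Pz; first by left.
  by exists x.
case: Hz => y [/andP[y0 yz] Py Hy].
have [|x /andP[x1 x2] Px] := Phi_sturm nn (ltW y0) yz _ Pz; first by right.
exists x; split => //; first by rewrite x2 (lt_trans y0).
exact: zeros_ge_mono (ltW x1) (IH y y0 Py Hy).
Qed.

(** A simple zero comes with a change of sign, which survives a small change of [nu]; the other
    zeros are handled by induction on an interval that ends before [z]. *)
Lemma zeros_ge_open nu k t : zeros_ge nu k t ->
  exists2 d, 0 < d & forall nu', `|nu' - nu| < d -> zeros_ge nu' k t.
Proof.
elim: k t => [|k IH] t /=; first by move=> _; exists 1.
move=> [z [/andP[z0 zt] Pz Hz]].
have [s /andP[s0 sz] Hs] := zeros_ge_left z0 Hz.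
have [d1 d10 H1] := IH s Hs.
have [e e0 He] := cont_neq0_near (@dPhi_cont nu z) (Phi_simple z0 Pz).
(* The window [[z - d, z + d]] must stay to the right of [s], to the left of [t], and where the
   derivative does not vanish. *)
have [d d0 [ds dt de]] : exists2 d, 0 < d & [/\ d < z - s, d < t - z & d < e].
  exists (Num.min ((z - s) / 2) (Num.min ((t - z) / 2) (e / 2))).
    by rewrite !lt_min; apply/and3P; split; lra.
  by split; rewrite !gt_min; apply/or3P; [apply: Or31|apply: Or32|apply: Or33]; lra.
have nz r : z - d < r < z + d -> dPhi nu r != 0.
  by move=> /andP[r1 r2]; apply: He; rewrite ltr_norml; apply/andP; split; lra.
have [|c c0 Hc] := nonzero_sign _ (@dPhi_cont nu) nz; first by lra.
have mono x y : z - d <= x -> x < y -> y <= z + d -> c * Phi nu x < c * Phi nu y.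
  move=> x1 xy y1; apply: (@derive_pos_lt _ (fun r => c * Phi nu r) (fun r => c * dPhi nu r)) => //.
  - by apply: within_cont => r _; apply: cvgM; [exact: cvg_cst|exact: Phi_cont].
  - move=> r _; have := is_deriveM1 (is_derive_cst1 c r) (is_derive_Phi nu r).
    by rewrite mul0r add0r.
  - by move=> r /andP[r1 r2]; apply: Hc; apply/andP; split; lra.
have c2 : 0 < c ^+ 2 by rewrite exprn_even_gt0.
have A1 : c * Phi nu (z - d) < 0.
  by have := mono (z - d) z (lexx _); rewrite Pz mulr0; apply; lra.
have B1 : 0 < c * Phi nu (z + d).
  by have := mono z (z + d); rewrite Pz mulr0; apply; lra.
pose m := Num.min `|Phi nu (z - d)| `|Phi nu (z + d)|.
have m0 : 0 < m.
  rewrite lt_min !normr_gt0; apply/andP; split.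
    by apply: contraTneq A1 => ->; rewrite mulr0 ltxx.
  by apply: contraTneq B1 => ->; rewrite mulr0 ltxx.
have t0 : 0 <= t by lra.
have [d2 d20 H2] := Phi_near nu t0 m0.
exists (Num.min d1 d2); first by rewrite lt_min d10.
move=> nu'; rewrite lt_min => /andP[/H1 K1 /H2 K2].
have Zs x : 0 <= x <= t -> m <= `|Phi nu x| -> 0 < Phi nu' x * Phi nu x.
  move=> /K2[+ _] mx; move/lt_le_trans => /(_ _ mx).
  have [px|px] := leP 0 (Phi nu x).
    rewrite (ger0_norm px) ltr_norml => /andP[h1 h2]; apply: mulr_gt0; first by lra.
    by rewrite lt_neqAle px andbT; apply: contraTneq mx => <-; rewrite normr0 -ltNge.
  rewrite (ltr0_norm px) ltr_norml => /andP[h1 h2].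
  by rewrite nmulr_lgt0 //; lra.
have Za : 0 < Phi nu' (z - d) * Phi nu (z - d).
  by apply: Zs; [apply/andP; split; lra|rewrite ge_min lexx].
have Zb : 0 < Phi nu' (z + d) * Phi nu (z + d).
  by apply: Zs; [apply/andP; split; lra|rewrite ge_min lexx orbT].
have sgn : Phi nu' (z - d) * Phi nu' (z + d) < 0.
  have h : 0 < Phi nu' (z - d) * Phi nu (z - d) * (Phi nu' (z + d) * Phi nu (z + d)).
    exact: mulr_gt0.
  have g : c * Phi nu (z - d) * (c * Phi nu (z + d)) < 0 by rewrite nmulr_rlt0.
  have g' : Phi nu (z - d) * Phi nu (z + d) < 0.
    rewrite -(pmulr_rlt0 _ c2); suff -> : c ^+ 2 * (Phi nu (z - d) * Phi nu (z + d)) =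
      c * Phi nu (z - d) * (c * Phi nu (z + d)) by [].
    by ring.
  rewrite -(nmulr_rgt0 _ g'); move: h; congr (is_true (_ < _)); ring.
have zd : z - d <= z + d by lra.
have [x /andP[x1 x2] Px] := IVT_zero zd (@Phi_cont nu') sgn.
exists x; split => //; first by apply/andP; split; lra.
by apply: zeros_ge_mono K1; lra.
Qed.

(* Zeros can only be created in pairs, through a double zero, or enter
   through the endpoint [t]. *)
Lemma zeros_ge_usc nu k t : 0 < t -> ~ zeros_ge nu k t -> Phi nu t != 0 ->
  exists2 d, 0 < d & forall nu', `|nu' - nu| < d -> ~ zeros_ge nu' k t.
Proof.
elim: k t => [|k IH] t t0 Hk Pt; first by case: Hk.
have [[z0 [z0t Pz0]]|Hno] := pselect (exists z, 0 < z < t /\ Phi nu z = 0); last first.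
  have nz r : 0 <= r <= t -> Phi nu r != 0.
    move=> /andP[]; rewrite le_eqVlt => /orP[/eqP<- _|r0].
      by rewrite Phi0 oner_eq0.
    rewrite le_eqVlt => /orP[/eqP->//|rt]; apply/eqP => Pr; apply: Hno.
    by exists r; rewrite r0.
  have [m m0 Hm] := abs_bounded_below (ltW t0) (@Phi_cont nu) nz.
  have [d d0 Hd] := Phi_near nu (ltW t0) m0.
  exists d => // nu' /Hd K [z [/andP[z0 zt] Pz _]].
  have zi : 0 <= z <= t by rewrite !ltW.
  by have [] := K z zi; rewrite Pz sub0r normrN ltNge Hm.
(* Its supremum [z] is the last zero before [t]. From [z + d] to [t] the solution stays away from 0,
   and around [z] its derivative does; so a nearby solution has at most one zero from [z - d] on. *)
pose A := [set z | 0 < z < t /\ Phi nu z = 0].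
have sA : has_sup A.
  by split; [exists z0|exists t => r [/andP[_ /ltW]]].
pose z := sup A.
have zA r : A r -> r <= z by move=> Ar; apply: sup_upper_bound.
have zp : 0 < z.
  by have /andP[h _] := z0t; exact: lt_le_trans h (zA _ (conj z0t Pz0)).
have zt : z <= t by apply: sup_le_ub; [case: sA|move=> r [/andP[_ /ltW]]].
have Pz : Phi nu z = 0.
  apply/eqP; rewrite -[_ == _]negbK; apply/negP => P0.
  have [e e0 He] := cont_neq0_near (@Phi_cont nu z) P0.
  have [r Ar rl] := sup_adherent e0 sA.
  have rz := zA _ Ar; case: Ar => _ Pr.
  have : Phi nu r != 0 by apply: He; rewrite ler0_norm; move: rl; rewrite -/z; lra.
  by rewrite Pr eqxx.
have {}zt : z < t.
  by rewrite lt_neqAle zt andbT; apply: contraNneq Pt => <-; rewrite Pz.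
have Hkz : ~ zeros_ge nu k z.
  by move=> H; apply: Hk; exists z; rewrite zp zt.
have [e e0 He] := cont_neq0_near (@dPhi_cont nu z) (Phi_simple zp Pz).
have [d d0 [dz dt de]] : exists2 d, 0 < d & [/\ d < z, d < t - z & d < e].
  exists (Num.min (z / 2) (Num.min ((t - z) / 2) (e / 2))).
    by rewrite !lt_min; apply/and3P; split; lra.
  by split; rewrite !gt_min; apply/or3P; [apply: Or31|apply: Or32|apply: Or33]; lra.
have zd : 0 < z - d by lra.
have Pzd : Phi nu (z - d) != 0.
  apply/eqP => P0; have lt : z - d < z by lra.
  have [c /andP[c1 c2] /eqP] := Rolle_zero lt (is_derive_Phi nu) (etrans P0 (esym Pz)).
  by apply/negP; apply: He; rewrite ltr0_norm; lra.
have zdz : z - d <= z by lra.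
have [d1 d10 H1] := IH _ zd (fun H => Hkz (zeros_ge_mono zdz H)) Pzd.
have nz1 r : z - d <= r <= z + d -> dPhi nu r != 0.
  by move=> /andP[r1 r2]; apply: He; rewrite ltr_norml; apply/andP; split; lra.
have nz2 r : z + d <= r <= t -> Phi nu r != 0.
  move=> /andP[r1]; rewrite le_eqVlt => /orP[/eqP->//|r2]; apply/eqP => Pr.
  have : r <= z by apply: zA; split => //; apply/andP; split; lra.
  lra.
have zdd : z - d <= z + d by lra.
have zdt : z + d <= t by lra.
have [m1 m10 Hm1] := abs_bounded_below zdd (@dPhi_cont nu) nz1.
have [m2 m20 Hm2] := abs_bounded_below zdt (@Phi_cont nu) nz2.
have m0 : 0 < Num.min m1 m2 by rewrite lt_min m10.
have [d2 d20 H2] := Phi_near nu (ltW t0) m0.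
exists (Num.min d1 d2); first by rewrite lt_min d10.
move=> nu'; rewrite lt_min => /andP[/H1 K1 /H2 K2] [y [/andP[y0 yt] Py Hy]].
have yz : y < z + d.
  rewrite ltNge; apply/negP => zy.
  have [|+ _] := K2 y; first by rewrite !ltW.
  by rewrite Py sub0r normrN lt_min [_ < m2]ltNge Hm2 ?andbF // zy ltW.
apply: K1; clear H1 IH Hk; case: k Hkz Hy => [[]//|k _ [x [/andP[x0 xy] Px Hx]]].
exists x; split => //; rewrite x0 /= ltNge; apply/negP => zx.
have [c /andP[c1 c2] Pc] := Rolle_zero xy (is_derive_Phi nu') (etrans Px (esym Py)).
have [|_] := K2 c; first by apply/andP; split; lra.
by rewrite Pc sub0r normrN lt_min [_ < m1]ltNge Hm1 //; apply/andP; split; lra.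
Qed.

(** If [t] itself is a zero, only that one can enter: [zeros_ge_usc] is applied at a slightly larger
    [t'], where [Phi nu] does not vanish and before which [t] is the only additional zero. *)
Lemma zeros_ge_usc_end nu k t : 0 < t -> ~ zeros_ge nu k t -> Phi nu t = 0 ->
  exists2 d, 0 < d & forall nu', `|nu' - nu| < d -> ~ zeros_ge nu' k.+1 t.
Proof.
move=> t0 Hk Pt; have [d d0 Hd] := Phi_isolated nu (ltW t0).
pose t' := t + d / 2.
have t'0 : 0 < t' by rewrite /t'; lra.
have Pt' : Phi nu t' != 0 by apply: Hd; rewrite /t' gtr0_norm; lra.
have [|e e0 He] := zeros_ge_usc (k := k.+1) t'0 _ Pt'.
  move=> [z [/andP[z0 zt] Pz Hz]]; apply: Hk; apply: zeros_ge_mono Hz.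
  rewrite leNgt; apply/negP => tz; move: (Hd z); rewrite Pz eqxx => H.
  by suff : false by []; apply: H; rewrite gtr0_norm; move: zt; rewrite /t'; lra.
exists e => // nu' /He H1 H2; apply: H1; apply: zeros_ge_mono H2.
by rewrite /t'; lra.
Qed.

(** With [q + nu <= 0], the product [r ^+ N * (Phi nu r * dPhi nu r)] is nondecreasing from 0, hence
    [Phi nu r ^+ 2] is nondecreasing from 1. This bounds below the parameters for which zeros
    exist. *)
Lemma Phi_no_zero nu r : nu <= - Q -> 0 <= r -> Phi nu r != 0.
Proof.
move=> nQ; rewrite le_eqVlt => /orP[/eqP<-|r0]; first by rewrite Phi0 oner_eq0.
have an x : q x + nu <= 0 by have /andP[_] := qQ x; lra.
pose W x := x ^+ N * (Phi nu x * dPhi nu x).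
have cW : continuous W.
  move=> x; apply: cvgM; first exact: exprn_continuous.
  by apply: cvgM; [exact: Phi_cont|exact: dPhi_cont].
have W0 x : 0 < x -> 0 <= W x.
  move=> x0; have : W 0 <= W x.
    apply: (@derive_nonneg_le _ W
      (fun y => y ^+ N * (dPhi nu y ^+ 2 - (q y + nu) * Phi nu y ^+ 2))).
    - exact: ltW.
    - by apply: within_cont => y _; exact: cW.
    - move=> y /andP[y0 _].
      have := is_deriveM1 (is_deriveX1 N (is_derive_id1 y))
        (is_deriveM1 (is_derive_Phi nu y) (is_derive_dPhi nu y0)).
      move/is_derive_eq; apply; have y1 : y != 0 by rewrite gt_eqF.
      by case: (N) => [|N1] /=; [rewrite expr0; field|rewrite exprS; field].
    - move=> y /andP[y0 _]; apply: mulr_ge0; first by rewrite exprn_ge0 // ltW.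
      rewrite subr_ge0; apply: le_trans (sqr_ge0 _).
      by rewrite mulr_le0_ge0 // sqr_ge0.
  by rewrite {1}/W dPhi0 !mulr0.
have : Phi nu 0 ^+ 2 <= Phi nu r ^+ 2.
  apply: (@derive_nonneg_le _ (fun x => Phi nu x ^+ 2)
    (fun x => 2%:R * Phi nu x ^+ 1 * dPhi nu x)).
  - exact: ltW.
  - by apply: within_cont => x _; exact: is_derive_cont (is_deriveX1 2 (is_derive_Phi nu x)).
  - by move=> x _; exact: is_deriveX1 (is_derive_Phi nu x).
  - move=> x /andP[x0 _]; rewrite expr1 -mulrA mulr_ge0 //.
    by have := W0 x x0; rewrite /W pmulr_rge0 ?exprn_gt0.
rewrite Phi0 expr1n; apply: contraTneq => ->.
by rewrite expr0n /= -ltNge ltr01.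
Qed.

(** The witness is the infimum of the parameters with at least [k + 1] zeros. Openness keeps it out
    of that set, and the two upper semicontinuity lemmas force a zero at [t] and at least [k] zeros
    before it. *)
Lemma eigenvalue_exists nu0 k t : 0 < t -> zeros_ge nu0 k.+1 t ->
  exists nu, [/\ nu < nu0, Phi nu t = 0, zeros_ge nu k t & ~ zeros_ge nu k.+1 t].
Proof.
move=> t0 H0; pose A := [set nu | zeros_ge nu k.+1 t].
have lbA : lbound A (- Q).
  move=> nu [z [/andP[z0 _] Pz _]]; rewrite leNgt; apply/negP => /ltW nQ.
  by have := Phi_no_zero nQ (ltW z0); rewrite Pz eqxx.
have iA : has_inf A by split; [exists nu0|exists (- Q)].
pose nu := inf A.
have nuA mu : A mu -> nu <= mu by move=> Amu; apply: ge_inf => //; exists (- Q).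
have Hn : ~ zeros_ge nu k.+1 t.
  move=> H; have [d d0 Hd] := zeros_ge_open H.
  have : nu <= nu - d / 2.
    by apply: nuA; apply: Hd; rewrite addrAC subrr add0r normrN gtr0_norm; lra.
  lra.
have near d : 0 < d -> exists2 mu, `|mu - nu| < d & zeros_ge mu k.+1 t.
  move=> d0; have [mu Amu ml] := inf_adherent d0 iA.
  exists mu => //; have num := nuA _ Amu.
  by rewrite ger0_norm ?subr_ge0 // ltrBlDl.
have Pt : Phi nu t = 0.
  apply/eqP; rewrite -[_ == _]negbK; apply/negP => P0.
  have [d d0 Hd] := zeros_ge_usc t0 Hn P0.
  by have [mu /Hd] := near d d0.
exists nu; split => //.
  by rewrite lt_neqAle nuA // andbT; apply: contra_notN Hn => /eqP ->.
apply: contrapT => Hk; have [d d0 Hd] := zeros_ge_usc_end t0 Hk Pt.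
by have [mu /Hd] := near d d0.
Qed.

(** Continuity induction on the right end: since zeros are isolated, the supremum of the ends with
    finitely many zeros before them cannot lie below [t]. *)
Lemma zeros_finite nu t : 0 <= t -> exists k, ~ zeros_ge nu k t.
Proof.
move=> t0; pose A := [set s | 0 <= s <= t /\ exists k, ~ zeros_ge nu k s].
have A0 : A 0.
  split; first by rewrite lexx.
  by exists 1%N => -[z [/andP[z0 z1] _ _]]; have := lt_trans z0 z1; rewrite ltxx.
have sA : has_sup A by split; [exists 0|exists t => s [/andP[]]].
pose s := sup A.
have sU r : A r -> r <= s by move=> Ar; apply: sup_upper_bound.
have s0 : 0 <= s by exact: sU.
have [d d0 Hd] := Phi_isolated nu s0.
have [r Ar rl] := sup_adherent d0 sA.
case: Ar => rt [k Hk].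
pose s' := Num.min (s + d / 2) t.
have ss : s' <= s + d / 2 by rewrite ge_min lexx.
have As' : A s'.
  split; first by rewrite le_min t0 andbT ge_min lexx orbT andbT; lra.
  (* Two more than [k]: of the two largest zeros, at most one lies beyond [r], namely [s], so the
     second is at most [r] and the other [k] lie before it. *)
  exists k.+2 => -[z [/andP[z0 zs] Pz [y [/andP[y0 yz] Py Hy]]]]; apply: Hk.
  apply: zeros_ge_mono Hy; rewrite leNgt; apply/negP => ry.
  have E x : s - d < x -> x < s + d -> Phi nu x = 0 -> x = s.
    move=> x1 x2 Px; apply/eqP; rewrite -[_ == _]negbK; apply/negP => xs.
    have : Phi nu x != 0.
      by apply: Hd; rewrite normr_gt0 subr_eq0 xs ltr_norml /=; apply/andP; split; lra.
    by rewrite Px eqxx.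
  have rl' : s - d < r by exact: rl.
  have Ey : y = s by apply: E => //; lra.
  have Ez : z = s by apply: E => //; lra.
  lra.
have := sU _ As'; rewrite /s' ge_min => /orP[|ts]; first by lra.
case: As' => _ [j]; rewrite /s' (min_r _) //; first by exists j.
by lra.
Qed.

Lemma zeros_count nu t : 0 <= t -> exists k, zeros_ge nu k t /\ ~ zeros_ge nu k.+1 t.
Proof.
move=> /(zeros_finite nu)[k]; elim: k => [[]//|k IH Hk].
by have [/IH//|Hk'] := pselect (~ zeros_ge nu k t); exists k; split => //; exact: contrapT.
Qed.

(** The intervals are open: just left of [z] the zero [z] is not counted and nothing else changes,
    just right of [z] it is counted. This shift is the jump of the Morse index. *)
Lemma zeros_near_zero nu z : 0 < z -> Phi nu z = 0 ->
  exists d, [/\ 0 < d, d < z,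
   forall k t, z - d < t < z -> zeros_ge nu k t <-> zeros_ge nu k z
   & forall k t, z < t < z + d -> zeros_ge nu k.+1 t <-> zeros_ge nu k z].
Proof.
move=> z0 Pz; have [d d0 Hd] := Phi_isolated nu (ltW z0).
have E x : z - d < x -> x < z + d -> Phi nu x = 0 -> x = z.
  move=> x1 x2 Px; apply/eqP; rewrite -[_ == _]negbK; apply/negP => xs.
  have : Phi nu x != 0.
    by apply: Hd; rewrite normr_gt0 subr_eq0 xs ltr_norml /=; apply/andP; split; lra.
  by rewrite Px eqxx.
exists (Num.min d (z / 2)).
have e1 : Num.min d (z / 2) <= d by rewrite ge_min lexx.
have e2 : Num.min d (z / 2) <= z / 2 by rewrite ge_min lexx orbT.
split; [by rewrite lt_min d0; lra|lra| |].
- move=> k t /andP[t1 t2]; split; first by apply: zeros_ge_mono; exact: ltW.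
  case: k => // k [x [/andP[x0 xz] Px Hx]]; exists x; split => //; rewrite x0 /=.
  rewrite ltNge; apply/negP => tx; have : x = z by apply: E => //; lra.
  by move=> xz'; rewrite xz' ltxx in xz.
- move=> k t /andP[t1 t2]; split; last by move=> H; exists z; rewrite z0 t1.
  move=> [x [/andP[x0 xt] Px Hx]]; apply: zeros_ge_mono Hx.
  rewrite leNgt; apply/negP => zx; have : x = z by apply: E => //; lra.
  by move=> xz; rewrite xz ltxx in zx.
Qed.

(** Going up from the smallest parameter, each passage to a larger one, the last being to [nu0],
    gains a zero in []0, t[] by [zeros_ge_sturm]. *)
Lemma eigenvalue_chain nu0 t (s : seq R) : 0 < t ->
  path (fun x y => y < x) nu0 s -> (forall nu, nu \in s -> Phi nu t = 0) ->
  zeros_ge nu0 (size s) t.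
Proof.
move=> t0; elim: s nu0 => [//|nu s IH] nu0; rewrite [path _ _ _]/= => /andP[nn ps] Hs.
apply: (zeros_ge_sturm nn t0); first by apply: Hs; rewrite mem_head.
by apply: IH => // mu ms; apply: Hs; rewrite inE ms orbT.
Qed.

Lemma eigenvalue_count nu0 t k (nus : 'I_k -> R) : 0 < t -> injective nus ->
  (forall i, nus i < nu0) -> (forall i, Phi (nus i) t = 0) -> zeros_ge nu0 k t.
Proof.
move=> t0 inj lt0 P0; pose s := rev (sort <=%O (codom nus)).
have ss : size s = k by rewrite size_rev size_sort size_codom card_ord.
have ms mu : mu \in s -> exists i, mu = nus i.
  by rewrite mem_rev mem_sort => /codomP[i ->]; exists i.
rewrite -ss; apply: eigenvalue_chain => //; last by move=> mu /ms[i ->].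
have : sorted (fun x y => y < x) s.
  rewrite /s rev_sorted; rewrite (_ : sorted _ _ = sorted <%O (sort <=%O (codom nus))) //.
  by rewrite sort_lt_sorted; apply/injectiveP.
case: s ms {ss} => //= mu s ms ->; rewrite andbT.
by have [|i ->] := ms mu; first by rewrite mem_head.
Qed.

Lemma is_derive_sum1 k (f : 'I_k -> R -> R) (df : 'I_k -> R) x :
  (forall i, is_derive x 1 (f i) (df i)) ->
  is_derive x 1 (fun y => \sum_(i < k) f i y) (\sum_(i < k) df i).
Proof. by move=> H; have := is_derive_sum H; rewrite fct_sumE. Qed.

Lemma derive_zero_open (F : R -> R) (l : R) x S : 0 < x < S ->
  (forall r, 0 < r < S -> F r = 0) -> is_derive x 1 F l -> l = 0.
Proof.
move=> /andP[x0 xS] F0 dF.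
suff : is_derive x 1 F 0 by case: dF => _ <- [_ <-].
apply: (is_derive_near _ (is_derive_cst1 0 x)); near=> y; apply/esym/F0.
by apply/andP; split; near: y; [exact: lt_nbhsr|exact: lt_nbhsl].
Unshelve. all: by end_near. Qed.

(** Minus the radial operator shifted by [a], applied to the relation, multiplies each coefficient
    by [nus i - a]. *)
Lemma Phi_comb_step k (nus c : 'I_k -> R) S a :
  (forall r, 0 < r < S -> \sum_i c i * Phi (nus i) r = 0) ->
  forall r, 0 < r < S -> \sum_i c i * (nus i - a) * Phi (nus i) r = 0.
Proof.
move=> H r rS.
have dc x (f : R -> R) l (d : R) : is_derive x 1 f l ->
    is_derive x 1 (fun y => d * f y) (d * l).
  by move=> df; have := is_deriveM1 (is_derive_cst1 d x) df; rewrite mul0r add0r.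
have H1 x : 0 < x < S -> \sum_i c i * dPhi (nus i) x = 0.
  move=> xS; apply: (derive_zero_open xS H); apply: is_derive_sum1 => i.
  by apply: dc; exact: is_derive_Phi.
have r0 : 0 < r by case/andP: rS.
have H2 : \sum_i c i * (- (N%:R / r) * dPhi (nus i) r - (q r + nus i) * Phi (nus i) r) = 0.
  apply: (derive_zero_open rS H1); apply: is_derive_sum1 => i.
  by apply: dc; exact: is_derive_dPhi.
have E : \sum_i c i * (nus i - a) * Phi (nus i) r =
  - (N%:R / r) * (\sum_i c i * dPhi (nus i) r)
  - (q r + a) * (\sum_i c i * Phi (nus i) r)
  - \sum_i c i * (- (N%:R / r) * dPhi (nus i) r - (q r + nus i) * Phi (nus i) r).
  rewrite !mulr_sumr -!sumrB; apply: eq_bigr => i _; ring.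
by rewrite E H1 // H // H2 !mulr0 !subr0.
Qed.

(** Applying the preceding step with every parameter other than [nus i] leaves a single term, whose
    coefficient is [c i] times a product of nonzero differences. *)
Lemma Phi_lin_indep k (nus c : 'I_k -> R) S : 0 < S -> injective nus ->
  (forall r, 0 < r < S -> \sum_i c i * Phi (nus i) r = 0) -> forall i, c i = 0.
Proof.
move=> S0 inj H i.
have H1 (s : seq R) r : 0 < r < S ->
    \sum_j (c j * \prod_(a <- s) (nus j - a)) * Phi (nus j) r = 0.
  elim: s r => [|a s IH] r rS.
    by rewrite -[RHS](H r rS); apply: eq_bigr => j _; rewrite big_nil mulr1.
  rewrite -[RHS](Phi_comb_step a IH rS); apply: eq_bigr => j _.
  by rewrite big_cons; ring.
have P0 : Phi (nus i) 0 != 0 by rewrite Phi0 oner_eq0.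
have [d d0 Hd] := cont_neq0_near (@Phi_cont (nus i) 0) P0.
have {}Hd : exists2 r, 0 < r < S & Phi (nus i) r != 0.
  have m0 : 0 < Num.min d S by rewrite lt_min d0.
  have m1 : Num.min d S <= d by rewrite ge_min lexx.
  have m2 : Num.min d S <= S by rewrite ge_min lexx orbT.
  exists (Num.min d S / 2); first by apply/andP; split; lra.
  by apply: Hd; rewrite subr0 gtr0_norm; lra.
case: Hd => r rS Pr.
have := H1 [seq nus j | j <- enum 'I_k & j != i] r rS.
rewrite (bigD1 i) //= [X in _ + X]big1 ?addr0; last first.
  move=> j ji; rewrite (_ : \prod_(a <- _) _ = 0) ?mulr0 ?mul0r //.
  have js : j \in [seq l <- enum 'I_k | l != i] by rewrite mem_filter ji mem_enum.
  have us : uniq [seq l <- enum 'I_k | l != i] by rewrite filter_uniq // enum_uniq.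
  by rewrite big_map (bigD1_seq j js us) /= subrr mul0r.
move/eqP; rewrite !mulf_eq0 (negbTE Pr) orbF => /orP[/eqP//|].
rewrite big_map prodf_seq_eq0 => /hasP[j]; rewrite mem_filter => /andP[ji _] /=.
by rewrite subr_eq0 => /eqP/inj E; rewrite E eqxx in ji.
Qed.

End Sturm.

(** * The profile w *)

Section MEMSProfile.
Context {R : realType}.
Variables (N : nat) (p : R) (w : R -> R).
Hypotheses (p0 : 0 < p) (hw : is_w N.+1 p w).
Implicit Types (t r x e : R).
Let dw : R -> R := derive1 w.

Lemma w_0 : w 0 = 1. Proof. by case: hw. Qed.

Lemma w_gt0 t : 0 < t -> 0 < w t.
Proof. by case: hw => _ [_ [_ [h _]]]; exact: h. Qed.

Lemma is_derive_w t : 0 < t -> is_derive t 1 w (dw t).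
Proof.
case: hw => _ [_ [_ [_ [h _]]]] /h[h1 _]; rewrite /dw derive1E.
exact: derivableP.
Qed.

Lemma is_derive_dw t : 0 < t -> is_derive t 1 dw (- (N%:R / t) * dw t + w t `^ (- p)).
Proof.
case: hw => _ [_ [_ [_ [h k]]]] t0; have [_ h1] := h t t0.
have := k t t0; rewrite derive1nS derive1n1 -natr1 addrK div1r => E.
apply: (is_derive_eq (derivableP h1)); rewrite -derive1E powRN.
by move: E; rewrite -/dw => <-; ring.
Qed.

Lemma w_right e : 0 < e -> exists2 d, 0 < d & forall r, 0 < r < d -> `|w r - 1| < e.
Proof.
move=> e0; case: hw => _ [/cvgrPdist_lt/(_ e e0)[d /= d0 Hd] _].
exists d => // r /andP[r0 rd]; rewrite distrC; apply: Hd => //=.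
by rewrite sub0r normrN gtr0_norm.
Qed.

Lemma w_right_derive e : 0 < e ->
  exists2 d, 0 < d & forall r, 0 < r < d -> `|w r - w 0| < e * r.
Proof.
move=> e0; case: hw => _ [_ [/cvgrPdist_lt/(_ e e0)[d /= d0 Hd] _]].
exists d => // r /andP[r0 rd].
have := Hd r; rewrite /= !sub0r !normrN gtr0_norm // => /(_ rd r0).
by rewrite normrM normfV (gtr0_norm r0) ltr_pdivrMr.
Qed.

Lemma w_within T : {within `[0, T], continuous w}.
Proof.
have [T0|T0] := ltP 0 T; last first.
  move: T0; rewrite le_eqVlt => /orP[/eqP->|T0].
    by rewrite set_itv1; exact: continuous_subspace1.
  by rewrite set_itv_ge ?bnd_simp -?ltNge //; exact: continuous_subspace0.
apply/continuous_within_itvP => //; split.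
- move=> x; rewrite in_itv /= => /andP[x0 _].
  exact: is_derive_cont (is_derive_w x0).
- by rewrite w_0; case: hw => _ [].
- by apply: cvg_at_left_filter; exact: is_derive_cont (is_derive_w T0).
Qed.

(** No limit of [derive1 w] at 0 is given; the one-sided derivative at 0 and the mean value theorem
    make it small at points arbitrarily close to 0. *)
Lemma dw_small e : 0 < e -> exists2 x, 0 < x < e & `|dw x| < e.
Proof.
move=> e0; have [d d0 Hd] := w_right_derive e0.
pose h := Num.min (d / 2) (e / 2).
have h0 : 0 < h by rewrite lt_min; apply/andP; split; lra.
have hd : h <= d / 2 by rewrite ge_min lexx.
have he : h <= e / 2 by rewrite ge_min lexx orbT.
have dx x : 0 < x < h -> is_derive x 1 w (dw x).
  by move=> /andP[x0 _]; exact: is_derive_w.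
have [c /andP[c0 ch] E] := MVT1 h0 (@w_within h) dx.
exists c; first by apply/andP; split; lra.
have := Hd h; rewrite E subr0 normrM (gtr0_norm h0) ltr_pM2r //; apply.
by rewrite h0; lra.
Qed.

(** The flux of [w]: by the equation its derivative is [r ^+ N] times a power of [w], which is
    positive, and the damping term disappears. *)
Let P r := r ^+ N * dw r.

Lemma is_derive_P r : 0 < r -> is_derive r 1 P (r ^+ N * w r `^ (- p)).
Proof.
move=> r0; have := is_deriveM1 (is_deriveX1 N (is_derive_id1 r)) (is_derive_dw r0).
move/is_derive_eq; apply; have r1 : r != 0 by rewrite gt_eqF.
by case: (N) => [|N1] /=; [rewrite expr0; field|rewrite exprS; field].
Qed.

Lemma P_small e : 0 < e -> exists2 x, 0 < x < e & `|P x| < e.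
Proof.
move=> e0; have m0 : 0 < Num.min e 1 by rewrite lt_min e0 ltr01.
have [x /andP[x0 xm] dx] := dw_small m0.
exists x; first by rewrite x0 (lt_le_trans xm) // ge_min lexx.
rewrite normrM (gtr0_norm (exprn_gt0 _ x0)).
apply: le_lt_trans (_ : `|dw x| < e); last first.
  by apply: lt_le_trans dx _; rewrite ge_min lexx.
rewrite ler_piMl // exprn_ile1 //; first exact: ltW.
by apply: ltW; apply: lt_le_trans xm _; rewrite ge_min lexx orbT.
Qed.

(* [P] tends to [0] along a sequence, which is enough for monotone functions. *)
Lemma P_compare (H H' : R -> R) r : 0 < r ->
  (forall x, 0 < x <= r -> is_derive x 1 H (H' x)) ->
  (forall x, 0 < x <= r -> 0 <= x ^+ N * w x `^ (- p) - H' x) ->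
  (forall x, 0 < x <= r -> x < 1 -> H x <= x) -> H r <= P r.
Proof.
move=> r0 dH dle Hx; rewrite -subr_ge0 leNgt; apply/negP => neg.
pose m := Num.min r (Num.min 1 ((H r - P r) / 4)).
have m0 : 0 < m by rewrite !lt_min r0 ltr01; lra.
have m1 : m <= r by rewrite ge_min lexx.
have m2 : m <= 1 by rewrite !ge_min lexx orbT.
have m3 : m <= (H r - P r) / 4 by rewrite !ge_min lexx !orbT.
have [x /andP[x0 xm] Px] := P_small m0.
have xr : x <= r by lra.
have W y : x <= y <= r -> 0 < y <= r.
  by move=> /andP[xy ->]; rewrite (lt_le_trans x0).
have d1 y : x <= y <= r -> is_derive y 1 (fun y => P y - H y)
    (y ^+ N * w y `^ (- p) - H' y).
  move=> /W yi; apply: is_deriveD1; last by apply: is_deriveN1; exact: dH.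
  by apply: is_derive_P; case/andP: yi.
have : P x - H x <= P r - H r.
  apply: (@derive_nonneg_le _ (fun y => P y - H y)
    (fun y => y ^+ N * w y `^ (- p) - H' y)) => //.
  - by apply: within_cont => y /d1/is_derive_cont.
  - by move=> y /andP[/ltW xy /ltW yr]; apply: d1; rewrite xy.
  - by move=> y /andP[/ltW xy /ltW yr]; apply: dle; apply: W; rewrite xy.
have : H x <= x by apply: Hx; [rewrite x0|lra].
move: Px; rewrite ltr_norml => /andP[]; lra.
Qed.

Lemma wN_gt0 s t : 0 < t -> 0 < w t `^ s.
Proof. by move=> /w_gt0; exact: powR_gt0. Qed.

Lemma dw_ge0 r : 0 < r -> 0 <= dw r.
Proof.
move=> r0; suff : 0 <= P r by rewrite /P pmulr_rge0 // exprn_gt0.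
apply: (P_compare (H := fun _ => 0) (H' := fun _ => 0) r0).
- move=> x /andP[x0 _]; rewrite subr0; apply: mulr_ge0; last exact: powR_ge0.
  by rewrite exprn_ge0 // ltW.
- by move=> x /andP[/ltW].
Qed.

Lemma w_ndecr r s : 0 <= r -> r <= s -> w r <= w s.
Proof.
move=> r0 rs; apply: (@derive_nonneg_le _ w dw) => //.
- apply: (@continuous_subspaceW _ _ _ `[0, s]%classic); last exact: w_within.
  by apply: subset_itvr; rewrite bnd_simp.
- by move=> x /andP[rx _]; apply: is_derive_w; exact: le_lt_trans rx.
- by move=> x /andP[rx _]; apply: dw_ge0; exact: le_lt_trans rx.
Qed.

Lemma w_ge1 r : 0 <= r -> 1 <= w r.
Proof. by move=> r0; rewrite -w_0; exact: w_ndecr. Qed.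

Lemma powRN_anti s x y : 0 <= s -> 0 < x -> x <= y -> y `^ (- s) <= x `^ (- s).
Proof.
move=> s0 x0 xy; rewrite !powRN lef_pV2 ?posrE ?powR_gt0 //; last first.
  exact: lt_le_trans xy.
by apply: ge0_ler_powR => //; rewrite nnegrE ltW //; exact: lt_le_trans xy.
Qed.

Lemma wN_le1 s r : 0 <= s -> 0 <= r -> w r `^ (- s) <= 1.
Proof.
move=> s0 r0; apply: le_trans (powRN_anti s0 ltr01 (w_ge1 r0)) _.
by rewrite powR1.
Qed.

(** On []0, T]] the source is at least its value at [T], as [w] is nondecreasing; comparing [P] with
    [c * r ^+ N.+1] gives a linear lower bound. The condition [c <= 1] serves the comparison near
    0. *)
Lemma dw_ge c r T : 0 < r -> r <= T -> 0 <= c -> c * N.+1%:R <= w T `^ (- p) ->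
  c <= 1 -> c * r <= dw r.
Proof.
move=> r0 rT c0 cT c1.
have rN : 0 < r ^+ N by exact: exprn_gt0.
rewrite -(ler_pM2l rN) mulrCA -exprSr.
apply: (P_compare (H := fun x => c * x ^+ N.+1)
  (H' := fun x => c * (N.+1%:R * x ^+ N * 1)) r0).
- move=> x _; have := is_deriveM1 (is_derive_cst1 c x) (is_deriveX1 N.+1 (is_derive_id1 x)).
  by rewrite mul0r add0r.
- move=> x /andP[x0 xr]; rewrite mulr1 mulrA [_ * x ^+ N]mulrC -mulrBr.
  apply: mulr_ge0; first by rewrite exprn_ge0 // ltW.
  rewrite subr_ge0; apply: le_trans cT _; apply: powRN_anti; first exact: ltW.
    exact: w_gt0.
  by apply: w_ndecr; [exact: ltW|exact: le_trans rT].
- move=> x /andP[x0 xr] x1; rewrite exprS mulrCA ler_piMr //; first exact: ltW.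
  by rewrite mulr_ile1 // ?exprn_ge0 ?exprn_ile1 // ltW.
Qed.

(** The source is at most 1, hence at most [N + 1]. The inequality runs in the direction opposite to
    [P_compare], so the argument through points with small [P] is repeated. *)
Lemma dw_le r : 0 < r -> dw r <= r.
Proof.
move=> r0; have rN : 0 < r ^+ N by exact: exprn_gt0.
rewrite -(ler_pM2l rN) -exprSr -subr_ge0 leNgt; apply/negP => neg.
pose H x := P x - x ^+ N.+1.
have dH x : 0 < x -> is_derive x 1 H (x ^+ N * w x `^ (- p) - N.+1%:R * x ^+ N * 1).
  move=> x0; apply: is_deriveD1; first exact: is_derive_P.
  by apply: is_deriveN1; exact: is_deriveX1 N.+1 (is_derive_id1 x).
pose m := Num.min r (H r / 2).
have m0 : 0 < m by rewrite lt_min r0 /H /P; lra.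
have [x /andP[x0 xm] Px] := P_small m0.
have xr : x <= r by apply: ltW; apply: lt_le_trans xm _; rewrite ge_min lexx.
have : - H x <= - H r.
  apply: (@derive_nonneg_le _ (fun y => - H y)
    (fun x => - (x ^+ N * w x `^ (- p) - N.+1%:R * x ^+ N * 1))) => //.
  - apply: within_cont => y /andP[xy _].
    by apply: is_derive_cont; apply: is_deriveN1; apply: dH; exact: lt_le_trans xy.
  - by move=> y /andP[/ltW xy _]; apply: is_deriveN1; apply: dH; exact: lt_le_trans xy.
  - move=> y /andP[/ltW xy _]; have y0 : 0 < y by exact: lt_le_trans xy.
    rewrite mulr1 [N.+1%:R * _]mulrC -mulrBr -mulrN; apply: mulr_ge0.
      by rewrite exprn_ge0 // ltW.
    rewrite oppr_ge0 subr_le0; apply: le_trans (_ : 1 <= _); last by rewrite ler1n.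
    by apply: wN_le1; exact: ltW.
have Hxm : H x < m.
  by move: Px; rewrite ltr_norml /H => /andP[_]; have := exprn_ge0 N.+1 (ltW x0); lra.
have mH : m <= H r / 2 by rewrite ge_min lexx orbT.
have Hr : 0 < H r by move: neg; rewrite /H /P; lra.
rewrite lerN2 => rx; have := le_lt_trans rx (lt_le_trans Hxm mH).
clear -Hr; lra.
Qed.

(** The potential in the variable [r = t |x|], frozen for negative [r] at its value at 0, because
    the existence theorem asks for a coefficient continuous and bounded on the whole line. *)
Definition q_of r : R := p * w (Num.max r 0) `^ (- (p + 1)).

Lemma q_ofE r : 0 <= r -> q_of r = p * w r `^ (- (p + 1)).
Proof. by move=> r0; rewrite /q_of max_l. Qed.

Lemma q_of_bound r : 0 <= q_of r <= p.
Proof.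
rewrite /q_of; have m0 : 0 <= Num.max r 0 by rewrite le_max lexx orbT.
rewrite mulr_ge0 ?powR_ge0 ?(ltW p0) //= -[X in _ <= X]mulr1 ler_wpM2l ?(ltW p0) //.
by apply: wN_le1 => //; have := p0; lra.
Qed.

Lemma w_max_cont : continuous (fun r => w (Num.max r 0)).
Proof.
move=> r; have [r0|r0|->] := ltgtP r 0.
- apply: (@is_derive_cont _ _ _ 0); apply: (is_derive_near _ (is_derive_cst1 (w 0) r)).
  near=> y; rewrite max_r //; apply/ltW; near: y; exact: lt_nbhsl.
- apply: (@is_derive_cont _ _ _ (dw r)); apply: (is_derive_near _ (is_derive_w r0)).
  near=> y; rewrite max_l //; apply/ltW; near: y; exact: lt_nbhsr.
- apply: ball_cont => e e0; have [d d0 Hd] := w_right e0.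
  exists d => // y; rewrite subr0 maxxx w_0.
  have [y0|y0] := leP y 0; first by rewrite w_0 subrr normr0.
  by rewrite gtr0_norm // => yd; apply: Hd; rewrite y0.
Unshelve. all: by end_near. Qed.

Lemma q_of_cont : continuous q_of.
Proof.
move=> r; apply: cvgM; first exact: cvg_cst.
have m0 : 0 <= Num.max r 0 by rewrite le_max lexx orbT.
have wm : 0 < w (Num.max r 0) by apply: lt_le_trans ltr01 (w_ge1 m0).
apply: (cvg_comp _ (fun y => y `^ (- (p + 1))) (@w_max_cont r)).
exact: is_derive_cont (is_derive_powR1 _ wm).
Qed.

Let k : R := (p + 1) / 2.

(* [phi] is [d/da] at [a = 1] of the solutions [a * w (a `^ (- k) * r)], so it
   solves the linearized equation. *)
Definition phi r : R := w r - k * r * dw r.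

(** The equation for [w] eliminates its second derivative, so that [dphi] can be differentiated
    again. The value 0 up to the origin is its limit from the right. *)
Definition dphi r : R := if r <= 0 then 0
  else (1 - k + k * N%:R) * dw r - k * (r * w r `^ (- p)).

Lemma is_derive_wN t s : 0 < t ->
  is_derive t 1 (fun r => w r `^ (- s)) (- s * w t `^ (- (s + 1)) * dw t).
Proof.
move=> t0; have := is_derive_comp1 (is_derive_w t0) (is_derive_powR1 (- s) (w_gt0 t0)).
by rewrite opprD.
Qed.

Lemma wNS t s : 0 < t -> w t `^ (- (s + 1)) * w t = w t `^ (- s).
Proof.
move=> t0; have wt := w_gt0 t0.
have E : w t `^ (- s - 1) = w t `^ (- s) * w t `^ (- 1).
  by apply: powRD; rewrite (gt_eqF wt) implybT.
by rewrite opprD E powR_inv1 ?(ltW wt) // divfK // gt_eqF.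
Qed.

Lemma dphiE t : 0 < t ->
  dphi t = (1 - k + k * N%:R) * dw t - k * (t * w t `^ (- p)).
Proof. by move=> t0; rewrite /dphi ifF // leNgt t0. Qed.

Lemma is_derive_phi t : 0 < t -> is_derive t 1 phi (dphi t).
Proof.
move=> t0; have t1 : t != 0 by rewrite gt_eqF.
have := is_deriveD1 (is_derive_w t0) (is_deriveN1 (is_deriveM1
  (is_deriveM1 (is_derive_cst1 k t) (is_derive_id1 t)) (is_derive_dw t0))).
by move/is_derive_eq; apply; rewrite dphiE //; field.
Qed.

Lemma is_derive_dphi t : 0 < t ->
  is_derive t 1 dphi (- (N%:R / t) * dphi t - (q_of t + 0) * phi t).
Proof.
move=> t0; have t1 : t != 0 by rewrite gt_eqF.
have := is_deriveD1 (is_deriveM1 (is_derive_cst1 (1 - k + k * N%:R) t) (is_derive_dw t0))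
  (is_deriveN1 (is_deriveM1 (is_derive_cst1 k t)
    (is_deriveM1 (is_derive_id1 t) (is_derive_wN p t0)))).
move=> H; apply: (is_derive_near (g := fun r =>
   (1 - k + k * N%:R) * dw r - k * (r * w r `^ (- p)))).
  near=> y; rewrite dphiE //; near: y; exact: lt_nbhsr.
apply: (is_derive_eq H); rewrite dphiE // addr0 q_ofE ?ltW // /phi.
rewrite -(wNS p t0) /k; field.
by rewrite t1.
Unshelve. all: by end_near. Qed.

(** Both functions solve the same equation with value 1 and slope 0 at the origin. The work lies at
    0, where [0 <= dw r <= r] gives continuity of [phi] and [dphi] from the right. *)
Lemma PhiE t : 0 < t -> Phi N q_of_cont q_of_bound 0 t = phi t.
Proof.
move=> t0.
have phi0 : phi 0 = 1 by rewrite /phi w_0 mulr0 mul0r subr0.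
suff H : phi t = phi 0 * Phi N q_of_cont q_of_bound 0 t by rewrite H phi0 mul1r.
have rt r : 0 < r < t -> 0 < r by case/andP.
apply: (@regular_unique _ N q_of p q_of_cont q_of_bound 0 phi dphi t); first exact: ltW.
- apply/continuous_within_itvP => //; split.
  + move=> x; rewrite in_itv /= => /andP[x0 _].
    exact: is_derive_cont (is_derive_phi x0).
  + rewrite phi0; apply/cvgrPdist_lt => e e0.
    have [d d0 Hd] : exists2 d, 0 < d & forall r, 0 < r < d -> `|w r - 1| < e / 2.
      by apply: w_right; lra.
    have k0 : 0 < k by rewrite /k; have := p0; lra.
    have k2 : 0 < 2 * k by exact: mulr_gt0.
    exists (Num.min d (Num.min 1 (e / (2 * k)))) => /=.
      by rewrite !lt_min d0 ltr01 divr_gt0.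
    move=> r /=; rewrite sub0r normrN => + r0; rewrite gtr0_norm // !lt_min.
    move=> /and3P[rd r1]; rewrite ltr_pdivlMr // => rk.
    have h1 : `|w r - 1| < e / 2 by apply: Hd; rewrite r0.
    have h2 : `|k * r * dw r| <= k * r.
      rewrite normrM (gtr0_norm (mulr_gt0 k0 r0)) ger0_norm ?dw_ge0 //.
      by rewrite ler_piMr ?(le_trans (dw_le r0)) ?(ltW r1) // mulr_ge0 // ltW.
    have -> : 1 - phi r = - (w r - 1) + k * r * dw r by rewrite /phi; ring.
    apply: le_lt_trans (ler_normD _ _) _; rewrite normrN.
    by have := ltr_leD h1 h2; lra.
  + by apply: cvg_at_left_filter; exact: is_derive_cont (is_derive_phi t0).
- apply/continuous_within_itvP => //; split.
  + move=> x; rewrite in_itv /= => /andP[x0 _].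
    exact: is_derive_cont (is_derive_dphi x0).
  + rewrite [X in _ --> X](_ : _ = 0); last by rewrite /dphi lexx.
    pose C := `|1 - k + k * N%:R| + `|k| + 1.
    have C0 : 0 < C by rewrite ltr_wpDl // addr_ge0.
    apply/cvgrPdist_lt => e e0; exists (e / C) => /=; first exact: divr_gt0.
    move=> r /=; rewrite sub0r normrN => + r0; rewrite gtr0_norm //.
    rewrite ltr_pdivlMr // => rC; rewrite sub0r normrN dphiE //.
    apply: le_lt_trans (ler_normB _ _) _; apply: le_lt_trans rC.
    rewrite /C !mulrDr mulr1; apply: le_trans (_ : _ <= r * `|1 - k + k * N%:R| + r * `|k|) _; last first.
      by rewrite lerDl ltW.
    apply: lerD; rewrite normrM [X in _ <= X]mulrC ler_wpM2l //.
      by rewrite ger0_norm ?dw_ge0 // dw_le.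
    rewrite ger0_norm ?mulr_ge0 ?powR_ge0 ?(ltW r0) // ler_piMr ?(ltW r0) //.
    by apply: wN_le1; exact: ltW.
  + by apply: cvg_at_left_filter; exact: is_derive_cont (is_derive_dphi t0).
- by rewrite /dphi lexx.
- by move=> r /rt r0; exact: is_derive_phi.
- by move=> r /rt r0; exact: is_derive_dphi.
Qed.

Lemma is_derive_lam t : 0 < t ->
  is_derive t 1 (lam p w) (2 * t * w t `^ (- (p + 1 + 1)) * phi t).
Proof.
move=> t0; have := is_deriveM1 (is_deriveX1 2 (is_derive_id1 t)) (is_derive_wN (p + 1) t0).
rewrite (_ : (fun y => y ^+ 2 * w y `^ (- (p + 1))) = lam p w); last first.
  by apply/funext => y; rewrite /lam powRN.
move/is_derive_eq; apply; rewrite /= expr1 -(wNS (p + 1) t0) /phi /k.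
by field.
Qed.

Lemma lam_critical t : 0 < t -> (derive1 (lam p w) t == 0) = (phi t == 0).
Proof.
move=> t0; rewrite derive1E (@derive_val _ _ _ _ _ _ _ (is_derive_lam t0)).
by rewrite !mulf_eq0 pnatr_eq0 (gt_eqF t0) (gt_eqF (wN_gt0 _ t0)).
Qed.

(** In the product rule the term with the derivative of the prefactor drops out at a zero of
    [phi]. *)
Lemma lam_second t : 0 < t -> phi t = 0 ->
  derive1n 2 (lam p w) t = 2 * t * w t `^ (- (p + 1 + 1)) * dphi t.
Proof.
move=> t0 ph0; rewrite derive1nS derive1n1 derive1E.
pose g r := 2 * r * w r `^ (- (p + 1 + 1)).
have dg : is_derive t 1 g (2 * w t `^ (- (p + 1 + 1)) +
    2 * t * (- (p + 1 + 1) * w t `^ (- (p + 1 + 1 + 1)) * dw t)).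
  have := is_deriveM1 (is_deriveM1 (is_derive_cst1 2 t) (is_derive_id1 t))
    (is_derive_wN (p + 1 + 1) t0).
  by move/is_derive_eq; apply; ring.
have H := is_deriveM1 dg (is_derive_phi t0).
rewrite ph0 mulr0 add0r in H.
apply: derive_val; apply: (is_derive_near _ H); near=> y.
have y0 : 0 < y by near: y; exact: lt_nbhsr.
by rewrite derive1E (@derive_val _ _ _ _ _ _ _ (is_derive_lam y0)).
Unshelve. all: by end_near. Qed.

End MEMSProfile.

(** * Directional derivatives and the Laplacian *)

Section ContinuousAtNear.
Context {R : realType} {T : topologicalType}.

Lemma near_continuous_at (f : T -> R) (x : T) :
  (forall e : R, 0 < e -> \forall y \near x, `|f x - f y| < e) ->
  {for x, continuous f}.
Proof. by move=> H; apply/cvgrPdist_lt. Qed.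

Lemma continuous_at_near (f : T -> R) (x : T) (e : R) :
  {for x, continuous f} -> 0 < e -> \forall y \near x, `|f x - f y| < e.
Proof. by move=> /cvgrPdist_lt; apply. Qed.

Lemma continuous_atM (f g : T -> R) (x : T) : {for x, continuous f} ->
  {for x, continuous g} -> {for x, continuous (fun y => f y * g y)}.
Proof. by move=> cf cg; exact: cvgM. Qed.

Lemma continuous_atD (f g : T -> R) (x : T) : {for x, continuous f} ->
  {for x, continuous g} -> {for x, continuous (fun y => f y + g y)}.
Proof. by move=> cf cg; exact: cvgD. Qed.

Lemma continuous_at_cst (c : R) (x : T) : {for x, continuous (fun _ : T => c)}.
Proof. exact: cvg_cst. Qed.

Lemma within_continuous_comp {U : topologicalType} (A : set T) (K : set U)
    (f : T -> R) (g : U -> T) :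
  {within A, continuous f} -> continuous g -> (forall x, K x -> A (g x)) ->
  {within K, continuous (fun x => f (g x))}.
Proof.
move=> /subspace_continuousP cf cg KA; apply/subspace_continuousP => x Kx B HB.
have H : nbhs (g x) [set y | A y -> B (f y)] := cf _ (KA x Kx) B HB.
have H2 : nbhs x [set y | A (g y) -> B (f (g y))] := cg x _ H.
suff : nbhs x [set y | K y -> B (f (g y))] by [].
by apply: filterS H2 => y Hy Ky; exact: Hy (KA y Ky).
Qed.

Lemma within_continuousB (K : set T) (f g : T -> R) :
  {within K, continuous f} -> {within K, continuous g} ->
  {within K, continuous (fun x => f x - g x)}.
Proof. by move=> cf cg x; apply: cvgB; [exact: cf|exact: cg]. Qed.

Lemma within_continuous_div (K : set T) (f g : T -> R) :
  {within K, continuous f} -> continuous g -> (forall x, K x -> g x != 0) ->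
  {within K, continuous (fun x => f x / g x)}.
Proof.
move=> /subspace_continuousP cf cg g0; apply/subspace_continuousP => x Kx.
apply: cvgM; first exact: cf.
apply: cvgV; first exact: g0.
exact: cvg_within_filter (cg x).
Qed.

End ContinuousAtNear.

(** * Derivatives along lines and the Euclidean norm *)

Section Directional.
Context {R : realType} {n : nat}.
Local Notation V := 'rV[R]_n.
Implicit Types (f g : V -> R) (x y v e : V) (i j : 'I_n).

(** This reduces the rules for directional derivatives to those of one real variable. *)
Lemma is_derive_line f x v l :
  is_derive x v f l <-> is_derive (0 : R) 1 (fun h : R => f (h *: v + x)) l.
Proof.
have E : 'D_v f x = 'D_1 (fun h : R => f (h *: v + x)) 0.
  rewrite /derive; set g1 := fun h => h^-1 *: _; set g2 := fun h => h^-1 *: _.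
  suff -> : g1 = g2 by [].
  by apply/funext => h; rewrite /g1 /g2 /= addr0 scale0r add0r [_%:A]mulr1.
split=> -[H1 H2].
  by apply: DeriveDef; [exact: (derivable1P f x v).1|rewrite -E].
by apply: DeriveDef; [exact: (derivable1P f x v).2|rewrite E].
Qed.

Lemma line0 x v : 0 *: v + x = x. Proof. by rewrite scale0r add0r. Qed.

Lemma is_derive_compv f (g : R -> R) x v df dg : is_derive x v f df ->
  is_derive (f x) 1 g dg -> is_derive x v (fun y => g (f y)) (dg * df).
Proof.
move=> /is_derive_line Hf Hg; apply/is_derive_line.
by apply: (is_derive_comp1 Hf); rewrite line0.
Qed.

Lemma is_deriveDv f g x v df dg : is_derive x v f df -> is_derive x v g dg ->
  is_derive x v (fun y => f y + g y) (df + dg).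
Proof.
by move=> /is_derive_line Hf /is_derive_line Hg; apply/is_derive_line.
Qed.

Lemma is_deriveMv f g x v df dg : is_derive x v f df -> is_derive x v g dg ->
  is_derive x v (fun y => f y * g y) (df * g x + f x * dg).
Proof.
move=> /is_derive_line Hf /is_derive_line Hg; apply/is_derive_line.
by have := is_deriveM1 Hf Hg; rewrite line0.
Qed.

Lemma is_derive_cstv (c : R) x v : is_derive x v (fun _ : V => c) 0.
Proof. exact: is_derive_cst. Qed.

Lemma is_derive_coordv x v i : is_derive x v (fun y : V => y 0 i) (v 0 i).
Proof.
apply/is_derive_line.
rewrite (_ : (fun h : R => _) = fun h => h * v 0 i + x 0 i); last first.
  by apply/funext => h; rewrite !mxE.
have := is_deriveD1 (is_deriveM1 (is_derive_id1 0) (is_derive_cst1 (v 0 i) 0))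
  (is_derive_cst1 (x 0 i) 0).
by rewrite mul1r mul0r !addr0.
Qed.

Lemma is_derive_sumv (I : Type) (r : seq I) (P : pred I) (f : I -> V -> R)
    (df : I -> R) x v : (forall i : I, is_derive x v (f i) (df i)) ->
  is_derive x v (fun y => \sum_(i <- r | P i) f i y) (\sum_(i <- r | P i) df i).
Proof.
move=> H; elim: r => [|i r IH].
  rewrite (_ : (fun y => _) = fun _ => 0) ?big_nil; first exact: is_derive_cstv.
  by apply/funext => y; rewrite big_nil.
rewrite (_ : (fun y => _) = fun y => (if P i then f i y else 0) +
    \sum_(j <- r | P j) f j y); last first.
  by apply/funext => y; rewrite big_cons; case: ifP; rewrite ?add0r.
rewrite (_ : \sum_(_ <- _ :: _ | _) _ = (if P i then df i else 0) +
    \sum_(j <- r | P j) df j); last first.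
  by rewrite big_cons; case: ifP; rewrite ?add0r.
by apply: is_deriveDv => //; case: ifP => _ //; exact: is_derive_cstv.
Qed.

Definition dot e x : R := \sum_(i < n) e 0 i * x 0 i.

Lemma dotC e x : dot e x = dot x e.
Proof. by apply: eq_bigr => i _; rewrite mulrC. Qed.

Lemma dotDr e x y : dot e (x + y) = dot e x + dot e y.
Proof. by rewrite -big_split; apply: eq_bigr => i _; rewrite mxE mulrDr. Qed.

Lemma dotZr e x (c : R) : dot e (c *: x) = c * dot e x.
Proof. by rewrite mulr_sumr; apply: eq_bigr => i _; rewrite mxE; ring. Qed.

Lemma dotDl e x y : dot (x + y) e = dot x e + dot y e.
Proof. by rewrite !(dotC _ e) dotDr. Qed.

Lemma dotZl e x (c : R) : dot (c *: x) e = c * dot x e.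
Proof. by rewrite !(dotC _ e) dotZr. Qed.

Lemma dot_ebasis i x : dot (ebasis R i) x = x 0 i.
Proof.
rewrite /dot (bigD1 i) //= big1 ?addr0 => [|j ji]; rewrite !mxE !eqxx /=.
  by rewrite mul1r.
by rewrite (negbTE ji) mul0r.
Qed.

Lemma dot_ge0 x : 0 <= dot x x.
Proof. by apply: sumr_ge0 => i _; rewrite -expr2 sqr_ge0. Qed.

Lemma enormE x : enorm x = Num.sqrt (dot x x).
Proof. by congr Num.sqrt; apply: eq_bigr => i _; rewrite expr2. Qed.

Lemma enorm_ge0 x : 0 <= enorm x. Proof. exact: sqrtr_ge0. Qed.

Lemma enorm_sqr x : enorm x ^+ 2 = dot x x.
Proof. by rewrite enormE sqr_sqrtr // dot_ge0. Qed.

Lemma dot_eq0 x : dot x x = 0 -> x = 0.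
Proof.
move=> /eqP; rewrite psumr_eq0 => [/allP H|i _]; last by rewrite -expr2 sqr_ge0.
apply/rowP => i; rewrite mxE; apply/eqP.
by have := H i; rewrite mem_index_enum /= mulf_eq0 orbb; apply.
Qed.

Lemma enorm_gt0 x : x != 0 -> 0 < enorm x.
Proof.
move=> x0; rewrite lt_neqAle enorm_ge0 andbT; apply: contra x0 => /eqP E.
by apply/eqP/dot_eq0; rewrite -enorm_sqr -E expr0n.
Qed.

Lemma enorm0 : enorm (0 : V) = 0.
Proof.
by rewrite enormE (_ : dot 0 0 = 0) ?sqrtr0 // /dot big1 // => i _; rewrite mxE mul0r.
Qed.

Lemma enormZ (c : R) x : enorm (c *: x) = `|c| * enorm x.
Proof. by rewrite !enormE dotZl dotZr mulrA -expr2 sqrtrM ?sqr_ge0 // sqrtr_sqr. Qed.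

Lemma enorm_ebasis i : enorm (ebasis R i) = 1.
Proof. by rewrite enormE dot_ebasis /ebasis mxE !eqxx sqrtr1. Qed.

Lemma sum_ebasis x : x = \sum_i x 0 i *: ebasis R i.
Proof.
apply/rowP => j; rewrite summxE (bigD1 j) //= big1 ?addr0 => [|i ij].
  by rewrite !mxE !eqxx mulr1.
by rewrite !mxE eqxx eq_sym (negbTE ij) mulr0.
Qed.

Lemma coord_le_enorm x i : `|x 0 i| <= enorm x.
Proof.
rewrite enormE -sqrtr_sqr ler_sqrt ?dot_ge0 //.
rewrite /dot (bigD1 i) //= expr2 lerDl sumr_ge0 // => j _.
by rewrite -expr2 sqr_ge0.
Qed.

(** Cauchy-Schwarz, from the nonnegative square of [dot y y *: x - dot x y *: y]. *)
Lemma dot_le x y : `|dot x y| <= enorm x * enorm y.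
Proof.
have [->|y0] := eqVneq y 0.
  by rewrite enorm0 mulr0 dotC -[X in dot X](scale0r (0 : V)) dotZl mul0r normr0.
have py : 0 < dot y y by rewrite -enorm_sqr exprn_gt0 // enorm_gt0.
have := dot_ge0 (dot y y *: x - dot x y *: y).
rewrite dotDl !dotDr -!scaleNr !dotZl !dotZr (dotC y x) => H.
have {}H : 0 <= dot y y * (dot x x * dot y y - dot x y ^+ 2) by move: H; rewrite !expr2; nra.
move: H; rewrite pmulr_rge0 // subr_ge0 => H.
rewrite -(ler_pXn2r (n := 2)) ?nnegrE ?mulr_ge0 ?enorm_ge0 //.
by rewrite real_normK ?num_real // exprMn !enorm_sqr.
Qed.

Lemma is_derive_dot e x v : is_derive x v (dot e) (dot e v).
Proof.
apply: (@is_derive_sumv _ _ _ (fun i y => e 0 i * y 0 i)) => i.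
by have := is_deriveMv (is_derive_cstv (e 0 i) x v) (is_derive_coordv x v i);
  rewrite mul0r add0r.
Qed.

Lemma is_derive_enorm x v : x != 0 -> is_derive x v (@enorm R n) (dot v x / enorm x).
Proof.
move=> x0; have d2 : is_derive x v (fun y => dot y y) (dot v x + dot x v).
  rewrite /dot -big_split.
  apply: (@is_derive_sumv _ _ _ (fun i y => y 0 i * y 0 i)) => i.
  exact: is_deriveMv (is_derive_coordv x v i) (is_derive_coordv x v i).
have p : 0 < dot x x by rewrite -enorm_sqr exprn_gt0 // enorm_gt0.
have := is_derive_compv d2 (is_derive1_sqrt p).
rewrite (_ : (fun y => Num.sqrt _) = @enorm R n); last first.
  by apply/funext => y; rewrite enormE.
move/is_derive_eq; apply; rewrite -enormE (dotC x v).
by field; rewrite gt_eqF // enorm_gt0.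
Qed.

Lemma differentiable_dot e x : differentiable (dot e) x.
Proof.
rewrite (_ : dot e = \sum_(i < n) (fun y => e 0 i * y 0 i)); last first.
  by apply/funext => y; rewrite fct_sumE.
apply: differentiable_sum => i.
by apply: differentiableM; [exact: differentiable_cst|exact: differentiable_coord].
Qed.

Lemma differentiable_enorm x : x != 0 -> differentiable (@enorm R n) x.
Proof.
move=> x0; rewrite (_ : @enorm R n = Num.sqrt \o (fun y => dot y y)); last first.
  by apply/funext => y; rewrite /= enormE.
have p : 0 < dot x x by rewrite -enorm_sqr exprn_gt0 // enorm_gt0.
apply: differentiable_comp.
  rewrite (_ : (fun y => _) = \sum_(i < n) (fun y : V => y 0 i * y 0 i)); last first.
    by apply/funext => y; rewrite fct_sumE.
  apply: differentiable_sum => i.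
  by apply: differentiableM; exact: differentiable_coord.
by apply/derivable1_diffP; case: (is_derive1_sqrt p).
Qed.

Lemma differentiable_radial (F : R -> R) l x : x != 0 ->
  is_derive (enorm x) 1 F l -> differentiable (fun y => F (enorm y)) x.
Proof.
move=> x0 [dF _]; apply: (@differentiable_comp _ _ _ _ (@enorm R n) F).
  exact: differentiable_enorm.
exact/derivable1_diffP.
Qed.

Lemma enorm_cont : continuous (@enorm R n).
Proof.
move=> x; rewrite (_ : @enorm R n = Num.sqrt \o (fun y => dot y y)); last first.
  by apply/funext => y; rewrite /= enormE.
apply: continuous_comp; last exact: sqrt_continuous.
rewrite (_ : (fun y => _) = \sum_(i < n) (fun y : V => y 0 i * y 0 i)); last first.
  by apply/funext => y; rewrite fct_sumE.
apply/differentiable_continuous/differentiable_sum => i.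
by apply: differentiableM; exact: differentiable_coord.
Qed.

Lemma dot_cont e : continuous (dot e).
Proof. by move=> x; apply: differentiable_continuous; exact: differentiable_dot. Qed.

Lemma norm_le_enorm x : `|x| <= enorm x.
Proof.
rewrite /Num.norm /= mx_normrE; apply/bigmax_leP; split; first exact: enorm_ge0.
by move=> [i j] _ /=; rewrite (ord1 i) coord_le_enorm.
Qed.

End Directional.

(** The second derivative is given at 0 only. Caratheodory's factorisation [k1 s = c s * s], with
    [c] continuous at 0, shows that [k] would increase to the right of 0 if [l] were positive. *)
Lemma second_derivative_max {R : realType} (k k1 : R -> R) (l : R) :
  (\forall s \near (0 : R), is_derive (s : R) 1 k (k1 s)) -> is_derive (0 : R) 1 k1 l ->
  (\forall s \near (0 : R), k s <= k 0) -> l <= 0.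
Proof.
move=> dk dk1 km.
have [d d0 Hd] : exists2 d : R, 0 < d &
    forall s : R, `|s| < d -> is_derive s 1 k (k1 s) /\ k s <= k 0.
  have /nbhs_ballP[d /= d0 Hd] :
      \forall s \near (0 : R), is_derive (s : R) 1 k (k1 s) /\ k s <= k 0.
    by apply: filterS2 dk km => s.
  exists d => // s sd.
  by apply: Hd; rewrite /ball /= sub0r normrN.
have nd (s : R) : - d < s < d -> `|s| < d by move=> sd; rewrite ltr_norml.
have k10 : k1 0 = 0.
  have : is_derive (0 : R) 1 k 0.
    apply: (@derive1_at_max R k (- d) d 0); first by lra.
    - by move=> t; rewrite in_itv /= => /nd/Hd[[]].
    - by rewrite in_itv /=; apply/andP; split; lra.
    - by move=> t; rewrite in_itv /= => /nd/Hd[].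
  have d00 : - d < 0 < d by apply/andP; split; lra.
  by have [[_ <-] _] := Hd 0 (nd _ d00); case.
rewrite leNgt; apply/negP => l0.
have [c [cE cc cl]] := (is_derive1_caratheodory k1 0 l).1 dk1.
have l2 : 0 < l / 2 by lra.
have [e e0 He] := cont_ball cc l2.
pose m := Num.min (d / 2) (e / 2).
have m0 : 0 < m by rewrite lt_min; apply/andP; split; lra.
have m1 : m <= d / 2 by rewrite ge_min lexx.
have m2 : m <= e / 2 by rewrite ge_min lexx orbT.
have : k 0 < k m.
  apply: (@derive_pos_lt _ k k1) => //.
  - apply: within_cont => x /andP[x0 xm].
    have xd : - d < x < d by apply/andP; split; lra.
    by have [dx _] := Hd x (nd x xd); exact: is_derive_cont dx.
  - by move=> x /andP[x0 xm]; apply: (Hd x _).1; apply: nd; apply/andP; split; lra.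
  - move=> x /andP[x0 xm]; have := cE x; rewrite k10 !subr0 => ->.
    apply: mulr_gt0 => //; have := He x; rewrite subr0 cl gtr0_norm // ltr_norml.
    have xe : x < e by lra.
    by move=> /(_ xe)/andP[]; lra.
have md : - d < m < d by apply/andP; split; lra.
have [_] := Hd m (nd m md); lra.
Qed.

(** * The Laplacian at a maximum and under reflections *)

Section HasLaplacian.
Context {R : realType} {n : nat}.
Local Notation V := 'rV[R]_n.
Implicit Types (f g : V -> R) (x y v e : V) (i j : 'I_n) (c l m : R).

(** A relation instead of the function [laplacian]: it carries the existence of the first partial
    derivatives near [x] and of the second ones at [x], and is therefore stable under linear
    combinations. *)
Definition has_laplacian f x l := exists (g : 'I_n -> V -> R) (h : 'I_n -> R),
  [/\ forall i, \forall y \near x, is_derive y (ebasis R i) f (g i y),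
      forall i, is_derive x (ebasis R i) (g i) (h i) & \sum_i h i = l].

Lemma has_laplacian_comb f g x l m c : has_laplacian f x l -> has_laplacian g x m ->
  has_laplacian (fun y => f y + c * g y) x (l + c * m).
Proof.
have dc y v (k : V -> R) d : is_derive y v k d ->
    is_derive y v (fun z => c * k z) (c * d).
  by move=> dk; have := is_deriveMv (is_derive_cstv c y v) dk; rewrite mul0r add0r.
move=> [f1 [f2 [df1 df2 <-]]] [g1 [g2 [dg1 dg2 <-]]].
exists (fun i y => f1 i y + c * g1 i y), (fun i => f2 i + c * g2 i); split.
- move=> i; apply: filterS2 (df1 i) (dg1 i) => y hf hg.
  by apply: is_deriveDv => //; exact: dc.
- by move=> i; apply: is_deriveDv => //; exact: dc.
- by rewrite big_split /= mulr_sumr.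
Qed.

Lemma has_laplacian_near f g x l : (\forall y \near x, f y = g y) ->
  has_laplacian f x l -> has_laplacian g x l.
Proof.
move=> fg [f1 [f2 [df1 df2 <-]]]; exists f1, f2; split => // i.
apply: filterS2 (near_join fg) (df1 i) => y fy dy.
exact: (near_eq_is_derive fy dy).
Qed.

Lemma laplacianE f x l : has_laplacian f x l -> laplacian f x = l.
Proof.
move=> [f1 [f2 [df1 df2 <-]]]; apply: eq_bigr => i _; apply: derive_val.
apply: (near_eq_is_derive _ (df2 i)).
by apply: filterS (df1 i) => y H; apply/esym; exact: derive_val.
Qed.

Lemma has_laplacian_max f x l : has_laplacian f x l ->
  (\forall y \near x, f y <= f x) -> l <= 0.
Proof.
move=> [f1 [f2 [df1 df2 <-]]] fx; rewrite -oppr_ge0 -sumrN; apply: sumr_ge0 => i _.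
rewrite oppr_ge0.
have line : (fun s : R => s *: ebasis R i + x) @ (0 : R) --> x.
  rewrite -[X in _ --> X](line0 x (ebasis R i)).
  apply: cvgD; last exact: cvg_cst.
  by apply: cvgZl; exact: cvg_id.
apply: (@second_derivative_max _ (fun s => f (s *: ebasis R i + x))
  (fun s => f1 i (s *: ebasis R i + x))).
- have H1 : \forall s \near (0 : R), is_derive (s *: ebasis R i + x) (ebasis R i) f
      (f1 i (s *: ebasis R i + x)) := line _ (df1 i).
  apply: filterS H1 => s /is_derive_line H.
  pose phi r : R := f (r *: ebasis R i + x).
  have E : (fun r : R => f (r *: ebasis R i + (s *: ebasis R i + x))) =
    (fun r : R => phi (r + s)).
    by apply/funext => r; rewrite /phi scalerDl addrA.
  rewrite E in H.
  have d1 : is_derive s 1 (fun r : R => r - s) 1.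
    by have := is_deriveD1 (is_derive_id1 s) (is_derive_cst1 (- s) s); rewrite addr0.
  rewrite -(subrr s) in H.
  have := is_derive_comp1 d1 H; rewrite mulr1.
  by rewrite (_ : (fun r => _) = phi) //; apply/funext => r; rewrite subrK.
- exact/is_derive_line.
- have H1 : \forall s \near (0 : R), f (s *: ebasis R i + x) <= f x := line _ fx.
  by apply: filterS H1 => s; rewrite line0.
Qed.

(** Full differentiability matters here: a reflection sends the basis vectors to other
    directions. *)
Lemma is_derive_lin f x v : differentiable f x ->
  is_derive x v f (\sum_j v 0 j * derive f x (ebasis R j)).
Proof.
move=> df; apply: (is_derive_eq (derivableP (diff_derivable df))).
rewrite deriveE // [in LHS](sum_ebasis v) linear_sum; apply: eq_bigr => j _.
by rewrite linearZ /= deriveE.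
Qed.

Definition twice_diff_ball f := forall x, enorm x < 1 -> differentiable f x /\
  forall i, differentiable (fun y => derive f y (ebasis R i)) x.

Lemma ball_near x r : enorm x < r -> \forall y \near x, enorm y < r.
Proof.
move=> xr; have H : \forall s \near enorm x, s < r by exact: lt_nbhsl.
exact: (@enorm_cont R n x _ H).
Qed.

Lemma has_laplacian_ball f x : twice_diff_ball f -> enorm x < 1 ->
  has_laplacian f x (laplacian f x).
Proof.
move=> Hf x1; exists (fun i y => derive f y (ebasis R i)).
exists (fun i => derive (fun y => derive f y (ebasis R i)) x (ebasis R i)); split => //.
- move=> i; apply: filterS (ball_near x1) => y /Hf[df _].
  exact: (derivableP (diff_derivable df)).
- by move=> i; exact: (derivableP (diff_derivable ((Hf x x1).2 i))).
Qed.

(** For a unit vector [e], the reflection in the hyperplane orthogonal to [e]. *)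
Definition refl e x : V := x - (2 * dot e x) *: e.

Lemma refl_line e (h : R) v x : refl e (h *: v + x) = h *: refl e v + refl e x.
Proof.
rewrite /refl dotDr dotZr scalerBr mulrDr scalerDl opprD !scalerA addrACA.
by rewrite mulrCA.
Qed.

Lemma dot_refl e x y : dot e e = 1 -> dot (refl e x) (refl e y) = dot x y.
Proof.
move=> e1; rewrite /refl; move Ea : (2 * dot e x) => a; move Eb : (2 * dot e y) => b.
rewrite -!scaleNr dotDl !dotDr !dotZl !dotZr e1 (dotC x e).
have -> : dot e x = a / 2 by rewrite -Ea; field.
have -> : dot e y = b / 2 by rewrite -Eb; field.
by field.
Qed.

Lemma enorm_refl e x : dot e e = 1 -> enorm (refl e x) = enorm x.
Proof. by move=> e1; rewrite !enormE dot_refl. Qed.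

Lemma dotNl e x : dot (- e) x = - dot e x.
Proof. by rewrite -scaleN1r dotZl mulN1r. Qed.

Lemma reflN e x : refl (- e) x = refl e x.
Proof. by rewrite /refl dotNl mulrN scalerN scaleNr opprK. Qed.

Lemma dot_refl_self e x : dot e e = 1 -> dot e (refl e x) = - dot e x.
Proof.
by move=> e1; rewrite /refl dotDr -scaleNr dotZr e1; ring.
Qed.

Lemma reflK e x : dot e e = 1 -> refl e (refl e x) = x.
Proof.
by move=> e1; rewrite {1}/refl dot_refl_self // /refl mulrN scaleNr opprK subrK.
Qed.

Lemma refl_cont e : continuous (refl e).
Proof.
move=> x; apply: differentiable_continuous.
have d1 : differentiable (fun y : V => y) x by exact: (@ex_diff _ _ _ _ _ _ _ (is_diff_id x)).
have d2 : differentiable (fun y => (2 * dot e y) *: e) x.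
  apply: differentiableZl.
  have d3 : differentiable (fun _ : V => 2 : R) x by exact: differentiable_cst.
  exact: (differentiableM d3 (differentiable_dot e x)).
exact: (differentiableB d1 d2).
Qed.

Lemma is_derive_refl f e x v l : is_derive (refl e x) (refl e v) f l ->
  is_derive x v (fun y => f (refl e y)) l.
Proof.
move=> /is_derive_line H; apply/is_derive_line.
by rewrite (_ : (fun h => _) = fun h => f (h *: refl e v + refl e x)) //; apply/funext => h;
  rewrite refl_line.
Qed.

Lemma refl_sym e i j : refl e (ebasis R i) 0 j = refl e (ebasis R j) 0 i.
Proof.
rewrite /refl 2!mxE [in RHS]mxE [in RHS]mxE (dotC e) dot_ebasis (dotC e) dot_ebasis.
by rewrite !mxE eqxx /= eq_sym; ring.
Qed.

(** The matrix [a] of the reflection is orthogonal, so contracting the second derivatives with it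
    twice leaves their trace; its symmetry turns the sums over [i] into dot products of reflected
    basis vectors. *)
Lemma has_laplacian_refl f e x : twice_diff_ball f -> dot e e = 1 -> enorm x < 1 ->
  has_laplacian (fun y => f (refl e y)) x (laplacian f (refl e x)).
Proof.
move=> Hf e1 x1; have rx1 : enorm (refl e x) < 1 by rewrite enorm_refl.
pose a i j := refl e (ebasis R i) 0 j.
pose D i y := derive f y (ebasis R i).
exists (fun i y => \sum_j a i j * D j (refl e y)).
exists (fun i => \sum_j a i j * \sum_k a i k * derive (D j) (refl e x) (ebasis R k)).
split.
- move=> i; apply: filterS (ball_near x1) => y y1; apply: is_derive_refl.
  by apply: is_derive_lin; apply: (Hf _ _).1; rewrite enorm_refl.
- move=> i; apply: (@is_derive_sumv _ _ _ _ _ (fun j y => a i j * D j (refl e y))) => j.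
  have H := is_derive_lin (refl e (ebasis R i)) ((Hf _ rx1).2 j).
  have := is_deriveMv (is_derive_cstv (a i j) x (ebasis R i)) (is_derive_refl H).
  by rewrite mul0r add0r.
have aE j k : \sum_i a i j * a i k = (j == k)%:R.
  rewrite -[RHS](_ : dot (refl e (ebasis R j)) (refl e (ebasis R k)) = _).
    by apply: eq_bigr => i _; rewrite /a refl_sym [in X in _ * X]refl_sym.
  by rewrite dot_refl // dot_ebasis /ebasis mxE eqxx.
have sumE (X : 'I_n -> 'I_n -> R) :
    \sum_i \sum_j a i j * (\sum_k a i k * X j k) = \sum_j X j j.
  under eq_bigr do under eq_bigr do rewrite mulr_sumr.
  rewrite exchange_big; apply: eq_bigr => j _; rewrite exchange_big.
  transitivity (\sum_k (j == k)%:R * X j k).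
    by apply: eq_bigr => k _; rewrite -aE mulr_suml; apply: eq_bigr => i _; rewrite mulrA.
  rewrite (bigD1 j) // eqxx mul1r big1 => [|k kj]; first exact: addr0.
  by rewrite eq_sym (negbTE kj) mul0r.
exact: (sumE (fun j k => derive (D j) (refl e x) (ebasis R k))).
Qed.

End HasLaplacian.

(** * The Laplacian of radial functions and of their products with linear forms *)

Section RadialLaplacian.
Context {R : realType} {N : nat}.
Local Notation V := 'rV[R]_N.+1.
Implicit Types (x y e : V) (i : 'I_N.+1).

Lemma near_enorm x (P : R -> Prop) : x != 0 -> (\forall r \near enorm x, P r) ->
  \forall y \near x, y != 0 /\ P (enorm y).
Proof.
move=> /enorm_gt0 x0 HP.
have H : \forall r \near enorm x, 0 < r /\ P r.
  by near=> r; split; near: r => //; exact: lt_nbhsr.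
have : \forall y \near x, 0 < enorm y /\ P (enorm y) := @enorm_cont R N.+1 x _ H.
apply: filterS => y [y0 Py]; split => //.
by apply: contraTneq y0 => ->; rewrite enorm0 ltxx.
Unshelve. all: by end_near. Qed.

Lemma sum_sqr_enorm x : \sum_i x 0 i * x 0 i = enorm x ^+ 2.
Proof. by rewrite enorm_sqr. Qed.

Lemma is_derive_radial (F : R -> R) l x i : x != 0 -> is_derive (enorm x) 1 F l ->
  is_derive x (ebasis R i) (fun y => F (enorm y)) (l * (x 0 i / enorm x)).
Proof.
move=> x0 dF; have := is_derive_compv (is_derive_enorm (ebasis R i) x0) dF.
by rewrite dot_ebasis.
Qed.

Lemma is_derive_inv_enorm x i : x != 0 ->
  is_derive x (ebasis R i) (fun y => (enorm y)^-1) (- (x 0 i) / enorm x ^+ 3).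
Proof.
move=> x0; have r0 : enorm x != 0 by rewrite gt_eqF // enorm_gt0.
have := is_derive_radial i x0 (is_deriveV1 (f := fun r => r) r0 (is_derive_id1 _)).
by move/is_derive_eq; apply; field.
Qed.

Lemma is_derive_ebasis_coord x i :
  is_derive x (ebasis R i) (fun y : V => y 0 i) 1.
Proof. by have := is_derive_coordv x (ebasis R i) i; rewrite /ebasis mxE !eqxx. Qed.

Lemma has_laplacian_radial (F F1 : R -> R) (F2 : R) x : x != 0 ->
  (\forall r \near enorm x, is_derive (r : R) 1 F (F1 r)) ->
  is_derive (enorm x) 1 F1 F2 ->
  has_laplacian (fun y => F (enorm y)) x (F2 + N%:R / enorm x * F1 (enorm x)).
Proof.
move=> x0 dF dF1; have r0 : enorm x != 0 by rewrite gt_eqF // enorm_gt0.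
exists (fun i y => F1 (enorm y) * (y 0 i / enorm y)).
pose r := enorm x.
exists (fun i => F2 / r ^+ 2 * (x 0 i * x 0 i) +
  (F1 r / r - F1 r / r ^+ 3 * (x 0 i * x 0 i))).
split.
- by move=> i; apply: filterS (near_enorm x0 dF) => y [y0]; exact: is_derive_radial.
- move=> i; have := is_deriveMv (is_derive_radial i x0 dF1)
    (is_deriveMv (is_derive_ebasis_coord x i) (is_derive_inv_enorm i x0)).
  by move/is_derive_eq; apply; rewrite /r; field.
rewrite big_split /= sumrB -!mulr_sumr sum_sqr_enorm sumr_const card_ord.
by rewrite -[_ *+ N.+1]mulr_natr -natr1 /r; field.
Qed.

(** On a radial function times a linear form the Laplacian acts as the radial operator in dimension
    N + 3, whence the coefficient [N%:R + 2]. *)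
Lemma has_laplacian_radial_dot (G G1 : R -> R) (G2 : R) x e : x != 0 ->
  (\forall r \near enorm x, is_derive (r : R) 1 G (G1 r)) ->
  is_derive (enorm x) 1 G1 G2 ->
  has_laplacian (fun y => G (enorm y) * dot e y) x
    ((G2 + (N%:R + 2) / enorm x * G1 (enorm x)) * dot e x).
Proof.
move=> x0 dG dG1; have r0 : enorm x != 0 by rewrite gt_eqF // enorm_gt0.
have de y i : is_derive y (ebasis R i) (dot e) (e 0 i).
  by have := is_derive_dot e y (ebasis R i); rewrite dotC dot_ebasis.
exists (fun i y => G1 (enorm y) * (y 0 i / enorm y) * dot e y + G (enorm y) * e 0 i).
pose r := enorm x.
exists (fun i => (G2 / r ^+ 2 - G1 r / r ^+ 3) * dot e x * (x 0 i * x 0 i) +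
  (G1 r / r * dot e x + 2 * G1 r / r * (e 0 i * x 0 i))).
split.
- move=> i; apply: filterS (near_enorm x0 dG) => y [y0 dGy].
  exact: is_deriveMv (is_derive_radial i y0 dGy) (de y i).
- move=> i; have dGx := nbhs_singleton dG.
  have := is_deriveDv (is_deriveMv (is_deriveMv (is_derive_radial i x0 dG1)
    (is_deriveMv (is_derive_ebasis_coord x i) (is_derive_inv_enorm i x0))) (de x i))
    (is_deriveMv (is_derive_radial i x0 dGx) (is_derive_cstv (e 0 i) x (ebasis R i))).
  by move/is_derive_eq; apply; rewrite /r; field.
rewrite !big_split /= -!mulr_sumr sum_sqr_enorm sumr_const card_ord -/(dot e x).
by rewrite -[_ *+ N.+1]mulr_natr -natr1 /r; field.
Qed.

(** Written with [+] and [- M] so that it is an instance of [has_laplacian_comb]. *)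
Lemma has_laplacian_strip e x (M : R) : dot e e = 1 ->
  has_laplacian (fun y => 1 + (- M) * (dot e y * dot e y)) x (0 + (- M) * 2).
Proof.
move=> e1; have de y i : is_derive y (ebasis R i) (dot e) (e 0 i).
  by have := is_derive_dot e y (ebasis R i); rewrite dotC dot_ebasis.
apply: has_laplacian_comb.
  exists (fun _ _ => 0), (fun _ => 0); split.
  - by move=> i; near=> y; exact: is_derive_cstv.
  - by move=> i; exact: is_derive_cstv.
  - by rewrite big1.
exists (fun i y => e 0 i * dot e y + dot e y * e 0 i), (fun i => 2 * (e 0 i * e 0 i)).
split.
- by move=> i; near=> y; exact: is_deriveMv (de y i) (de y i).
- move=> i; have := is_deriveDv
    (is_deriveMv (is_derive_cstv (e 0 i) x (ebasis R i)) (de x i))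
    (is_deriveMv (de x i) (is_derive_cstv (e 0 i) x (ebasis R i))).
  by move/is_derive_eq; apply; ring.
- by rewrite -mulr_sumr -/(dot e e) e1 mulr1.
Unshelve. all: by end_near. Qed.

End RadialLaplacian.

(** * Radial symmetry of eigenfunctions *)

Section MaximumPrinciple.
Context {R : realType}.
Variables (N : nat) (p : R) (w : R -> R).
Hypotheses (p0 : 0 < p) (hw : is_w N.+1 p w).
Local Notation V := 'rV[R]_N.+1.
Implicit Types (x y e : V) (r s : R).
Let dw : R -> R := derive1 w.

(** The powers of [w t] in [lam] and in [1 - u_sol] cancel; what remains depends on [t] only through
    scaling. *)
Lemma potentialE (t : R) x : 0 < t ->
  potential p w t x = t ^+ 2 * q_of p w (t * enorm x).
Proof.
move=> t0; have tx : 0 <= t * enorm x by rewrite mulr_ge0 ?enorm_ge0 // ltW.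
have w1 := w_gt0 hw t0; have w2 : 0 < w (t * enorm x).
  exact: (lt_le_trans ltr01 (w_ge1 hw tx)).
rewrite /potential /lam /u_sol subKr q_ofE // powRN powRM ?ltW ?invr_gt0 //.
have E : (w t)^-1 `^ (p + 1) = (w t `^ (p + 1))^-1.
  apply: (mulIf (x := w t `^ (p + 1))); first by rewrite gt_eqF // powR_gt0.
  by rewrite -powRM ?ltW ?invr_gt0 // !mulVf ?powR1 // gt_eqF // powR_gt0.
rewrite E.
have a1 : w t `^ (p + 1) != 0 by rewrite gt_eqF // powR_gt0.
have a2 : w (t * enorm x) `^ (p + 1) != 0 by rewrite gt_eqF // powR_gt0.
by field; rewrite a1 a2.
Qed.

Variable t : R.
Hypothesis t0 : 0 < t.

(** Away from the origin, [psi e] below is [- w t / t] times the derivative of [u_sol] along [e].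
    [d2] is the second derivative of [w] as given by the equation, and [G1] is the derivative of
    [G]. *)
Let G r := dw (t * r) / r.
Let d2 s := - (N%:R / s) * dw s + w s `^ (- p).
Let G1 r := (t * d2 (t * r) * r - dw (t * r)) / r ^+ 2.

Let psi e y := G (enorm y) * dot e y.

Lemma is_derive_scale (F : R -> R) l r : is_derive (t * r) 1 F l ->
  is_derive r 1 (fun r => F (t * r)) (t * l).
Proof.
move=> dF; have d1 : is_derive r 1 (fun r => t * r) t.
  have := is_deriveM1 (is_derive_cst1 t r) (is_derive_id1 r).
  by rewrite mul0r add0r mulr1.
by have := is_derive_comp1 d1 dF; rewrite mulrC.
Qed.

Lemma is_derive_G r : 0 < r -> is_derive r 1 G (G1 r).
Proof.
move=> r0; have r1 : r != 0 by rewrite gt_eqF.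
have tr : 0 < t * r by exact: mulr_gt0.
have := is_deriveM1 (is_derive_scale (is_derive_dw hw tr))
  (is_deriveV1 (f := fun r => r) r1 (is_derive_id1 r)).
by move/is_derive_eq; apply; rewrite /G1 /d2 -/dw; field; rewrite r1 gt_eqF.
Qed.

(** Differentiating the equation of [u_t] gives a solution of the linearized equation with
    eigenvalue 0; this is verified here through [d3], the third derivative of [w]. *)
Lemma has_laplacian_psi e x : x != 0 ->
  has_laplacian (psi e) x (- potential p w t x * psi e x).
Proof.
move=> x0; have r0 := enorm_gt0 x0; set r := enorm x in r0.
have tr : 0 < t * r by exact: mulr_gt0.
have r1 : r != 0 by rewrite gt_eqF.
have t1 : t != 0 by rewrite gt_eqF.
pose W := w (t * r) `^ (- p).
pose d3 := (N%:R / (t * r) ^+ 2) * dw (t * r) - (N%:R / (t * r)) * d2 (t * r)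
  - q_of p w (t * r) * dw (t * r).
have dd2 : is_derive (t * r) 1 d2 d3.
  have := is_deriveD1 (is_deriveM1 (is_deriveN1 (is_deriveM1 (is_derive_cst1 N%:R (t * r))
    (is_deriveV1 (f := fun r => r) (lt0r_neq0 tr) (is_derive_id1 (t * r)))))
    (is_derive_dw hw tr)) (is_derive_wN hw p tr).
  move/is_derive_eq; apply; rewrite /d3 q_ofE ?ltW // /d2 -/dw.
  by field; rewrite r1 t1.
have dG1 : is_derive r 1 G1 (t ^+ 2 * d3 / r - 2 * (t * d2 (t * r) * r - dw (t * r)) / r ^+ 3).
  have r2 : r ^+ 2 != 0 by rewrite expf_neq0.
  have := is_deriveM1 (is_deriveD1 (is_deriveM1 (is_deriveM1 (is_derive_cst1 t r)
      (is_derive_scale dd2)) (is_derive_id1 r))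
      (is_deriveN1 (is_derive_scale (is_derive_dw hw tr))))
    (is_deriveV1 (f := fun r => r ^+ 2) r2 (is_deriveX1 2 (is_derive_id1 r))).
  move/is_derive_eq; apply; rewrite /= -/(d2 (t * r)) -/dw.
  by field.
have dG : \forall s \near r, is_derive (s : R) 1 G (G1 s).
  near=> s; apply: is_derive_G; near: s; exact: lt_nbhsr.
have := has_laplacian_radial_dot e x0 dG dG1.
rewrite -/r (_ : _ * dot e x = - potential p w t x * psi e x) //.
rewrite potentialE // /psi -/r /G /G1 /d3.
by field; rewrite r1 t1.
Unshelve. all: by end_near. Qed.

(** From [dw r <= r]. It yields continuity of [psi e] at the origin, where the quotient [G] takes
    the default value 0. *)
Lemma psi_le e y : `|psi e y| <= t * `|dot e y|.
Proof.
rewrite /psi normrM ler_wpM2r //; have [->|y0] := eqVneq y 0.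
  by rewrite /G enorm0 invr0 mulr0 normr0 ltW.
have r0 := enorm_gt0 y0; have tr := mulr_gt0 t0 r0.
rewrite /G normrM normfV (gtr0_norm r0) ler_pdivrMr //.
by rewrite ger0_norm ?(dw_ge0 hw) // (dw_le p0 hw).
Qed.

Lemma psi_cont e : continuous (psi e).
Proof.
move=> y; have [->|y0] := eqVneq y 0.
  have d0 : dot e 0 = 0 by rewrite -(scale0r (0 : V)) dotZr mul0r.
  have p00 : psi e 0 = 0 by rewrite /psi d0 mulr0.
  apply: near_continuous_at => a a0; rewrite p00.
  have at0 : 0 < a / t by exact: divr_gt0.
  have H : \forall z \near (0 : V), `|dot e 0 - dot e z| < a / t.
    exact: (continuous_at_near (@dot_cont R N.+1 e 0) at0).
  apply: filterS H => z; rewrite d0 !sub0r !normrN ltr_pdivlMr // mulrC.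
  exact: le_lt_trans (psi_le e z).
have c1 : {for y, continuous (G \o @enorm R N.+1)}.
  apply: continuous_comp; first exact: enorm_cont.
  exact: is_derive_cont (is_derive_G (enorm_gt0 y0)).
exact: (continuous_atM c1 (@dot_cont R N.+1 e y)).
Qed.

(** A Hopf-type bound: [psi e] leaves the mirror at least linearly, uniformly in [e], because the
    derivative of [w] has a linear lower bound on []0, t]]. *)
Lemma psi_ge : exists2 c : R, 0 < c &
  forall e y, enorm y <= 1 -> 0 <= dot e y -> c * dot e y <= psi e y.
Proof.
pose c := w t `^ (- p) / N.+1%:R.
have wt := wN_gt0 hw (- p) t0; have N0 : 0 < N.+1%:R :> R by rewrite ltr0n.
have c0 : 0 < c by rewrite divr_gt0.
have c1 : c <= 1.
  rewrite ler_pdivrMr // mul1r; apply: le_trans (_ : 1 <= _); last by rewrite ler1n.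
  by apply: (wN_le1 hw); rewrite ltW.
exists (c * t); first exact: mulr_gt0.
move=> e y y1 dy; have [y0|y0] := eqVneq y 0.
  by rewrite /psi y0 (_ : dot e 0 = 0) ?mulr0 // -(scale0r (0 : V)) dotZr mul0r.
have r0 := enorm_gt0 y0; have tr := mulr_gt0 t0 r0.
rewrite /psi ler_wpM2r // /G ler_pdivlMr // -mulrA.
apply: (dw_ge p0 hw (T := t)) => //; last first.
- by rewrite /c divfK // gt_eqF.
- exact: ltW.
- by rewrite ger_pMr.
Qed.

Variables (mu : R) (f : V -> R).
Hypotheses (mu0 : mu < 0) (Hf : dirichlet_eigenfunction p w t mu f).

(* A positive maximum of the odd part [g] of [f] divided by the strict
   supersolution [psi + eps (1 - M s ^+ 2)] on the half ball [s >= 0] is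
   interior and contradicts the equation; [psi] is minus a derivative of [u_t],
   and [eps M = c] makes the strip term win where [psi] degenerates. *)
Lemma eigenfunction_refl_le e x : dot e e = 1 -> enorm x <= 1 -> 0 <= dot e x ->
  f x <= f (refl e x).
Proof.
move=> e1 x1 ex; rewrite leNgt; apply/negP => gx.
case: Hf => cf [Hd [Hlap Hbd]].
have [c c0 Hc] := psi_ge.
(* [M] bounds the potential, since [q_of] is at most [p]. *)
pose M := t ^+ 2 * p.
have M0 : 0 < M by rewrite mulr_gt0 // exprn_gt0.
pose eps := c / M.
have eps0 : 0 < eps by exact: divr_gt0.
have epsM : eps * M = c by rewrite divfK // gt_eqF.
pose m y := psi e y + eps * (1 + (- M) * (dot e y * dot e y)).
pose g y := f y - f (refl e y).
pose K := [set y | enorm y <= 1] `&` [set y | 0 <= dot e y].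
have enorme : enorm e = 1 by rewrite enormE e1 sqrtr1.
have s1 y : enorm y <= 1 -> dot e y <= 1.
  move=> y1; apply: le_trans (ler_norm _) _; apply: le_trans (dot_le e y) _.
  by rewrite enorme mul1r.
(* With [s = dot e y] in [[0, 1]], [psi] is at least [c * s], hence at least [c * s ^+ 2]; the
   remaining [eps] makes [m] positive on the closed half ball, mirror included. *)
have m_gt0 y : K y -> 0 < m y.
  move=> [/= y1 sy]; have h1 := Hc e y y1 sy; have h2 := s1 y y1.
  have -> : m y = psi e y + eps - c * (dot e y * dot e y) by rewrite /m -epsM; ring.
  have : c * (dot e y * dot e y) <= c * dot e y by rewrite ler_pM2l // ler_piMl.
  by lra.
have cm : continuous m.
  move=> y; have c2 := continuous_atM (@dot_cont R N.+1 e y) (@dot_cont R N.+1 e y).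
  have c3 := continuous_atM (@continuous_at_cst R _ (- M) y) c2.
  have c4 := continuous_atD (@continuous_at_cst R _ 1 y) c3.
  exact: (continuous_atD (@psi_cont e y)
    (continuous_atM (@continuous_at_cst R _ eps y) c4)).
have crefl := @refl_cont R N.+1 e.
have cg : {within K, continuous g}.
  apply: within_continuousB.
    by apply: continuous_subspaceW cf => y [].
  have KA y : K y -> [set y | enorm y <= 1] (refl e y).
    by move=> [y1 _] /=; rewrite enorm_refl.
  exact: within_continuous_comp cf crefl KA.
have ch : {within K, continuous (fun y => g y / m y)}.
  by apply: within_continuous_div cg cm _ => y Ky; rewrite gt_eqF // m_gt0.
have Kx : K x by [].
have cK : compact K.
  apply: bounded_closed_compact.
    exists 1; split; first exact: num_real.
    move=> b b1 y [/= y1 _]; apply: le_trans (norm_le_enorm y) _.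
    exact: le_trans y1 (ltW b1).
  apply: closedI.
    have -> : [set y : V | enorm y <= 1] = (@enorm R N.+1) @^-1` [set r | r <= 1] by [].
    by apply: preimage_closed => [z _|]; [exact: enorm_cont|exact: closed_le].
  have -> : [set y : V | 0 <= dot e y] = (dot e) @^-1` [set r | 0 <= r] by [].
  by apply: preimage_closed => [z _|]; [exact: dot_cont|exact: closed_ge].
have [z + Hz] := EVT_max_rV (ex_intro _ x Kx) cK ch.
rewrite inE => Kz; have [/= z1 sz] := Kz.
pose h := g z / m z.
have h0 : 0 < h.
  apply: lt_le_trans (Hz x (mem_set Kx)).
  by rewrite divr_gt0 ?m_gt0 // subr_gt0.
have gz : g z = h * m z by rewrite /h divfK // gt_eqF // m_gt0.
have gz0 : 0 < g z by rewrite gz mulr_gt0 // m_gt0.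
have z_lt : enorm z < 1.
  rewrite lt_neqAle z1 andbT; apply: contraTneq gz0 => E.
  by rewrite /g !Hbd ?enorm_refl // subrr ltxx.
have s_gt : 0 < dot e z.
  rewrite lt_neqAle sz andbT; apply: contraTneq gz0 => E.
  by rewrite /g /refl -E mulr0 scale0r subr0 subrr ltxx.
have z0 : z != 0.
  by apply: contraTneq s_gt => ->; rewrite -(scale0r (0 : V)) dotZr mul0r ltxx.
have Lf := has_laplacian_ball Hd z_lt.
have Lr := has_laplacian_refl Hd e1 z_lt.
have Lm := has_laplacian_comb eps (has_laplacian_psi e z0) (has_laplacian_strip z M e1).
have L := has_laplacian_comb (- h) (has_laplacian_comb (- 1) Lf Lr) Lm.
have near_le : \forall y \near z,
    f y + -1 * f (refl e y) + - h * m y <= f z + -1 * f (refl e z) + - h * m z.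
  have A1 := ball_near z_lt.
  have A2 : \forall y \near z, 0 < dot e y.
    have H : \forall r \near dot e z, 0 < r by exact: lt_nbhsr.
    exact: (@dot_cont R N.+1 e z _ H).
  apply: filterS2 A1 A2 => y y1 sy.
  have Ky : K y by split; exact: ltW.
  have : g y <= h * m y.
    by have := Hz y (mem_set Ky); rewrite -/h ler_pdivrMr // m_gt0.
  by move: gz; rewrite /g; lra.
have := has_laplacian_max L near_le.
have rz_lt : enorm (refl e z) < 1 by rewrite enorm_refl.
have E1 := Hlap z z_lt; have E2 := Hlap _ rz_lt.
have PV : potential p w t (refl e z) = potential p w t z.
  by rewrite !potentialE // enorm_refl.
rewrite PV in E2.
have V0 : 0 <= potential p w t z.
  rewrite potentialE // mulr_ge0 ?sqr_ge0 //.
  by case/andP: (q_of_bound p0 hw (t * enorm z)).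
have VM : potential p w t z <= M.
  rewrite potentialE // /M ler_wpM2l ?sqr_ge0 //.
  by case/andP: (q_of_bound p0 hw (t * enorm z)).
have hz1 := s1 z z1; have hz2 := Hc e z z1 sz.
move: E1 E2 V0 VM gz hz1 hz2 s_gt; rewrite /g /m.
move: (f z) (f (refl e z)) (laplacian f z) (laplacian f (refl e z)) (potential p w t z)
  (psi e z) (dot e z) => a b la lb v ps s E1 E2 v0 vM gz s1' ps1 s0.
have -> : la = - (v + mu) * a by lra.
have -> : lb = - (v + mu) * b by lra.
have -> : - (v + mu) * a + -1 * (- (v + mu) * b) +
  - h * (- v * ps + eps * (0 + - M * 2)) =
  - (v + mu) * (a - b) - h * (- v * ps - 2 * (eps * M)) by ring.
rewrite gz leNgt => /negP; apply.
(* The summands in the last bracket are nonnegative: [mu < 0], [0 <= v <= M] and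
   [ps >= c * s >= c * (s * s)]. Of the [2 * (eps * M)] from the strip, one half pays for [eps * v];
   the other remains and is positive. *)
have -> : - (v + mu) * (h * (ps + eps * (1 + - M * (s * s)))) -
    h * (- v * ps - 2 * (eps * M)) =
  h * (- mu * (ps - eps * M * (s * s)) + eps * (- mu)
     + eps * (M - v) + v * (eps * M) * (s * s) + eps * M) by ring.
rewrite epsM; apply: mulr_gt0 => //.
have ss : s * s <= s by rewrite ler_piMl // ltW.
have css : c * (s * s) <= c * s by rewrite ler_pM2l.
have mu1 : 0 < - mu by rewrite oppr_gt0.
have q1 : 0 <= - mu * (ps - c * (s * s)).
  by apply: mulr_ge0; [exact: ltW|rewrite subr_ge0 (le_trans css)].
have q2 : 0 < eps * (- mu) by exact: mulr_gt0.
have q3 : 0 <= eps * (M - v) by apply: mulr_ge0; [exact: ltW|rewrite subr_ge0].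
have q4 : 0 <= v * c * (s * s).
  by apply: mulr_ge0; [apply: mulr_ge0; [|exact: ltW]|rewrite -expr2 sqr_ge0].
by apply: ltr_wpDl c0; rewrite !addr_ge0 // ltW.
Qed.

(** The reflection in the hyperplane bisecting [x] and [y] exchanges them; the one-sided inequality
    is used with [e] and with [- e]. *)
Lemma eigenfunction_radial x y : enorm x <= 1 -> enorm x = enorm y -> f x = f y.
Proof.
move=> x1 xy; have [->//|ne] := eqVneq x y.
have d0 : x - y != 0 by rewrite subr_eq0.
have r0 := enorm_gt0 d0; set r := enorm (x - y) in r0.
have r1 : r != 0 by rewrite gt_eqF.
pose e := r^-1 *: (x - y).
have xx : dot x x = dot y y by rewrite -!enorm_sqr xy.
have rr : r ^+ 2 = 2 * (dot x x - dot x y).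
  rewrite enorm_sqr -scaleN1r dotDl !dotDr !dotZl !dotZr (dotC y x) -xx; ring.
have e1 : dot e e = 1.
  by rewrite /e dotZl dotZr -enorm_sqr -/r; field.
have ex : dot e x = r / 2.
  rewrite /e dotZl -scaleN1r dotDl dotZl (dotC y x).
  have -> : dot x x + -1 * dot x y = r ^+ 2 / 2 by rewrite rr; field.
  by field.
have rx : refl e x = y.
  rewrite /refl ex mulrC divfK // /e scalerA mulfV // scale1r opprB addrC subrK //.
have ry : refl (- e) y = x by rewrite reflN -rx reflK.
have ey : dot (- e) y = r / 2 by rewrite dotNl -rx dot_refl_self // opprK.
have ee : dot (- e) (- e) = 1 by rewrite dotNl dotC dotNl opprK.
apply/eqP; rewrite eq_le; apply/andP; split.
  by rewrite -rx; apply: eigenfunction_refl_le => //; rewrite ex divr_ge0 // ltW.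
rewrite -[in X in _ <= X]ry; apply: eigenfunction_refl_le => //; first by rewrite -xy.
by rewrite ey divr_ge0 // ltW.
Qed.

End MaximumPrinciple.

(** * Differentiability at the origin *)

Section DifferentiableAtZero.
Context {R : realType} {n : nat}.
Local Notation V := 'rV[R]_n.
Implicit Types (f h : V -> R) (x y : V) (i : 'I_n).

(** The chain rule fails at the origin, where the Euclidean norm is not differentiable; there
    derivatives come from estimates, and a deviation o(|y - x|) means that the differential is 0. *)
Lemma differentiable_little f x :
  (forall e : R, 0 < e -> \forall y \near x, `|f y - f x| <= e * `|y - x|) ->
  differentiable f x /\ forall v, derive f x v = 0.
Proof.
move=> H.
have E : f \o shift x = cst (f x) + (0 : V -> R) +o_ (0 : V) id.
  apply/eqaddoP => e e0.
  have := H e e0; rewrite (near_shift 0 x) => He.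
  apply: filterS He => y /=; rewrite !fctE /= addr0 subr0 addrK.
  by rewrite -[_ - _]/(_ - _).
have D : 'd f x = (0 : V -> R) :> (V -> R).
  by apply: diff_unique => //; exact: cst_continuous.
have df : differentiable f x.
  apply/diff_locallyP; rewrite D; split => //; exact: cst_continuous.
by split => // v; rewrite deriveE // D.
Qed.

Lemma coord_le_norm x i : `|x 0 i| <= `|x|.
Proof.
rewrite [leRHS]/Num.norm /= mx_normrE; apply/bigmax_geP; right => /=.
by exists (0, i).
Qed.

(** Continuity of [h] suffices, as [(h y - h 0) * y 0 i] is o(|y|). The partial derivatives of a
    radial function have this shape. *)
Lemma differentiable_mul_coord0 h i : {for (0 : V), continuous h} ->
  differentiable (fun y => h y * y 0 i) 0.
Proof.
move=> ch.
have d1 : differentiable (fun y : V => h 0 * y 0 i) 0.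
  exact: (differentiableM (differentiable_cst (h 0) (0 : V)) (differentiable_coord (0 : V) 0 i)).
have d2 : differentiable (fun y : V => (h y - h 0) * y 0 i) 0.
  apply: (differentiable_little _).1 => e e0; have := continuous_at_near ch e0.
  apply: filterS => y /ltW hy; rewrite [(0 : V) 0 i]mxE mulr0 !subr0 normrM distrC.
  by apply: ler_pM => //; exact: coord_le_norm.
rewrite (_ : (fun y => _) = (fun y : V => h 0 * y 0 i) + (fun y : V => (h y - h 0) * y 0 i)).
  exact: differentiableD.
by apply/funext => y; rewrite fctE; ring.
Qed.

Lemma is_derive_mul_coord0 h i : {for (0 : V), continuous h} ->
  is_derive (0 : V) (ebasis R i) (fun y => h y * y 0 i) (h 0).
Proof.
move=> ch; apply/is_derive_line/is_derive1_caratheodory.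
exists (fun s : R => h (s *: ebasis R i + 0)); split.
- by move=> s; rewrite !mxE !eqxx /=; ring.
- apply: near_continuous_at => e e0; rewrite line0.
  have line : (fun s : R => s *: ebasis R i + 0) @ (0 : R) --> (0 : V).
    rewrite -[X in _ --> X](line0 0 (ebasis R i)).
    by apply: cvgD; [apply: cvgZl; exact: cvg_id|exact: cvg_cst].
  exact: line _ (continuous_at_near ch e0).
- by rewrite line0.
Qed.

Lemma enorm_le_norm x : enorm x <= n%:R * `|x|.
Proof.
rewrite -(ler_pXn2r (n := 2)) ?nnegrE ?enorm_ge0 ?mulr_ge0 //.
rewrite enorm_sqr exprMn; apply: le_trans (_ : n%:R * `|x| ^+ 2 <= _).
  rewrite mulr_natl -[X in _ *+ X](card_ord n) -sumr_const.
  apply: ler_sum => i _; rewrite -expr2 -real_normK ?num_real //.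
  by rewrite lerXn2r ?nnegrE // coord_le_norm.
by rewrite ler_wpM2r ?sqr_ge0 // -natrX ler_nat; case: (n) => // k; rewrite leq_pmull.
Qed.

End DifferentiableAtZero.

(** * Expansion of [Phi nu] at the origin *)

Section PhiAtZero.
Context {R : realType}.
Variables (N : nat) (q : R -> R) (Q : R).
Hypotheses (cq : continuous q) (qQ : forall x, 0 <= q x <= Q).
Local Notation Phi := (Phi N cq qQ).
Local Notation dPhi := (dPhi N cq qQ).
Implicit Types (nu r s : R).

(** The second derivative of [Phi nu] at 0: in the limit the equation reads
    [(N + 1) * slope0 nu = - (q 0 + nu)]. *)
Definition slope0 nu : R := - (q 0 + nu) / N.+1%:R.

(** [H c] has the derivative [r ^+ N * (a0 + c - A r)] with [A] close to [a0], so [H e] increases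
    and [H (- e)] decreases from 0; division by [s ^+ N.+1] frames the quotient. *)
Lemma dPhi_origin nu (e : R) : 0 < e ->
  exists2 d, 0 < d & forall s, 0 < s < d -> `|dPhi nu s / s - slope0 nu| <= e.
Proof.
move=> e0; have cA : continuous (fun r => (q r + nu) * Phi nu r).
  by move=> r; apply: cvgM; [exact: shift_cont|exact: Phi_cont].
have [d d0 Hd] := cont_ball (cA 0) e0.
exists d => // s /andP[s0 sd].
have N0 : 0 < N.+1%:R :> R by rewrite ltr0n.
have N1 : 1 <= N.+1%:R :> R by rewrite ler1n.
pose a0 := q 0 + nu; pose A r := (q r + nu) * Phi nu r.
have A0 : A 0 = a0 by rewrite /A Phi0 mulr1.
pose H (c r : R) := r ^+ N * dPhi nu r + (a0 + c) / N.+1%:R * r ^+ N.+1.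
have dH c r : 0 < r -> is_derive r 1 (H c) (r ^+ N * (a0 + c - A r)).
  move=> r0; have r1 : r != 0 by rewrite gt_eqF.
  have := is_deriveD1 (is_deriveM1 (is_deriveX1 N (is_derive_id1 r)) (is_derive_dPhi N cq qQ nu r0))
    (is_deriveM1 (is_derive_cst1 ((a0 + c) / N.+1%:R) r) (is_deriveX1 N.+1 (is_derive_id1 r))).
  move/is_derive_eq; apply; rewrite /A.
  have N2 : N.+1%:R != 0 :> R by rewrite gt_eqF.
  move: N.+1%:R N2 => n1 N2; case: (N) => [|N'] /=; first by rewrite expr0; field; rewrite ?r1 ?N2.
  by rewrite exprS; field; rewrite r1 N2.
have cH c : continuous (H c).
  move=> r; apply: cvgD.
    by apply: cvgM; [exact: exprn_continuous|exact: dPhi_cont].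
  by apply: cvgM; [exact: cvg_cst|exact: exprn_continuous].
have H0 c : H c 0 = 0 by rewrite /H dPhi0 mulr0 expr0n mulr0 addr0.
have AE r : 0 < r < s -> `|A r - a0| < e.
  by move=> /andP[r0 rs]; rewrite -A0; apply: Hd; rewrite subr0 gtr0_norm //; lra.
have sN : 0 < s ^+ N by exact: exprn_gt0.
have HE c : H c s = s ^+ N.+1 * (dPhi nu s / s - slope0 nu + c / N.+1%:R).
  rewrite /H /slope0 exprS -/a0; field.
  by rewrite !gt_eqF.
have sN1 : 0 < s ^+ N.+1 by exact: exprn_gt0.
have eN : e / N.+1%:R <= e by rewrite ler_pdivrMr // ler_peMr // ltW.
have P1 : 0 <= H e s.
  rewrite -(H0 e); apply: (@derive_nonneg_le _ (H e) (fun r => r ^+ N * (a0 + e - A r))).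
  - exact: ltW.
  - by apply: within_cont => r _; exact: cH.
  - by move=> r /andP[r0 _]; exact: dH.
  - move=> r rs; have /andP[r0 _] := rs; apply: mulr_ge0; first by rewrite exprn_ge0 // ltW.
    by have := AE r rs; rewrite ltr_norml => /andP[]; lra.
have P2 : 0 <= - H (- e) s.
  rewrite -oppr0 -(H0 (- e)).
  apply: (@derive_nonneg_le _ (fun r => - H (- e) r) (fun r => - (r ^+ N * (a0 - e - A r)))).
  - exact: ltW.
  - by apply: within_cont => r _; apply: cvgN; exact: cH.
  - by move=> r /andP[r0 _]; apply: is_deriveN1; exact: dH.
  - move=> r rs; have /andP[r0 _] := rs; rewrite -mulrN; apply: mulr_ge0.
      by rewrite exprn_ge0 // ltW.
    by have := AE r rs; rewrite ltr_norml => /andP[]; lra.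
move: P1 P2; rewrite !HE pmulr_rge0 // oppr_ge0 pmulr_rle0 //.
rewrite [- e / _]mulNr => h1 h2; move: h1 h2 eN.
move: (dPhi nu s / s - slope0 nu) (e / N.+1%:R) => X E.
by clear; rewrite ler_norml => h1 h2 h3; apply/andP; split; lra.
Qed.

Lemma dPhi_linear nu : exists C d : R, [/\ 0 <= C, 0 < d &
  forall s, 0 < s < d -> `|dPhi nu s| <= C * s].
Proof.
have [d d0 Hd] := dPhi_origin nu ltr01.
exists (`|slope0 nu| + 1), d; split => // s sd.
have /andP[s0 _] := sd; rewrite -ler_pdivrMr //.
have -> : `|dPhi nu s| / s = `|dPhi nu s / s| by rewrite normrM normfV (gtr0_norm s0).
rewrite -[X in `|X|](subrK (slope0 nu)); apply: le_trans (ler_normD _ _) _.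
by rewrite addrC lerD2l Hd.
Qed.

Lemma Phi_quadratic nu : exists C d : R, [/\ 0 <= C, 0 < d &
  forall s, 0 <= s < d -> `|Phi nu s - 1| <= C * s ^+ 2].
Proof.
have [C [d [C0 d0 Hd]]] := dPhi_linear nu.
exists C, d; split => // s /andP[]; rewrite le_eqVlt => /orP[/eqP<- _|s0 sd].
  by rewrite Phi0 subrr normr0 expr0n mulr0.
have [c /andP[c0 cs]] := MVT1 s0 (within_cont (fun x _ => @Phi_cont _ N q Q cq qQ nu x))
  (fun x _ => is_derive_Phi N cq qQ nu x).
rewrite Phi0 subr0 => ->; rewrite normrM (gtr0_norm s0) expr2 mulrA ler_pM2r //.
apply: le_trans (Hd c _) _; first by rewrite c0; lra.
by rewrite ler_wpM2l // ltW.
Qed.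

End PhiAtZero.

(** * From a zero of [Phi nu] at [t] to an eigenfunction *)

Section RadialEigenfunction.
Context {R : realType}.
Variables (N : nat) (p : R) (w : R -> R).
Hypotheses (p0 : 0 < p) (hw : is_w N.+1 p w).
Local Notation V := 'rV[R]_N.+1.
Local Notation Phi := (Phi N (q_of_cont hw) (q_of_bound p0 hw)).
Local Notation dPhi := (dPhi N (q_of_cont hw) (q_of_bound p0 hw)).
Variables (t nu : R).
Hypothesis t0 : 0 < t.
Implicit Types (x y : V) (i : 'I_N.+1) (r s : R).

Let u y := Phi nu (t * enorm y).
Let F1 r := t * dPhi nu (t * r).
Let F2 r := t * (t * (- (N%:R / (t * r)) * dPhi nu (t * r)
  - (q_of p w (t * r) + nu) * Phi nu (t * r))).
Let L : R := t ^+ 2 * slope0 N (q_of p w) nu.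
(** The radial factor of the gradient: the [i]-th partial derivative of [u] is
    [K (enorm y) * y 0 i], and [L] is the limit of [F1 r / r] at 0. *)
Let K r := if r <= 0 then L else F1 r / r.

Lemma is_derive_PhiS r : is_derive r 1 (fun s => Phi nu (t * s)) (F1 r).
Proof. apply: is_derive_scale; exact: is_derive_Phi. Qed.

Lemma is_derive_F1 r : 0 < r -> is_derive r 1 F1 (F2 r).
Proof.
move=> r0; have tr : 0 < t * r by exact: mulr_gt0.
have := is_deriveM1 (is_derive_cst1 t r) (is_derive_scale
  (is_derive_dPhi N (q_of_cont hw) (q_of_bound p0 hw) nu tr)).
by rewrite mul0r add0r.
Qed.

Lemma K_cont0 : {for (0 : V), continuous (fun y => K (enorm y))}.
Proof.
apply: near_continuous_at => e e0.
pose e1 := e / 2 / t ^+ 2.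
have t2 : 0 < t ^+ 2 by exact: exprn_gt0.
have e10 : 0 < e1 by rewrite !divr_gt0.
have [d d0 Hd] := dPhi_origin N (q_of_cont hw) (q_of_bound p0 hw) nu e10.
have dt0 : enorm (0 : V) < d / t by rewrite enorm0 divr_gt0.
apply: filterS (ball_near dt0) => y yd; rewrite enorm0 {1}/K lexx /K.
case: ifPn => [_|]; first by rewrite subrr normr0.
rewrite -ltNge => y0; rewrite distrC.
have ty : 0 < t * enorm y < d by rewrite mulr_gt0 //= mulrC -ltr_pdivlMr.
have -> : F1 (enorm y) / enorm y - L =
    t ^+ 2 * (dPhi nu (t * enorm y) / (t * enorm y) - slope0 N (q_of p w) nu).
  by rewrite /F1 /L; field; rewrite !gt_eqF.
rewrite normrM gtr0_norm //; apply: le_lt_trans (ler_wpM2l (ltW t2) (Hd _ ty)) _.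
rewrite /e1 mulrC divfK ?gt_eqF //; lra.
Qed.

Lemma u_origin : differentiable u 0 /\ forall v, derive u 0 v = 0.
Proof.
apply: differentiable_little => e e0.
have [C [d [C0 d0 Hd]]] := Phi_quadratic N (q_of_cont hw) (q_of_bound p0 hw) nu.
pose B := C * t ^+ 2 * N.+1%:R + 1.
have B0 : 0 < B.
  by rewrite ltr_wpDl // !mulr_ge0 // ltW.
have m0 : enorm (0 : V) < Num.min (d / t) (e / B).
  by rewrite enorm0 lt_min !divr_gt0.
apply: filterS (ball_near m0) => y; rewrite lt_min => /andP[y1 y2].
rewrite /u enorm0 mulr0 Phi0 subr0.
have ty : 0 <= t * enorm y < d.
  by rewrite mulr_ge0 ?enorm_ge0 ?ltW //= mulrC -ltr_pdivlMr.
apply: le_trans (Hd _ ty) _.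
have h1 := enorm_le_norm y; have h2 := enorm_ge0 y.
have {}y2 : enorm y * B <= e by rewrite -ler_pdivlMr // ltW.
apply: le_trans (_ : enorm y * B * `|y| <= _); last by rewrite ler_wpM2r.
have -> : C * (t * enorm y) ^+ 2 = enorm y * (C * t ^+ 2 * enorm y) by ring.
rewrite -[enorm y * B * _]mulrA; apply: ler_wpM2l => //.
rewrite /B mulrDl mul1r; apply: ler_wpDr => //.
by rewrite -[C * _ * _ * _]mulrA ler_wpM2l // mulr_ge0 // sqr_ge0.
Qed.

Lemma u_gradient i : (fun y => derive u y (ebasis R i)) = fun y => K (enorm y) * y 0 i.
Proof.
apply/funext => y; have [->|y0] := eqVneq y 0.
  by rewrite u_origin.2 mxE mulr0.
have r0 := enorm_gt0 y0.
rewrite (@derive_val _ _ _ _ _ _ _ (is_derive_radial i y0 (is_derive_PhiS (enorm y)))).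
by rewrite /K ifF ?leNgt ?r0 // mulrA mulrAC.
Qed.

Lemma u_twice_diff y : differentiable u y /\
  forall i, differentiable (fun y => derive u y (ebasis R i)) y.
Proof.
split.
  have [->|y0] := eqVneq y 0; first exact: u_origin.1.
  exact: differentiable_radial y0 (is_derive_PhiS (enorm y)).
move=> i; rewrite u_gradient; have [->|y0] := eqVneq y 0.
  exact: differentiable_mul_coord0 K_cont0.
have r0 := enorm_gt0 y0.
have dK : is_derive (enorm y) 1 K (F2 (enorm y) * (enorm y)^-1 +
    F1 (enorm y) * (- 1 / enorm y ^+ 2)).
  apply: (is_derive_near _ (is_deriveM1 (is_derive_F1 r0)
    (is_deriveV1 (f := fun r => r) (lt0r_neq0 r0) (is_derive_id1 (enorm y))))).
  near=> s; rewrite /K ifF // leNgt; apply/negbF; near: s; exact: lt_nbhsr.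
exact: (differentiableM (differentiable_radial y0 dK) (differentiable_coord y 0 i)).
Unshelve. all: by end_near. Qed.

(** At the origin all [N + 1] pure second derivatives equal [L], and the denominator in [slope0]
    makes their sum fit the equation. *)
Lemma u_laplacian y : laplacian u y + potential p w t y * u y + t ^+ 2 * nu * u y = 0.
Proof.
rewrite potentialE //; have [->|y0] := eqVneq y 0.
  rewrite /laplacian.
  have E i : derive (fun y => derive u y (ebasis R i)) 0 (ebasis R i) = L.
    rewrite u_gradient.
    rewrite (@derive_val _ _ _ _ _ _ _ (is_derive_mul_coord0 i K_cont0)).
    by rewrite /K enorm0 lexx.
  under eq_bigr do rewrite E.
  rewrite sumr_const card_ord -[_ *+ _]mulr_natr /u enorm0 mulr0 Phi0 /L /slope0.
  have N0 : N.+1%:R != 0 :> R by rewrite pnatr_eq0.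
  by move: N.+1%:R N0 => m m0; field.
have r0 := enorm_gt0 y0.
have := @has_laplacian_radial R N (fun s => Phi nu (t * s)) F1 (F2 (enorm y)) y y0 _
  (is_derive_F1 r0).
move=> H; rewrite (laplacianE (H _)); last by near=> s; exact: is_derive_PhiS.
rewrite /F1 /F2 /u; field.
by rewrite !gt_eqF.
Unshelve. all: by end_near. Qed.

Lemma Phi_eigenfunction : Phi nu t = 0 ->
  dirichlet_eigenfunction p w t (t ^+ 2 * nu) u.
Proof.
move=> Pt; split.
  apply: continuous_subspaceT => y.
  apply: differentiable_continuous; exact: (u_twice_diff y).1.
split; first by move=> y _; exact: u_twice_diff.
split; first by move=> y _; exact: u_laplacian.
by move=> y y1; rewrite /u y1 mulr1.
Qed.

End RadialEigenfunction.

(** * From an eigenfunction with negative eigenvalue to a multiple of [Phi nu] *)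

Section EigenfunctionProfile.
Context {R : realType}.
Variables (N : nat) (p : R) (w : R -> R).
Hypotheses (p0 : 0 < p) (hw : is_w N.+1 p w).
Local Notation V := 'rV[R]_N.+1.
Local Notation Phi := (Phi N (q_of_cont hw) (q_of_bound p0 hw)).
Local Notation dPhi := (dPhi N (q_of_cont hw) (q_of_bound p0 hw)).
Variables (t mu : R) (f : V -> R).
Hypotheses (t0 : 0 < t) (mu0 : mu < 0) (Hf : dirichlet_eigenfunction p w t mu f).
Implicit Types (x y : V) (r s : R).

Let e0 : V := ebasis R ord0.
Let nu := mu / t ^+ 2.
Let F s := f (s *: e0).
Let F1 s := derive f (s *: e0) e0.
Let F2 s := derive (fun y => derive f y e0) (s *: e0) e0.

Lemma enorm_ray s : enorm (s *: e0) = `|s|.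
Proof. by rewrite enormZ enorm_ebasis mulr1. Qed.

Lemma radial_profile x : enorm x <= 1 -> f x = F (enorm x).
Proof.
move=> x1; apply: (eigenfunction_radial p0 hw t0 mu0 Hf x1).
by rewrite enorm_ray ger0_norm // enorm_ge0.
Qed.

Lemma is_derive_ray (g : V -> R) l s : is_derive (s *: e0) e0 g l ->
  is_derive s 1 (fun r => g (r *: e0)) l.
Proof.
move=> /is_derive_line H.
have E : (fun h : R => g (h *: e0 + s *: e0)) =
    (fun h : R => (fun r : R => g (r *: e0)) (h + s)).
  by apply/funext => h; rewrite -scalerDl.
rewrite E in H.
have d1 : is_derive s 1 (fun r : R => r - s) 1.
  by have := is_deriveD1 (is_derive_id1 s) (is_derive_cst1 (- s) s); rewrite addr0.
rewrite -(subrr s) in H.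
have := is_derive_comp1 d1 H; rewrite mulr1.
by rewrite (_ : (fun r => _) = (fun r => g (r *: e0))) //; apply/funext => r; rewrite subrK.
Qed.

Lemma is_derive_profile s : `|s| < 1 -> is_derive s 1 F (F1 s).
Proof.
move=> s1; apply: is_derive_ray; case: Hf => _ [Hd _].
have [|df _] := Hd (s *: e0); first by rewrite enorm_ray.
exact: derivableP (diff_derivable df).
Qed.

Lemma is_derive_profile1 s : `|s| < 1 -> is_derive s 1 F1 (F2 s).
Proof.
move=> s1; apply: (is_derive_ray (g := fun y => derive f y e0)); case: Hf => _ [Hd _].
have [|_ df] := Hd (s *: e0); first by rewrite enorm_ray.
exact: derivableP (diff_derivable (df ord0)).
Qed.

(** The ray is parametrized on both sides of 0, and radial symmetry makes [F] even; this yields the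
    regular initial condition. *)
Lemma profile_even : F1 0 = 0.
Proof.
have l01 : `|0 : R| < 1 by rewrite normr0.
have dN : is_derive (0 : R) 1 (fun s => - s) (-1).
  exact: is_deriveN1 (is_derive_id1 0).
have d1 : is_derive (0 : R) 1 (fun s => F (- s)) (F1 0 * -1).
  by apply: (is_derive_comp1 dN); rewrite oppr0; exact: is_derive_profile.
have E : \forall s \near (0 : R), F (- s) = F s.
  have H : \forall s \near (0 : R), `|s| < 1.
    apply/nbhs_ballP; exists 1 => //= s; by rewrite /ball /= sub0r normrN.
  apply: filterS H => s s1; rewrite /F.
  apply: (eigenfunction_radial p0 hw t0 mu0 Hf); first by rewrite enorm_ray normrN ltW.
  by rewrite !enorm_ray normrN.
have [_ E1] := near_eq_is_derive E d1.
have [_ E2] := is_derive_profile l01.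
by move: E1; rewrite E2; lra.
Qed.

(** Near a point of the ray other than the origin [f] is the radial function [F (enorm y)], so its
    Laplacian can be computed in radial form and inserted in the eigenvalue equation. *)
Lemma profile_ode s : 0 < s < 1 ->
  F2 s = - (N%:R / s) * F1 s - (t ^+ 2 * q_of p w (t * s) + mu) * F s.
Proof.
move=> /andP[s0 s1]; have ns : `|s| = s by rewrite gtr0_norm.
pose x := s *: e0; have xs : enorm x = s by rewrite enorm_ray.
have x1 : enorm x < 1 by rewrite xs.
have x0 : x != 0.
  by apply: contraTneq s0 => E; rewrite -xs E enorm0 ltxx.
have dF : \forall r \near enorm x, is_derive (r : R) 1 F (F1 r).
  rewrite xs; near=> r; apply: is_derive_profile; rewrite ltr_norml; apply/andP; split.
    by apply: lt_trans (_ : 0 < _); [rewrite ltrN10|near: r; exact: lt_nbhsr].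
  near: r; exact: lt_nbhsl.
have dF1 : is_derive (enorm x) 1 F1 (F2 s).
  by rewrite xs; apply: is_derive_profile1; rewrite ns.
have L := has_laplacian_radial x0 dF dF1.
have E : \forall y \near x, F (enorm y) = f y.
  by apply: filterS (ball_near x1) => y /ltW y1; rewrite -radial_profile.
have := laplacianE (has_laplacian_near E L).
case: Hf => _ [_ [Hlap _]] => LE.
have := Hlap x x1; rewrite LE potentialE // xs -/(F s); lra.
Unshelve. all: by end_near. Qed.

(** The rescaling [r = t * s] turns the eigenvalue into [nu = mu / t ^+ 2]. The value [r = t] is
    left out because on the sphere only continuity of [f] is known. *)
Lemma eigenfunction_profile_in r : 0 <= r < t -> F (r / t) = F 0 * Phi nu r.
Proof.
move=> /andP[r0 rt].
have t1 : t != 0 by rewrite gt_eqF.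
have dscale s (g : R -> R) l : is_derive (s / t) 1 g l ->
    is_derive s 1 (fun r => g (r / t)) (l / t).
  move=> dg; have d1 : is_derive s 1 (fun r => r / t) (t^-1).
    have := is_deriveM1 (is_derive_id1 s) (is_derive_cst1 (t^-1) s).
    by rewrite mul1r mulr0 addr0.
  exact: is_derive_comp1 d1 dg.
have lt1 s : 0 <= s <= r -> `|s / t| < 1.
  move=> /andP[s0 sr]; rewrite ger0_norm ?divr_ge0 ?(ltW t0) //.
  by rewrite ltr_pdivrMr // mul1r; exact: le_lt_trans rt.
pose G s := F1 (s / t) / t.
have dF s : 0 <= s <= r -> is_derive s 1 (fun s => F (s / t)) (G s).
  by move=> /lt1 s1; apply: dscale; exact: is_derive_profile.
have dG s : 0 <= s <= r -> is_derive s 1 G (F2 (s / t) / t / t).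
  move=> /lt1 s1; have := is_deriveM1 (dscale _ _ _ (is_derive_profile1 s1))
    (is_derive_cst1 (t^-1) s).
  by rewrite mulr0 addr0.
have W s : 0 < s < r -> 0 <= s <= r by move=> /andP[/ltW-> /ltW->].
have := @regular_unique _ N (q_of p w) p (q_of_cont hw) (q_of_bound p0 hw) nu
  (fun s => F (s / t)) G r r0.
rewrite mul0r; apply.
- by apply: within_cont => s /dF/is_derive_cont.
- by apply: within_cont => s /dG/is_derive_cont.
- by rewrite /G mul0r profile_even mul0r.
- by move=> s /W/dF.
move=> s sr; apply: (is_derive_eq (dG s (W s sr))).
have /andP[s0 sr'] := sr.
have st : 0 < s / t < 1.
  by rewrite divr_gt0 //= ltr_pdivrMr // mul1r; exact: lt_trans rt.
have E : t * (s / t) = s by rewrite mulrC divfK.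
rewrite profile_ode // E /G /nu; field.
by rewrite t1 gt_eqF.
Qed.

Lemma eigenfunction_profile :
  (forall x, enorm x < 1 -> f x = f 0 * Phi nu (t * enorm x)) /\
  f 0 * Phi nu t = 0.
Proof.
have F0 : F 0 = f 0 by rewrite /F scale0r.
have t1 : t != 0 by rewrite gt_eqF.
split=> [x x1|].
  rewrite radial_profile ?ltW // -F0 -eigenfunction_profile_in; last first.
    by rewrite mulr_ge0 ?enorm_ge0 ?(ltW t0) //= gtr_pMr.
  by rewrite mulrAC divff // mul1r.
case: Hf => cf [_ [_ Hbd]].
have Ft : F (t / t) = 0 by rewrite divff // /F scale1r Hbd // enorm_ebasis.
(* [D] vanishes inside and is continuous up to [t], so [D t = 0]; this carries the boundary
   condition over to [Phi nu t]. *)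
pose D r := F (r / t) - F 0 * Phi nu r.
have Dz r : 0 < r < t -> D r = 0.
  by move=> /andP[r0 rt]; rewrite /D eigenfunction_profile_in ?subrr // (ltW r0).
have dD r : 0 < r < t -> is_derive r 1 D 0.
  move=> /andP[r0 rt]; apply: (is_derive_near _ (is_derive_cst1 0 r)); near=> s.
  by apply/esym/Dz/andP; split; near: s; [exact: lt_nbhsr|exact: lt_nbhsl].
have cD : {within `[0, t], continuous D}.
  apply: within_continuousB; last first.
    apply: continuous_subspaceT => s.
    by apply: cvgM; [exact: cvg_cst|exact: Phi_cont].
  have cray : continuous (fun r : R => (r / t) *: e0).
    move=> r; apply: cvgZl; apply: cvgM; [exact: cvg_id|exact: cvg_cst].
  apply: (within_continuous_comp cf cray) => r /=; rewrite in_itv /= => /andP[r0 rt].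
  rewrite enorm_ray ger0_norm ?divr_ge0 ?(ltW t0) //.
  by rewrite ler_pdivrMr // mul1r.
have [c _] := MVT1 t0 cD dD; rewrite mul0r => /eqP.
have -> : D 0 = 0 by rewrite /D mul0r Phi0 mulr1 subrr.
by rewrite subr0 /D Ft F0 sub0r oppr_eq0 => /eqP.
Unshelve. all: by end_near. Qed.

End EigenfunctionProfile.

(** * The Morse index *)

Section MorseIndex.
Context {R : realType}.
Variables (N : nat) (p : R) (w : R -> R).
Hypotheses (p0 : 0 < p) (hw : is_w N.+1 p w).
Local Notation V := 'rV[R]_N.+1.
Local Notation Phi := (Phi N (q_of_cont hw) (q_of_bound p0 hw)).
Local Notation zeros_ge := (zeros_ge N (q_of_cont hw) (q_of_bound p0 hw)).

(** For each [i < k] there is an eigenvalue whose solution has exactly [i] zeros before [t];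
    different counts make the eigenvalues distinct, and distinct parameters give independent
    functions. *)
Lemma morse_lower (t : R) k : 0 < t -> zeros_ge 0 k t ->
  exists fs : 'I_k -> V -> R, neg_eigen_family p w t fs.
Proof.
move=> t0 Hk.
have Hex (i : 'I_k) : exists nu : R,
    [/\ nu < 0, Phi nu t = 0, zeros_ge nu i t & ~ zeros_ge nu i.+1 t].
  by apply: eigenvalue_exists t0 _; exact: zeros_ge_leq (ltn_ord i) Hk.
have [nus Hnu] := choice Hex.
have inj : injective nus.
  move=> i j E; apply/val_inj; have [_ _ zi zi'] := Hnu i; have [_ _ zj zj'] := Hnu j.
  rewrite E in zi zi'; case: (ltngtP i j) => // ij.
    by case: zi'; exact: zeros_ge_leq ij zj.
  by case: zj'; exact: zeros_ge_leq ij zi.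
exists (fun i x => Phi (nus i) (t * enorm x)); split.
  move=> i; have [n0 Pt _ _] := Hnu i; exists (t ^+ 2 * nus i); split.
    by rewrite pmulr_rlt0 // exprn_gt0.
  exact: Phi_eigenfunction.
move=> c Hc.
suff H r : 0 < r < t -> \sum_i c i * Phi (nus i) r = 0 by exact: (Phi_lin_indep t0 inj H).
move=> /andP[r0 rt].
have e1 : enorm ((r / t) *: ebasis R (ord0 : 'I_N.+1)) = r / t.
  by rewrite enormZ enorm_ebasis mulr1 gtr0_norm // divr_gt0.
have r1 : enorm ((r / t) *: ebasis R (ord0 : 'I_N.+1)) < 1.
  by rewrite e1 ltr_pdivrMr // mul1r.
by have := Hc _ r1; rewrite e1 mulrC divfK // gt_eqF.
Qed.

(** Each member of the family is a multiple of some [Phi nu] and does not vanish at the origin.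
    Independence forbids equal parameters, so [k] functions give [k] distinct eigenvalues. *)
Lemma morse_upper (t : R) k : 0 < t ->
  (exists fs : 'I_k -> V -> R, neg_eigen_family p w t fs) -> zeros_ge 0 k t.
Proof.
move=> t0 [fs [Hfs Hind]]; have [mus Hmu] := choice Hfs.
pose nus i := mus i / t ^+ 2.
have prof i x : enorm x < 1 -> fs i x = fs i 0 * Phi (nus i) (t * enorm x).
  by have [m0 Hi] := Hmu i; exact: (eigenfunction_profile p0 hw t0 m0 Hi).1.
have delta i (d : R) x : \sum_j (if j == i then d else 0) * fs j x = d * fs i x.
  rewrite (bigD1 i) //= eqxx big1 ?addr0 // => j /negbTE ->.
  by rewrite mul0r.
have fs0 i : fs i 0 != 0.
  apply/eqP => fi0; have := Hind (fun j => if j == i then 1 else 0).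
  move=> /(_ _ i)/=; rewrite eqxx => H; suff : (1 : R) = 0 by apply/eqP; rewrite oner_eq0.
  by apply: H => x x1; rewrite delta prof // fi0 mul0r mulr0.
apply: (eigenvalue_count (nus := nus) t0).
- move=> i j E; apply/eqP/negPn/negP => ij.
  (* With equal parameters, [fs j 0] times [fs i] minus [fs i 0] times [fs j] is zero on the
     ball. *)
  pose c l := (if l == i then fs j 0 else 0) + (if l == j then - fs i 0 else 0).
  have ci : c i = 0.
    apply: Hind => x x1; rewrite /c.
    under eq_bigr do rewrite mulrDl.
    rewrite big_split /= !delta (prof i x x1) (prof j x x1) E; ring.
  by move: ci (fs0 j); rewrite /c eqxx (negbTE ij) addr0 => ->; rewrite eqxx.
- by move=> i; rewrite /nus ltr_pdivrMr ?exprn_gt0 // mul0r; have [] := Hmu i.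
- move=> i; have [m0 Hi] := Hmu i.
  have /eqP := (eigenfunction_profile p0 hw t0 m0 Hi).2.
  by rewrite mulf_eq0 (negbTE (fs0 i)) => /eqP.
Qed.

Lemma morse_index_zeros (t : R) k : 0 < t -> zeros_ge 0 k t -> ~ zeros_ge 0 k.+1 t ->
  morse_index_is N.+1 p w t k.
Proof.
move=> t0 Hk Hk1; split; first exact: morse_lower.
by move=> /(morse_upper t0).
Qed.

Lemma lam_critical_Phi (t : R) : 0 < t -> derive1 (lam p w) t = 0 -> Phi 0 t = 0.
Proof. by move=> t0 /eqP; rewrite (lam_critical hw) // PhiE // => /eqP. Qed.

Lemma lam_nondegenerate (t : R) : 0 < t -> derive1 (lam p w) t = 0 ->
  derive1n 2 (lam p w) t != 0.
Proof.
move=> t0 l0; have Pt := lam_critical_Phi t0 l0.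
rewrite (lam_second hw) //; last by rewrite -(PhiE p0 hw t0).
rewrite !mulf_neq0 ?pnatr_eq0 ?(gt_eqF t0) ?(gt_eqF (wN_gt0 hw _ t0)) //.
have := Phi_simple t0 Pt; suff -> : dphi N p w t = dPhi N (q_of_cont hw) (q_of_bound p0 hw) 0 t.
  by [].
have [_ <-] := is_derive_Phi N (q_of_cont hw) (q_of_bound p0 hw) 0 t.
have E : \forall r \near t, phi p w r = Phi 0 r.
  by near=> r; rewrite PhiE //; near: r; exact: lt_nbhsr.
by have [_ <-] := near_eq_is_derive E (is_derive_phi hw t0).
Unshelve. all: by end_near. Qed.

End MorseIndex.

Unset Implicit Arguments.
Set Strict Implicit.

Theorem theorem5p3 (R : realType) (n : nat) (p : R) (w : R -> R)
  (hn : (0 < n)%N) (hp : 0 < p) (hw : is_w n p w) :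
  (forall tn : R, 0 < tn -> derive1 (lam p w) tn = 0 ->
     derive1n 2 (lam p w) tn != 0) /\
  (forall tn : R, 0 < tn -> derive1 (lam p w) tn = 0 ->
     exists delta : R, 0 < delta /\ delta < tn /\
     exists k : nat,
       (forall t, tn - delta < t < tn -> morse_index_is n p w t k) /\
       (forall t, tn < t < tn + delta -> morse_index_is n p w t k.+1)).
Proof.
case: n hn hw => // N _ hw; split=> [tn|tn tn0 l0].
  exact: (lam_nondegenerate hp hw).
have Pt := lam_critical_Phi hp hw tn0 l0.
(* [d < tn] keeps the left interval within positive [t]; the index before the turn is the number [k]
   of zeros of [Phi 0] in []0, tn[]. *)
have [d [d0 dt Hl Hr]] := zeros_near_zero tn0 Pt.
have [k [Hk Hk1]] := zeros_count N (q_of_cont hw) (q_of_bound hp hw) 0 (ltW tn0).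
exists d; split=> //; split=> //; exists k; split=> t ti.
  have t0 : 0 < t by case/andP: ti => t1 _; apply: lt_trans t1; rewrite subr_gt0.
  by apply: (morse_index_zeros (p0 := hp) (hw := hw)) => //; rewrite Hl.
have t0 : 0 < t by case/andP: ti => t1 _; exact: lt_trans t1.
by apply: (morse_index_zeros (p0 := hp) (hw := hw)) => //; rewrite Hr.
Qed.
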